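(* Let $\check G_N(z)=\sum_{k=1}^q \frac{\check R_k(N)}{z-\mu_k}$ be the model identified by least squares from $N$ samples of the closed-loop system described in the context, and let $\check G^*(z)=\sum_{k=1}^q\frac{\check R_k^*}{z-\mu_k}$ be the asymptotic (expected least-squares) model. Then for every $\epsilon>0$, $$\lim_{N\to\infty}\frac{\|\check G_N(z)-\check G^*(z)\|_2}{N^{-0.5+\epsilon}}=0\quad\text{almost surely},$$ where $\|\cdot\|_2$ denotes the $\mathcal H_2$ norm.
   Context: **System.** Consider a stable discrete-time LTI system with $m$ inputs and $p$ outputs, $y_t=G(z)u_t+H(z)e_t=G(z)u_t+v_t$, where $z$ is the time-shift operator ($zu_t=u_{t+1}$), $\{u_t\}$ is a quasistationary signal, and $\{e_t\}$ is an i.i.d. vector process with zero mean and unit covariance. Let $\mathbb D=\{z\in\mathbb C:|z|<1\}$. **Assumptions.** (i) $G(z)$ and $H(z)$ are strictly stable rational transfer function matrices (all poles in $\mathbb D$), and $G(z)$ has relative degree at least $1$. (ii) The system is controlled by a linear controller $u_t=G_u(z)y_t+H_u(z)\epsilon_t$, where $\{\epsilon_t\}$ is an i.i.d. vector process with zero mean and unit covariance, mutually independent with $\{e_t\}$, and the closed loop is stable. The transfer functions $G_u,H_u$ and the realization of $\epsilon_t$ are known. (iii) The injected probing component $H_u(z)\epsilon_t$ is persistently exciting of sufficiently high order. (As a consequence $u_t$ is persistently exciting of sufficiently high order, which guarantees that the least-squares problems below are well-defined, the finite-sample one after a finite warm-up period, i.e. for all sufficiently large $N$.) **Least squares.** Fix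 distinct poles $\mu_1,\dots,\mu_q\in\mathbb D$. Given samples $u_{1:N},y_{1:N}$, let $$(\check R_1(N),\dots,\check R_q(N))=\arg\min_{\check R_1,\dots,\check R_q\in\mathbb C^{p\times m}}\frac1N\sum_{t=1}^N\Big\|y_t-\sum_{k=1}^q\frac{\check R_k}{z-\mu_k}u_t\Big\|^2,$$ where $\|\cdot\|$ is the Euclidean norm and $\frac{1}{z-\mu_k}u_t$ denotes the state $\check x^{(k)}_t$ of the filter $\check x^{(k)}_{t+1}=\mu_k\check x^{(k)}_t+u_t$ with zero initial state. With $\bar{\mathbb E}(X_t)=\lim_{t\to\infty}\mathbb E(X_t)$, let $$(\check R_1^*,\dots,\check R_q^* )=\arg\min_{\check R_1,\dots,\check R_q\in\mathbb C^{p\times m}}\bar{\mathbb E}\Big\|y_t-\sum_{k=1}^q\frac{\check R_k}{z-\mu_k}u_t\Big\|^2 .$$ **Norm.** For a strictly stable $F(z)$, $\|F\|_2^2=\frac1{2\pi}\int_{-\pi}^{\pi}\mathrm{tr}\big(F(e^{i\omega})F(e^{i\omega})^H\big)\,d\omega$.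
   Formalization: Finite fourth moments of the components of e_t and ε_t are added as an assumption; with only zero mean and unit covariance the rate fails, e.g. for G=0, H=1+h/z, G_u=k, H_u=1, μ_1=0 and heavy-tailed e_t. *)

(* Defs.v *)
(* MathComp-Analysis, over an abstract [R : realType].

   Time is counted from 0, which is the instant of the first sample: the data
   set of length N consists of the samples at t = 0, ..., N - 1.  All filters
   start at rest at time 0. *)
From HB Require Import structures.
From mathcomp Require Import all_boot all_order all_algebra finmap.
From mathcomp Require Import all_classical all_reals all_analysis.
From mathcomp Require Import complex.

Set Implicit Arguments.
Unset Strict Implicit.
Unset Printing Implicit Defensive.

Import Order.TTheory GRing.Theory Num.Theory.
Import numFieldNormedType.Exports.

Local Open Scope classical_set_scope.
Local Open Scope ring_scope.

Section transfer_functions.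
Variable R : realType.

Definition ratfun := {fraction {poly R}}.

(* [frac] is written out because [\d_ x] denotes the Dirac measure here. *)
Definition numer (f : ratfun) : {poly R} := (frac (repr f)).1.
Definition denom (f : ratfun) : {poly R} := (frac (repr f)).2.

(* f = n / d has relative degree (deg d - deg n) at least k; [size] is
   degree + 1, so the shifts cancel.  The zero function has infinite relative
   degree. *)
Definition reldeg_ge (k : nat) (f : ratfun) : Prop :=
  f = 0 \/ (size (numer f) + k <= size (denom f))%N.

Definition proper_mx p m (F : 'M[ratfun]_(p, m)) : Prop :=
  forall i j, reldeg_ge 0 (F i j).

(* z is a finite pole of f when no representation of f as a quotient of
   polynomials has a denominator that is nonzero at z. *)
Definition is_pole (f : ratfun) (z : R[i]) : Prop :=
  forall n d : {poly R}, d != 0 -> f = FracField.tofrac n / FracField.tofrac d ->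
    root (map_poly (real_complex R) d) z.

(* All poles, the point at infinity included, lie in the open unit disc. *)
Definition strictly_stable p m (F : 'M[ratfun]_(p, m)) : Prop :=
  proper_mx F /\
  forall i j z, is_pole (F i j) z -> ComplexField.Normc.normc z < 1.

(* k-th coefficient of the expansion f(z) = \sum_k h_k z^-k at infinity of a
   proper f = n / d: the polynomial part of z^k f(z) is
   \sum_(j <= k) h_j z^(k - j), with constant term h_k. *)
Definition markov (f : ratfun) (k : nat) : R :=
  ((numer f * 'X^k) %/ denom f)`_0.

Definition markov_mx p m (F : 'M[ratfun]_(p, m)) (k : nat) : 'M[R]_(p, m) :=
  \matrix_(i, j) markov (F i j) k.

(* The signal F(z) x_t. *)
Definition filt p m (F : 'M[ratfun]_(p, m)) (x : nat -> 'cV[R]_m) (t : nat)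
  : 'cV[R]_p :=
  \sum_(s < t.+1) markov_mx F s *m x (t - s)%N.

(* The four transfer matrices from the external inputs (e, eps) to the signals
   (u, y) of the loop y = G u + H e, u = Gu y + Hu eps. *)
Definition closed_loop_stable p m ne neps
    (G : 'M[ratfun]_(p, m)) (H : 'M[ratfun]_(p, ne))
    (Gu : 'M[ratfun]_(m, p)) (Hu : 'M[ratfun]_(m, neps)) : Prop :=
  let S := invmx (1%:M - Gu *m G) in
  [/\ strictly_stable (S *m Gu *m H),
      strictly_stable (S *m Hu),
      strictly_stable (G *m S *m Gu *m H + H) &
      strictly_stable (G *m S *m Hu)].

Definition expi (w : R) : R[i] := Complex (cos w) (sin w).

Definition H2norm p m (F : R[i] -> 'M[R[i]]_(p, m)) : R :=
  Num.sqrt ((2 * pi)^-1 *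
    \int[lebesgue_measure]_(w in `[- pi, pi])
      complex.Re (\tr (F (expi w) *m (map_mx (@conjc R) (F (expi w)))^T))).

Definition pole_model p m q (mu : 'I_q -> R[i]) (Rk : 'I_q -> 'M[R[i]]_(p, m))
    (z : R[i]) : 'M[R[i]]_(p, m) :=
  \sum_(k < q) (z - mu k)^-1 *: Rk k.

End transfer_functions.

Section least_squares.
Variable R : realType.

Definition cplx n (v : 'cV[R]_n) : 'cV[R[i]]_n := map_mx (real_complex R) v.

Definition sqnormc n (v : 'cV[R[i]]_n) : R :=
  \sum_(i < n) ComplexField.Normc.normc (v i 0) ^+ 2.

(* The signal 1 / (z - mu) u_t. *)
Fixpoint filter_state m (mu : R[i]) (u : nat -> 'cV[R]_m) (t : nat)
  : 'cV[R[i]]_m :=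
  if t is s.+1 then mu *: filter_state mu u s + cplx (u s) else 0.

Definition sqerror p m q (mu : 'I_q -> R[i]) (y : nat -> 'cV[R]_p)
    (u : nat -> 'cV[R]_m) (Rk : 'I_q -> 'M[R[i]]_(p, m)) (t : nat) : R :=
  sqnormc (cplx (y t) - \sum_(k < q) Rk k *m filter_state (mu k) u t).

Definition sample_cost p m q (mu : 'I_q -> R[i]) (N : nat)
    (y : nat -> 'cV[R]_p) (u : nat -> 'cV[R]_m)
    (Rk : 'I_q -> 'M[R[i]]_(p, m)) : R :=
  N%:R^-1 * \sum_(t < N) sqerror mu y u Rk t.

Definition is_argmin (A : Type) d (V : porderType d) (f : A -> V) (a : A) : Prop :=
  forall b, (f a <= f b)%O.

End least_squares.

Section processes.
Context d (T : measurableType d) (R : realType) (P : probability T R).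

Definition asymptotic_mean (X : nat -> T -> R) : \bar R :=
  lim ((fun t => 'E_P[X t]%E) @ \oo).

Definition asymptotic_cost p m q (mu : 'I_q -> R[i])
    (y : nat -> T -> 'cV[R]_p) (u : nat -> T -> 'cV[R]_m)
    (Rk : 'I_q -> 'M[R[i]]_(p, m)) : \bar R :=
  asymptotic_mean (fun t x => sqerror mu (y ^~ x) (u ^~ x) Rk t).

(* A vector process is a sequence of random tuples; [n.-tuple R] carries the
   product Borel sigma-algebra. *)
Definition vec n (e : nat -> {RV P >-> n.-tuple R}) (t : nat) (x : T) : 'cV[R]_n :=
  \col_i tnth (e t x) i.

Definition iid n (e : nat -> {RV P >-> n.-tuple R}) : Prop :=
  (forall t (B : set (n.-tuple R)), measurable B ->
     P (e t @^-1` B) = P (e 0%N @^-1` B)) /\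
  (forall (J : {fset nat}) (B : nat -> set (n.-tuple R)),
     (forall t, measurable (B t)) ->
     P (\bigcap_(t in [set` J]) (e t @^-1` B t)) =
     (\prod_(t <- J) P (e t @^-1` B t))%E).

Definition zero_mean_unit_cov n (e : nat -> {RV P >-> n.-tuple R}) : Prop :=
  (forall t i, 'E_P[fun x => vec e t x i 0%R] = 0)%E /\
  (forall t i j, covariance P (fun x => vec e t x i 0) (fun x => vec e t x j 0)
                 = (i == j)%:R%:E).

(* Second moments alone do not yield an N^(-1/2 + eta) rate: the least-squares
   error contains time averages of the entries of e_t e_t^T - I, which obey no
   rate when these are merely integrable. *)
Definition finite_fourth_moments n (e : nat -> {RV P >-> n.-tuple R}) : Prop :=
  forall t i, ('E_P[fun x => (vec e t x i 0 ^+ 4)%R] < +oo)%E.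

Definition sigma_of_process n (e : nat -> {RV P >-> n.-tuple R}) : set (set T) :=
  <<s \bigcup_t g_sigma_algebra_preimage (e t) >>.

Definition independent_processes n1 n2 (e1 : nat -> {RV P >-> n1.-tuple R})
    (e2 : nat -> {RV P >-> n2.-tuple R}) : Prop :=
  forall A B, sigma_of_process e1 A -> sigma_of_process e2 B ->
    P (A `&` B) = (P A * P B)%E.

(* Quasistationarity: bounded means and covariances, and convergence of the
   time averages of the covariances at every lag. *)
Definition quasistationary n (w : nat -> T -> 'cV[R]_n) : Prop :=
  (exists C : R,
     (forall t i, (`|'E_P[fun x => w t x i 0%R]| <= C%:E)%E) /\
     (forall t s i j, (`|'E_P[fun x => (w t x i 0 * w s x j 0)%R]| <= C%:E)%E)) /\
  (forall tau i j,
     cvgn (fun N : nat => N%:R^-1 *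
       \sum_(t < N) fine 'E_P[fun x => (w (t + tau)%N x i 0 * w t x j 0)%R])).

(* Persistent excitation of order n: the n x n block covariance matrix of w
   exists and is positive definite.  Its (i, j) block is
   lim_t E[w_(t+i) w_(t+j)^T], the limit covariance at lag i - j. *)
Definition persistently_exciting n m (w : nat -> T -> 'cV[R]_m) : Prop :=
  exists Rw : 'I_n -> 'I_n -> 'M[R]_m,
    (forall (i j : 'I_n) a b,
       (fun t => 'E_P[fun x => (w (t + i)%N x a 0 * w (t + j)%N x b 0)%R]%E)
         @ \oo --> (Rw i j a b)%:E) /\
    (forall c : 'I_n -> 'cV[R]_m, (exists i, c i != 0) ->
       0 < (\sum_(i < n) \sum_(j < n) (c i)^T *m Rw i j *m c j) 0 0).

End processes.

(* Main.v *)
Require Import Defs.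
From HB Require Import structures.
From mathcomp Require Import fingroup perm generic_quotient.
From mathcomp Require Import all_boot all_order all_algebra finmap.
From mathcomp Require Import all_classical all_reals all_analysis.
From mathcomp Require Import complex.
From mathcomp Require Import measurable_realfun.
From mathcomp Require Import lra ring zify.

Set Implicit Arguments.
Unset Strict Implicit.
Unset Printing Implicit Defensive.

Import Order.TTheory GRing.Theory Num.Theory.
Import numFieldNormedType.Exports.

Local Open Scope classical_set_scope.
Local Open Scope ring_scope.

(** Solving the loop shows that the input, the output and the filter states are
    exponentially decaying filters of one white noise [W], the concatenation of
    [e] and [eps].  Sample second moments minus their means are then absolutely
    convergent combinations of time averages of the centred products
    [W_(t-i) W_(t-j) - delta_ij], which are orthogonal in [t] and
    have bounded variance by the fourth moments; block sums thus have variance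
    linear in their length, and Rademacher-Menshov chaining over dyadic blocks
    yields the almost sure growth [N^(1/2+eta)] for every [eta > 0].

    The normal equations transfer this rate to the residues because the limit
    Gram matrix is invertible.  Indeed a residue direction of zero asymptotic
    variance gives an identically zero filter of the noise; clearing
    denominators, it becomes a polynomial in the shift, of order depending only
    on the loop and the poles, that annihilates the probing signal, and
    persistent excitation forces this polynomial to vanish.  Reading it at the
    distinct poles gives zero residues.  Finally the H2 norm of a difference of
    models is bounded by the norms of the differences of their residues. *)

(** * Independence *)

Section independence.
Context d (T : measurableType d) (R : realType) (P : probability T R).

(** The order of excitation has to be fixed before the probing filter [Hu] is known, so the
    annihilating polynomial is built from the return difference [1 - Gu G]: this matrix sends the
    response of the input to [eps] alone back to [Hu eps], and it does not involve [Hu]. For the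
    same reason injectivity of the regressor is stated on impulse-response coefficients: vanishing
    coefficients can be tested on any driving signal, in particular with [e] switched off.

    Markov parameters are computed from one chosen numerator and denominator, while the closed-loop
    identities mix many representations; comparing them requires an intrinsic description, namely
    congruences modulo powers of 1/z in the valuation ring at infinity.

    The centred products are orthogonal in time only for a fixed pair of lags. Passing to signals
    costs the squared total weight of the impulse responses, which exponential decay keeps finite
    uniformly in the horizon.

    The estimates enter path by path, as minimizers only: the perturbation bound applies to any
    solution of the sample normal equations, whichever selection [RN] makes. *)

Lemma indep_g_sigma_algebra (A : set T) (G : set (set T)) :
  measurable A -> G `<=` measurable -> setI_closed G ->
  (forall B, G B -> P (A `&` B) = P A * P B)%E ->
  forall B, <<s G >> B -> P (A `&` B) = (P A * P B)%E.
Proof.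
move=> mA mG GI GP B sB.
pose H := [set B | measurable B /\ P (A `&` B) = (P A * P B)%E].
have HD : dynkin H.
  split.
  - by split=> //; rewrite setIT probability_setT mule1.
  - move=> C [mC PC]; split; first exact: measurableC.
    rewrite probability_setC// -setDE measureD//=; last first.
      exact: le_lt_trans (probability_le1 P mA) (ltry _).
    by rewrite PC muleBr ?mule1 ?fin_num_measure//.
  - move=> F tF HF; have mF n : measurable (F n) by case: (HF n).
    split; first exact: bigcupT_measurable.
    rewrite setI_bigcupr measure_bigcup//=; last 2 first.
      by move=> n _; exact: measurableI.
      exact: trivIset_setIl.
    rewrite measure_bigcup// -(fineK (fin_num_measure P A mA)) -nneseriesZl//.
    rewrite fineK ?fin_num_measure//.
    by apply: eq_eseriesr => n _; case: (HF n).
rewrite -setI_closed_g_dynkin_g_sigma_algebra// in sB.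
by case: (sB H) => //; split=> // C GC; split; [exact: mG|exact: GP].
Qed.

(** The pi-lambda argument is run once on each side, with an event of the other side held fixed. *)
Lemma indep_sigma (GA GB : set (set T)) :
  GA `<=` measurable -> GB `<=` measurable ->
  setI_closed GA -> setI_closed GB ->
  (forall A B, GA A -> GB B -> P (A `&` B) = P A * P B)%E ->
  forall A B, <<s GA >> A -> <<s GB >> B -> P (A `&` B) = (P A * P B)%E.
Proof.
move=> mA mB IA IB PAB A B sA sB.
have mB' : measurable B.
  by apply: sB; split=> //; exact: sigma_algebra_measurable.
rewrite setIC muleC; apply: (@indep_g_sigma_algebra B GA) => // C GC.
rewrite setIC muleC; apply: (@indep_g_sigma_algebra C GB) => //.
- exact: mA.
- by move=> D GD; exact: PAB.
Qed.

(** The joint law agrees with the product law on rectangles, hence everywhere, and Fubini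
    applies. *)
Lemma expectation_mul_indep (U V : T -> R) :
  measurable_fun setT U -> measurable_fun setT V ->
  (forall A B, measurable A -> measurable B ->
     P (U @^-1` A `&` V @^-1` B) = (P (U @^-1` A) * P (V @^-1` B))%E) ->
  P.-integrable setT (EFin \o U) -> P.-integrable setT (EFin \o V) ->
  P.-integrable setT (EFin \o (fun x => U x * V x)) ->
  \int[P]_x (U x * V x) = (\int[P]_x U x) * (\int[P]_x V x).
Proof.
move=> mU mV ind iU iV iUV.
pose X : {RV P >-> R} := HB.pack U (isMeasurableFun.Build _ _ _ _ U mU).
pose Y : {RV P >-> R} := HB.pack V (isMeasurableFun.Build _ _ _ _ V mV).
pose UV x := (U x, V x).
have mUV : measurable_fun setT UV by exact: measurable_fun_pair.
pose XY : {RV P >-> (R * R)%type} :=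
  HB.pack UV (isMeasurableFun.Build _ _ _ _ UV mUV).
pose f := (fun z : measurableTypeR R * measurableTypeR R => (z.1 * z.2)%:E).
have mf : measurable_fun setT f.
  by apply/measurable_EFinP; exact: measurable_funM.
have eqZ A : measurable A ->
    (distribution P X \x distribution P Y)%E A = distribution P XY A.
  move=> mA; by apply: product_measure_unique.
have iZ : (distribution P XY).-integrable setT f.
  exact: integrable_pushforward.
have iprod : (distribution P X \x distribution P Y)%E.-integrable setT f.
  apply/integrableP; split=> //.
  case/integrableP: iZ => _; congr (_ < _)%E.
  by apply: eq_measure_integral => A mA _; apply: esym; exact: eqZ.
have iX : (\int[distribution P X]_x x%:E = \int[P]_x (U x)%:E)%E.
  by rewrite integral_distribution//; exact/measurable_EFinP.
have iY : (\int[distribution P Y]_x x%:E = \int[P]_x (V x)%:E)%E.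
  by rewrite integral_distribution//; exact/measurable_EFinP.
have idX : (distribution P X).-integrable setT (EFin \o (@idfun R)).
  by apply: integrable_pushforward => //; exact: EFin_measurable.
have idY : (distribution P Y).-integrable setT (EFin \o (@idfun R)).
  by apply: integrable_pushforward => //; exact: EFin_measurable.
have finX : (\int[P]_x (U x)%:E)%E \is a fin_num by exact: integrable_fin_num.
have finY : (\int[P]_x (V x)%:E)%E \is a fin_num by exact: integrable_fin_num.
rewrite /Rintegral -fineM//; congr fine.
transitivity (\int[distribution P XY]_z f z)%E.
  by rewrite integral_distribution.
transitivity (\int[distribution P X \x distribution P Y]_z f z)%E.
  by apply: eq_measure_integral => A mA _; apply: esym; exact: eqZ.
rewrite -integral12_prod_meas1// /fubini_F /f /=.
under eq_integral => x _.
  under eq_integral => y _ do rewrite EFinM.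
  rewrite integralZl// iY.
  over.
by rewrite -(fineK finY) integralZr// iX.
Qed.

End independence.

(** * The noise at one time against the noise at all other times *)

Section noise.
Context d (T : measurableType d) (R : realType) (P : probability T R).

(* A family [A] that is eventually [setT] encodes a finite family of constraints. *)
Lemma prob_cylinder n (e : nat -> {RV P >-> n.-tuple R}) (k : nat)
    (A : nat -> set (n.-tuple R)) :
  iid e -> (forall t, measurable (A t)) -> (forall t, (k <= t)%N -> A t = setT) ->
  P (\bigcap_t (e t @^-1` A t)) = (\prod_(t < k) P (e t @^-1` A t))%E.
Proof.
move=> [_ ie] mA AT.
have := ie [fset t in iota 0 k]%fset A mA.
have -> : \bigcap_(t in [set` [fset t in iota 0 k]%fset]) (e t @^-1` A t)
   = \bigcap_t (e t @^-1` A t).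
  apply/seteqP; split=> x /= Ax t /= _; last exact: Ax.
  have [tk|kt] := ltnP t k; last by rewrite /preimage/= AT.
  by apply: Ax; rewrite /= !inE mem_iota add0n.
move=> ->.
rewrite -(big_mkord xpredT (fun t => P (e t @^-1` A t))).
apply: perm_big; apply: uniq_perm; rewrite ?iota_uniq ?fset_uniq//.
by move=> t; rewrite !inE /index_iota subn0.
Qed.

Lemma measurable_cylinder n (e : nat -> {RV P >-> n.-tuple R})
    (A : nat -> set (n.-tuple R)) :
  (forall t, measurable (A t)) -> measurable (\bigcap_t (e t @^-1` A t)).
Proof.
move=> mA; apply: bigcapT_measurable => t.
by rewrite -[X in measurable X]setTI; exact: measurable_funPT.
Qed.

Lemma sigma_of_process_cylinder n (e : nat -> {RV P >-> n.-tuple R})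
    (A : nat -> set (n.-tuple R)) :
  (forall t, measurable (A t)) -> sigma_of_process e (\bigcap_t (e t @^-1` A t)).
Proof.
move=> mA.
apply: (@bigcapT_measurable _
  (g_sigma_algebraType (\bigcup_t g_sigma_algebra_preimage (e t)))) => t.
by apply: sub_sigma_algebra; exists t => //; exists (A t) => //; rewrite setTI.
Qed.

Definition set_at n (s : nat) (A0 : set (n.-tuple R)) (A : nat -> set (n.-tuple R)) t :=
  if t == s then A0 else A t.

Lemma cylinder_set_at n (e : nat -> {RV P >-> n.-tuple R}) s A0 A :
  A s = setT ->
  \bigcap_t (e t @^-1` set_at s A0 A t) =
  e s @^-1` A0 `&` \bigcap_t (e t @^-1` A t).
Proof.
move=> As; apply/seteqP; split=> [x h|x [h0 h] t _].
  split; first by have := h s I; rewrite /set_at eqxx.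
  move=> t _; have := h t I; rewrite /set_at.
  by case: eqP => // ->; rewrite /preimage /= As.
by rewrite /set_at; case: eqP => [->//|_]; exact: h.
Qed.

Lemma measurable_set_at n s (A0 : set (n.-tuple R)) A : measurable A0 ->
  (forall t, measurable (A t)) -> forall t, measurable (set_at s A0 A t).
Proof. by move=> mA0 mA t; rewrite /set_at; case: eqP. Qed.

Lemma prob_cylinder_set_at n (e : nat -> {RV P >-> n.-tuple R}) s k A0 A :
  iid e -> measurable A0 -> (forall t, measurable (A t)) ->
  (forall t, (k <= t)%N -> A t = setT) -> A s = setT ->
  P (\bigcap_t (e t @^-1` set_at s A0 A t)) =
  (P (e s @^-1` A0) * P (\bigcap_t (e t @^-1` A t)))%E.
Proof.
move=> ie mA0 mA AT As.
pose K := maxn k s.+1.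
have sK : (s < K)%N by rewrite leq_maxr.
rewrite (@prob_cylinder _ e K)//; last 2 first.
- exact: measurable_set_at.
- move=> t; rewrite geq_max => /andP[kt st].
  by rewrite /set_at gtn_eqF// AT.
rewrite (@prob_cylinder _ e K)//; last first.
  by move=> t; rewrite geq_max => /andP[kt _]; exact: AT.
rewrite (bigD1 (Ordinal sK))//= [in RHS](bigD1 (Ordinal sK))//=.
rewrite {1}/set_at eqxx As preimage_setT probability_setT mul1e; congr (_ * _)%E.
by apply: eq_bigr => i /negPf ne; rewrite /set_at -(inj_eq val_inj)/= in ne *; rewrite ne.
Qed.

Variables (ne neps : nat) (e : nat -> {RV P >-> ne.-tuple R})
  (eps : nat -> {RV P >-> neps.-tuple R}).

Definition noise (t : nat) (c : 'I_ne + 'I_neps) (x : T) : R :=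
  match c with inl a => vec e t x a 0 | inr b => vec eps t x b 0 end.

Definition present (s : nat) : set (set T) :=
  [set E | exists A B, [/\ measurable A, measurable B &
     E = e s @^-1` A `&` eps s @^-1` B]].

(** A pi-system generating the noise at all times except [s]: the constraint at [s] is trivial, and
    [k] bounds the constrained times so that probabilities are finite products. *)
Definition others (s : nat) : set (set T) :=
  [set E | exists k A B, [/\ (forall t, measurable (A t)) /\ (forall t, measurable (B t)),
     A s = setT /\ B s = setT,
     forall t, (k <= t)%N -> A t = setT /\ B t = setT &
     E = \bigcap_t (e t @^-1` A t) `&` \bigcap_t (eps t @^-1` B t)]].

Lemma setI_closed_present s : setI_closed (present s).
Proof.
move=> _ _ [A [B [mA mB ->]]] [A' [B' [mA' mB' ->]]].
exists (A `&` A'), (B `&` B'); split; [exact: measurableI|exact: measurableI|].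
by rewrite !preimage_setI setIACA.
Qed.

Lemma setI_closed_others s : setI_closed (others s).
Proof.
move=> _ _ [k [A [B [[mA mB] [As Bs] ABT ->]]]] [k' [A' [B' [[mA' mB'] [As' Bs'] ABT' ->]]]].
exists (maxn k k'), (fun t => A t `&` A' t), (fun t => B t `&` B' t); split.
- by split=> t; apply: measurableI.
- by rewrite As As' Bs Bs' !setIT.
- move=> t; rewrite geq_max => /andP[kt kt'].
  by have [-> ->] := ABT t kt; have [-> ->] := ABT' t kt'; rewrite !setIT.
- by rewrite setIACA; congr (_ `&` _); rewrite -bigcapI.
Qed.

Lemma measurable_present s : present s `<=` measurable.
Proof.
move=> _ [A [B [mA mB ->]]].
by apply: measurableI; rewrite -[X in measurable X]setTI; exact: measurable_funPT.
Qed.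

Lemma measurable_others s : others s `<=` measurable.
Proof.
move=> _ [k [A [B [[mA mB] _ _ ->]]]].
by apply: measurableI; exact: measurable_cylinder.
Qed.

Hypotheses (ie : iid e) (ieps : iid eps) (indep : independent_processes e eps).

Lemma prob_cylinders A B : (forall t, measurable (A t)) -> (forall t, measurable (B t)) ->
  P (\bigcap_t (e t @^-1` A t) `&` \bigcap_t (eps t @^-1` B t)) =
  (P (\bigcap_t (e t @^-1` A t)) * P (\bigcap_t (eps t @^-1` B t)))%E.
Proof. by move=> mA mB; apply: indep; exact: sigma_of_process_cylinder. Qed.

Lemma prob_present s A B : measurable A -> measurable B ->
  P (e s @^-1` A `&` eps s @^-1` B) = (P (e s @^-1` A) * P (eps s @^-1` B))%E.
Proof.
move=> mA mB; apply: indep; apply: sub_sigma_algebra.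
- by exists s => //; exists A => //; rewrite setTI.
- by exists s => //; exists B => //; rewrite setTI.
Qed.

(** On generators, writing the present constraint into the free slot at [s] merges each pair of
    events into one cylinder per process; the two processes are then split by mutual independence,
    and each cylinder by independence in time. *)
Lemma indep_present_others s A B :
  <<s present s >> A -> <<s others s >> B -> P (A `&` B) = (P A * P B)%E.
Proof.
apply: indep_sigma; [exact: measurable_present|exact: measurable_others|
  exact: setI_closed_present|exact: setI_closed_others|].
move=> {}A {}B [A0 [B0 [mA0 mB0 ->]]] [k [A' [B' [[mA mB] [As Bs] AB ->]]]].
rewrite setIACA -!cylinder_set_at// [LHS]prob_cylinders; last 2 first.
- exact: measurable_set_at.
- exact: measurable_set_at.
have AT t : (k <= t)%N -> A' t = setT by move=> /AB[].
have BT t : (k <= t)%N -> B' t = setT by move=> /AB[].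
rewrite !(prob_cylinder_set_at (k := k))//.
by rewrite prob_present// prob_cylinders// muleACA.
Qed.

End noise.

(** * White noise *)

Section fourth_moments.
Context d (T : measurableType d) (R : realType) (P : probability T R).

Definition L4 (f : T -> R) : Prop :=
  measurable_fun setT f /\ P.-integrable setT (EFin \o (fun x => f x ^+ 4)).

Lemma L4_cst (r : R) : L4 (fun=> r).
Proof.
split; first exact: measurable_cst.
exact: (@finite_measure_integrable_cst _ _ _ P setT (r ^+ 4)).
Qed.

(** Two rounds of [|xy| <= (x^2 + y^2) / 2]. *)
Lemma normr_mul4_le (a b c e : R) :
  `|a * b * c * e| <= a ^+ 4 + b ^+ 4 + c ^+ 4 + e ^+ 4.
Proof.
have sq (x y : R) : `|x * y| <= (x ^+ 2 + y ^+ 2) / 2.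
  rewrite ler_norml; apply/andP; split.
    have : 0 <= (x + y) ^+ 2 by exact: sqr_ge0.
    by rewrite !expr2; nra.
  have : 0 <= (x - y) ^+ 2 by exact: sqr_ge0.
  by rewrite !expr2; nra.
have h1 := sq (a * b) (c * e).
have h2 := sq (a ^+ 2) (b ^+ 2); have h3 := sq (c ^+ 2) (e ^+ 2).
rewrite -exprMn in h2; rewrite -exprMn in h3.
rewrite -!exprM in h2 h3.
have h2' := le_trans (ler_norm _) h2; have h3' := le_trans (ler_norm _) h3.
have p1 : 0 <= a ^+ 4 by rewrite (exprM a 2 2) sqr_ge0.
have p2 : 0 <= b ^+ 4 by rewrite (exprM b 2 2) sqr_ge0.
have p3 : 0 <= c ^+ 4 by rewrite (exprM c 2 2) sqr_ge0.
have p4 : 0 <= e ^+ 4 by rewrite (exprM e 2 2) sqr_ge0.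
rewrite -(mulrA (a * b)); apply: (le_trans h1).
rewrite /= in h2' h3'.
move: h2' h3'.
set u := a ^+ 4 in p1 *; set v := b ^+ 4 in p2 *.
set w := c ^+ 4 in p3 *; set z := e ^+ 4 in p4 *.
by rewrite ?(mulnE) /=; lra.
Qed.

Lemma integrable_mul4 f g h k : L4 f -> L4 g -> L4 h -> L4 k ->
  P.-integrable setT (EFin \o (fun x => f x * g x * h x * k x)).
Proof.
move=> [mf if4] [mg ig] [mh ih] [mk ik].
have := integrableD measurableT (integrableD measurableT
  (integrableD measurableT if4 ig) ih) ik.
apply: le_integrable => //.
  by apply/measurable_EFinP; do 3! apply: measurable_funM => //.
move=> x _ /=; rewrite lee_fin; apply: le_trans (ler_norm _).
exact: normr_mul4_le.
Qed.

Lemma integrable_mul3 f g h : L4 f -> L4 g -> L4 h ->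
  P.-integrable setT (EFin \o (fun x => f x * g x * h x)).
Proof.
move=> lf lg lh; have := integrable_mul4 lf lg lh (L4_cst 1).
by apply: eq_integrable => //= x _; rewrite mulr1.
Qed.

Lemma integrable_mul2 f g : L4 f -> L4 g ->
  P.-integrable setT (EFin \o (fun x => f x * g x)).
Proof.
move=> lf lg; have := integrable_mul3 lf lg (L4_cst 1).
by apply: eq_integrable => //= x _; rewrite mulr1.
Qed.

Lemma integrable_L4 f : L4 f -> P.-integrable setT (EFin \o f).
Proof.
move=> lf; have := integrable_mul2 lf (L4_cst 1).
by apply: eq_integrable => //= x _; rewrite mulr1.
Qed.

(** Exactly what the variance estimate consumes: [wn_orth3] serves products with distinct lags,
    where the latest noise time occurs in a single factor, and [wn_orth2] those with equal lags,
    where each time carries a whole centred product. *)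
Record white_noise (I : finType) (W : nat -> I -> T -> R) : Prop := WhiteNoise {
  wn_L4 : forall t c, L4 (W t c);
  wn_bound : exists K, forall t c, \int[P]_x (W t c x ^+ 4) <= K;
  wn_cov : forall t s c c',
    \int[P]_x (W t c x * W s c' x) = ((t == s) && (c == c'))%:R;
  wn_orth3 : forall s c r1 r2 r3 c1 c2 c3, r1 != s -> r2 != s -> r3 != s ->
    \int[P]_x (W s c x * (W r1 c1 x * W r2 c2 x * W r3 c3 x)) = 0;
  wn_orth2 : forall s r c c' c1 c1', r != s ->
    \int[P]_x ((W s c x * W s c' x - (c == c')%:R) *
               (W r c1 x * W r c1' x - (c1 == c1')%:R)) = 0
}.

Variables (ne neps : nat) (e : nat -> {RV P >-> ne.-tuple R})
  (eps : nat -> {RV P >-> neps.-tuple R}).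
Hypotheses (ie : iid e) (ieps : iid eps) (indep : independent_processes e eps).
Hypotheses (cove : zero_mean_unit_cov e) (coveps : zero_mean_unit_cov eps).
Hypotheses (m4e : finite_fourth_moments e) (m4eps : finite_fourth_moments eps).

Lemma measurable_vec n (f : nat -> {RV P >-> n.-tuple R}) t a :
  measurable_fun setT (fun x => vec f t x a 0).
Proof.
under eq_fun do rewrite mxE.
apply: (@measurableT_comp _ _ _ _ _ _ (fun z : n.-tuple R => tnth z a)) => //.
exact: measurable_tnth.
Qed.

Lemma L4_vec n (f : nat -> {RV P >-> n.-tuple R}) t a :
  finite_fourth_moments f -> L4 (fun x => vec f t x a 0).
Proof.
move=> /(_ t a); rewrite unlock => h; split; first exact: measurable_vec.
apply/integrableP; split.
  by apply/measurable_EFinP; apply: measurable_funX; exact: measurable_vec.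
congr (_ < _)%E: h; apply: eq_integral => x _ /=.
by rewrite ger0_norm// (exprM _ 2 2) sqr_ge0.
Qed.

Lemma fourth_moment_stationary n (f : nat -> {RV P >-> n.-tuple R}) t a : iid f ->
  \int[P]_x (vec f t x a 0 ^+ 4) = \int[P]_x (vec f 0%N x a 0 ^+ 4).
Proof.
move=> [sf _]; rewrite /Rintegral; congr fine.
pose g (z : n.-tuple R) := (tnth z a ^+ 4)%:E.
have mg : measurable_fun setT g.
  apply/measurable_EFinP; apply: measurable_funX; exact: measurable_tnth.
have h s : (\int[P]_x (vec f s x a 0 ^+ 4)%:E = \int[distribution P (f s)]_z g z)%E.
  rewrite ge0_integral_distribution//.
    by apply: eq_integral => x _; rewrite /g /= /vec mxE.
  by move=> z; rewrite lee_fin (exprM _ 2 2) sqr_ge0.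
by rewrite !h; apply: eq_measure_integral => A mA _; exact: sf.
Qed.

Local Notation W := (noise e eps).

Definition sub_measurable (G : set (set T)) (f : T -> R) :=
  measurable_fun setT (f : g_sigma_algebraType G -> R).

Lemma sub_measurable_preimage G f A : sub_measurable G f -> measurable A ->
  <<s G >> (f @^-1` A).
Proof. by move=> mf mA; have := mf measurableT A mA; rewrite setTI. Qed.

Lemma sub_measurable_present s c : sub_measurable (present e eps s) (W s c).
Proof.
move=> _ A mA; rewrite setTI; apply: sub_sigma_algebra.
case: c => a.
- exists ((fun z : ne.-tuple R => tnth z a) @^-1` A), setT; split=> //.
    rewrite -[X in measurable X]setTI; exact: measurable_tnth.
  rewrite preimage_setT setIT; apply/seteqP; split=> x; by rewrite /preimage /= /vec mxE.
- exists setT, ((fun z : neps.-tuple R => tnth z a) @^-1` A); split=> //.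
    rewrite -[X in measurable X]setTI; exact: measurable_tnth.
  rewrite preimage_setT setTI; apply/seteqP; split=> x; by rewrite /preimage /= /vec mxE.
Qed.

Lemma cylinderT n (f : nat -> {RV P >-> n.-tuple R}) :
  \bigcap_t (f t @^-1` setT) = setT.
Proof. by apply/seteqP; split. Qed.

Lemma sub_measurable_others s r c : r != s -> sub_measurable (others e eps s) (W r c).
Proof.
move=> rs _ A mA; rewrite setTI; apply: sub_sigma_algebra.
have atT n (B : set (n.-tuple R)) : set_at r B (fun=> setT) s = setT.
  by rewrite /set_at eq_sym (negPf rs).
have leT n (B : set (n.-tuple R)) t : (r < t)%N -> set_at r B (fun=> setT) t = setT.
  by move=> rt; rewrite /set_at gtn_eqF.
case: c => a.
- pose B := (fun z : ne.-tuple R => tnth z a) @^-1` A.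
  have mB : measurable B by rewrite -[X in measurable X]setTI; exact: measurable_tnth.
  exists r.+1, (set_at r B (fun=> setT)), (fun=> setT); split=> //.
  + by split=> // t; exact: measurable_set_at.
  + by rewrite atT.
  + by move=> t rt; split=> //; exact: leT.
  + rewrite cylinder_set_at// !cylinderT !setIT.
    by apply/seteqP; split=> x; rewrite /preimage /= /vec mxE.
- pose B := (fun z : neps.-tuple R => tnth z a) @^-1` A.
  have mB : measurable B by rewrite -[X in measurable X]setTI; exact: measurable_tnth.
  exists r.+1, (fun=> setT), (set_at r B (fun=> setT)); split=> //.
  + by split=> // t; exact: measurable_set_at.
  + by rewrite atT.
  + by move=> t rt; split=> //; exact: leT.
  + rewrite cylinder_set_at// !cylinderT setIT setTI.
    by apply/seteqP; split=> x; rewrite /preimage /= /vec mxE.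
Qed.

Lemma noise_mul_indep s U V :
  sub_measurable (present e eps s) U -> sub_measurable (others e eps s) V ->
  P.-integrable setT (EFin \o U) -> P.-integrable setT (EFin \o V) ->
  P.-integrable setT (EFin \o (fun x => U x * V x)) ->
  \int[P]_x (U x * V x) = (\int[P]_x U x) * (\int[P]_x V x).
Proof.
move=> mU mV iU iV iUV; apply: expectation_mul_indep => //.
- by apply/measurable_EFinP; case/integrableP: iU.
- by apply/measurable_EFinP; case/integrableP: iV.
- move=> A B mA mB; apply: (indep_present_others ie ieps indep (s := s));
  exact: sub_measurable_preimage.
Qed.

Lemma L4_noise t c : L4 (W t c).
Proof. by case: c => a; exact: L4_vec. Qed.

Lemma noise_mean t c : \int[P]_x W t c x = 0.
Proof.
by case: c => a; [have := cove.1 t a|have := coveps.1 t a];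
  rewrite unlock /Rintegral => ->.
Qed.

Lemma noise_cov_present t c c' : \int[P]_x (W t c x * W t c' x) = (c == c')%:R.
Proof.
have cov n (f : nat -> {RV P >-> n.-tuple R}) a b : zero_mean_unit_cov f ->
    \int[P]_x (vec f t x a 0 * vec f t x b 0) = (a == b)%:R.
  move=> [m0 cv]; have := cv t a b; rewrite unlock !m0 /= unlock => h.
  rewrite /Rintegral -[RHS]/(fine ((a == b)%:R : R)%:E) -h; congr fine.
  by apply: eq_integral => x _ /=; rewrite [in RHS]/GRing.mul /= !subr0.
(* Components of [e] and [eps] at the same time are uncorrelated because the processes are
   independent and centred. *)
have crs a b : \int[P]_x (W t (inl a) x * W t (inr b) x) = 0.
  rewrite expectation_mul_indep ?noise_mean ?mul0r//.
  - exact: (L4_noise t (inl a)).1.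
  - exact: (L4_noise t (inr b)).1.
  - move=> A B mA mB.
    have pre n (f : nat -> {RV P >-> n.-tuple R}) i D :
        (fun x => vec f t x i 0) @^-1` D =
        f t @^-1` ((fun z : n.-tuple R => tnth z i) @^-1` D).
      by apply/seteqP; split=> x; rewrite /preimage /= /vec mxE.
    rewrite /= !pre prob_present//; rewrite -[X in measurable X]setTI;
    exact: measurable_tnth.
  - by apply: integrable_L4; exact: L4_noise.
  - by apply: integrable_L4; exact: L4_noise.
  - by apply: integrable_mul2; exact: L4_noise.
case: c c' => [a|a] [b|b].
- by rewrite /= cov//.
- by rewrite crs.
- by rewrite -[RHS](crs b a); apply: eq_Rintegral => x _; rewrite mulrC.
- by rewrite /= cov//.
Qed.

Lemma white_noise_noise : white_noise W.
Proof.
have L4N := L4_noise.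
split => //.
- exists (\sum_c \int[P]_x (W 0 c x ^+ 4)) => t c.
  have -> : \int[P]_x (W t c x ^+ 4) = \int[P]_x (W 0 c x ^+ 4).
    by case: c => a; exact: fourth_moment_stationary.
  rewrite (bigD1 c)//= lerDl sumr_ge0// => i _.
  by apply: Rintegral_ge0 => x _; rewrite (exprM _ 2 2) sqr_ge0.
- move=> t s c c'; have [->|ts] := eqVneq t s; first exact: noise_cov_present.
  rewrite (@noise_mul_indep t)//.
  + by rewrite noise_mean mul0r.
  + exact: sub_measurable_present.
  + by apply: sub_measurable_others; rewrite eq_sym.
  + exact: integrable_L4.
  + exact: integrable_L4.
  + exact: integrable_mul2.
- move=> s c r1 r2 r3 c1 c2 c3 r1s r2s r3s.
  rewrite (@noise_mul_indep s (W s c) (fun x => W r1 c1 x * W r2 c2 x * W r3 c3 x))//.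
  + by rewrite noise_mean mul0r.
  + exact: sub_measurable_present.
  + by apply: measurable_funM; first apply: measurable_funM; exact: sub_measurable_others.
  + exact: integrable_L4.
  + exact: integrable_mul3.
  + have := integrable_mul4 (L4N s c) (L4N r1 c1) (L4N r2 c2) (L4N r3 c3).
    by apply: eq_integrable => //= x _; rewrite !mulrA.
- move=> s r c c' c1 c1' rs.
  have i2 t a b : P.-integrable setT (EFin \o (fun x => W t a x * W t b x - (a == b)%:R)).
    have := integrableB measurableT (integrable_mul2 (L4N t a) (L4N t b))
      (integrable_L4 (L4_cst ((a == b)%:R))).
    exact: eq_integrable.
  rewrite (@noise_mul_indep s (fun x => W s c x * W s c' x - (c == c')%:R)
    (fun x => W r c1 x * W r c1' x - (c1 == c1')%:R))//.
  + rewrite RintegralB//; last 2 first.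
      exact: integrable_mul2.
      exact: integrable_L4 (L4_cst _).
    rewrite noise_cov_present Rintegral_cst// [X in fine X](_ : _ = 1%E).
      by rewrite mulr1 subrr mul0r.
    exact: probability_setT.
  + apply: measurable_funB => //; apply: measurable_funM; exact: sub_measurable_present.
  + by apply: measurable_funB => //; apply: measurable_funM; exact: sub_measurable_others.
  + pose M := integrable_mul4 (L4N s c) (L4N s c') (L4N r c1) (L4N r c1').
    pose A := integrable_mul2 (L4N s c) (L4N s c').
    pose B := integrable_mul2 (L4N r c1) (L4N r c1').
    have := integrableD measurableT (integrableB measurableT (integrableB measurableT M
      (integrableZl measurableT ((c1 == c1')%:R) A))
      (integrableZl measurableT ((c == c')%:R) B))
      (integrable_L4 (L4_cst ((c == c')%:R * (c1 == c1')%:R))).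
    apply: eq_integrable => //= x _; congr EFin.
    ring.
Qed.

End fourth_moments.

(** * Exponentially decaying sequences *)

Section decay.
Variable R : realType.
Implicit Types h g : nat -> R.

(** The ratio is kept positive because it is divided by below. *)
Definition expdecay h : Prop := exists C rho : R,
  [/\ 0 <= C, 0 < rho, rho < 1 & forall k, `|h k| <= C * rho ^+ k].

Lemma expdecay_le h g : (forall k, `|g k| <= `|h k|) -> expdecay h -> expdecay g.
Proof.
move=> le [C [r [C0 r0 r1 b]]]; exists C, r; split=> // k.
exact: le_trans (le k) (b k).
Qed.

Lemma expdecay_geo (r : R) : `|r| < 1 -> expdecay (fun k => r ^+ k).
Proof.
(* The maximum with 1/2 keeps the ratio positive when [r = 0]. *)
move=> r1; exists 1, (Num.max `|r| (1 / 2)); split=> //.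
- by rewrite gt_max r1 /=; lra.
- by move=> k; rewrite mul1r normrX; apply: lerXn2r; rewrite ?nnegrE// le_max ?normr_ge0 ?lexx.
Qed.

Lemma expdecayD h g : expdecay h -> expdecay g -> expdecay (fun k => h k + g k).
Proof.
move=> [C [r [C0 r0 r1 b]]] [D [s [D0 s0 s1 c]]].
pose m := Num.max r s.
have m0 : 0 < m by rewrite lt_max r0.
have rm : r <= m by rewrite le_max lexx.
have sm : s <= m by rewrite le_max lexx orbT.
exists (C + D), m; split=> //.
- exact: addr_ge0.
- by rewrite gt_max r1.
- move=> k; apply: (le_trans (ler_normD _ _)); rewrite mulrDl; apply: lerD.
    apply: (le_trans (b k)); apply: ler_wpM2l => //.
    by apply: lerXn2r; rewrite ?nnegrE //; exact: ltW.
  apply: (le_trans (c k)); apply: ler_wpM2l => //.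
  by apply: lerXn2r; rewrite ?nnegrE //; exact: ltW.
Qed.

Lemma expdecayZ (a : R) h : expdecay h -> expdecay (fun k => a * h k).
Proof.
move=> [C [r [C0 r0 r1 b]]]; exists (`|a| * C), r; split=> //.
- exact: mulr_ge0.
- by move=> k; rewrite normrM -mulrA; apply: ler_wpM2l.
Qed.

Lemma expdecay0 : expdecay (fun=> 0).
Proof.
exists 0, (1 / 2); split=> //; try lra.
by move=> k; rewrite normr0 mul0r.
Qed.

Lemma expdecay_sum (I : finType) (h : I -> nat -> R) :
  (forall i, expdecay (h i)) -> expdecay (fun k => \sum_i h i k).
Proof.
move=> hh; elim: (index_enum I) => [|i s IH].
  by under eq_fun do rewrite big_nil; exact: expdecay0.
by under eq_fun do rewrite big_cons; exact: expdecayD.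
Qed.

Lemma expdecay_natM h : expdecay h -> expdecay (fun k => k%:R * h k).
Proof.
move=> [C [r [C0 r0 r1 b]]].
(* [s] lies midway between [r] and 1, so [s / r = 1 + x] with [x > 0], and Bernoulli's inequality
   bounds [k x] by [(s / r)^k]: the factor [k] is paid by the larger ratio. *)
pose s := (1 + r) / 2; pose x := s / r - 1.
have s0 : 0 < s by rewrite /s; lra.
have x0 : 0 < x.
  by rewrite /x subr_gt0 ltr_pdivlMr// mul1r /s; lra.
exists (C / x), s; split=> //.
- by rewrite divr_ge0// ltW.
- by rewrite /s; lra.
- move=> k; rewrite normrM ger0_norm//.
  have bern : k%:R * x <= (s / r) ^+ k.
    have -> : s / r = 1 + x by rewrite /x; ring.
    elim: k => [|k IH]; first by rewrite mul0r expr0 ler01.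
    rewrite exprS mulrDl mul1r -addn1 natrD mulrDl mul1r lerD//.
    by apply: ler_peMr; [exact: ltW|rewrite exprn_ege1// lerDl ltW].
  rewrite expr_div_n ler_pdivlMr ?exprn_gt0// in bern.
  apply: (@le_trans _ _ (k%:R * (C * r ^+ k))); first exact: ler_wpM2l.
  rewrite mulrCA -mulrA; apply: ler_wpM2l => //.
  by rewrite ler_pdivlMl// mulrA (mulrC x).
Qed.

Lemma expdecay_unshift h : expdecay (fun k => h k.+1) -> expdecay h.
Proof.
move=> [C [r [C0 r0 r1 b]]]; exists (Num.max `|h 0%N| (C / r)), r; split=> //.
- by rewrite le_max normr_ge0.
- move=> [|k]; first by rewrite expr0 mulr1 le_max lexx.
  apply: (le_trans (b k)); rewrite exprS mulrA; apply: ler_wpM2r.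
    by rewrite exprn_ge0// ltW.
  by rewrite -ler_pdivrMr// le_max lexx orbT.
Qed.

(** Each of the [k + 1] terms is at most [C D m^k]; the factor [k + 1] is absorbed by
    [expdecay_natM]. *)
Lemma expdecay_conv h g : expdecay h -> expdecay g ->
  expdecay (fun k => \sum_(i < k.+1) h i * g (k - i)%N).
Proof.
move=> [C [r [C0 r0 r1 b]]] [D [s [D0 s0 s1 c]]].
pose m := Num.max r s.
have m0 : 0 < m by rewrite lt_max r0.
have rm : r <= m by rewrite le_max lexx.
have sm : s <= m by rewrite le_max lexx orbT.
have em : expdecay (fun k => (C * D) * (k%:R * m ^+ k + m ^+ k)).
  have em : expdecay (fun k => m ^+ k).
    by apply: expdecay_geo; rewrite ger0_norm ?ltW// gt_max r1.
  by apply: expdecayZ; apply: expdecayD => //; exact: expdecay_natM.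
apply: expdecay_le em => k; rewrite [leRHS]ger0_norm; last first.
  by rewrite mulr_ge0// ?mulr_ge0// addr_ge0// ?mulr_ge0// exprn_ge0// ltW.
apply: (le_trans (ler_norm_sum _ _ _)).
apply: (@le_trans _ _ (\sum_(i < k.+1) (C * D) * m ^+ k)).
  apply: ler_sum => i _; rewrite normrM.
  have -> : m ^+ k = m ^+ i * m ^+ (k - i) by rewrite -exprD subnKC// -ltnS.
  rewrite mulrACA; apply: ler_pM => //.
    apply: (le_trans (b i)); apply: ler_wpM2l => //.
    by apply: lerXn2r; rewrite ?nnegrE //; exact: ltW.
  apply: (le_trans (c (k - i)%N)); apply: ler_wpM2l => //.
  by apply: lerXn2r; rewrite ?nnegrE //; exact: ltW.
rewrite sumr_const card_ord -[leLHS]mulr_natr -natr1.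
by rewrite le_eqVlt; apply/orP; left; apply/eqP; ring.
Qed.

Lemma geo_sum_le (r : R) n : 0 <= r -> r < 1 -> \sum_(k < n) r ^+ k <= (1 - r)^-1.
Proof.
move=> r0 r1; rewrite -(ler_pM2l (x := 1 - r)) ?subr_gt0//.
rewrite mulfV ?gt_eqF ?subr_gt0//.
have -> : (1 - r) * (\sum_(k < n) r ^+ k) = 1 - r ^+ n.
  by rewrite -(expr1n _ n) subrXX expr1n; congr (_ * _); apply: eq_bigr => i _; rewrite expr1n mul1r.
by rewrite gerBl exprn_ge0.
Qed.

Lemma expdecay_summable h : expdecay h ->
  exists K, 0 <= K /\ forall n, \sum_(k < n) `|h k| <= K.
Proof.
move=> [C [r [C0 r0 r1 b]]]; exists (C * (1 - r)^-1); split.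
  by rewrite mulr_ge0// invr_ge0 subr_ge0 ltW.
move=> n; apply: (@le_trans _ _ (\sum_(k < n) C * r ^+ k)); first exact: ler_sum.
by rewrite -mulr_sumr; apply: ler_wpM2l => //; exact: geo_sum_le (ltW r0) r1.
Qed.

End decay.

(** Lagrange's identity: twice the defect is the double sum of [w_i w_j (x_i - x_j)^2]. *)
Lemma weighted_cauchy_schwarz (R : realFieldType) (I : finType) (w x : I -> R) :
  (forall i, 0 <= w i) ->
  (\sum_i w i * x i) ^+ 2 <= (\sum_i w i) * \sum_i w i * x i ^+ 2.
Proof.
move=> w0.
have h : 0 <= \sum_i \sum_j w i * w j * (x i - x j) ^+ 2.
  by apply: sumr_ge0 => i _; apply: sumr_ge0 => j _; rewrite mulr_ge0 ?sqr_ge0 ?mulr_ge0.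
have e : \sum_i \sum_j w i * w j * (x i - x j) ^+ 2 =
  2 * ((\sum_i w i) * (\sum_i w i * x i ^+ 2)) - 2 * (\sum_i w i * x i) ^+ 2.
  transitivity (\sum_i \sum_j (w i * x i ^+ 2 * w j + w i * (w j * x j ^+ 2)
                - 2 * ((w i * x i) * (w j * x j)))).
    by apply: eq_bigr => i _; apply: eq_bigr => j _; ring.
  under eq_bigr => i _ do rewrite sumrB big_split/= -!mulr_sumr.
  rewrite sumrB big_split/= -!mulr_suml -mulr_sumr -mulr_suml.
  ring.
by move: h; rewrite e subr_ge0 ler_pM2l.
Qed.

(** * Almost sure growth of partial sums *)

Section chaining.
Context d (T : measurableType d) (R : realType) (P : probability T R).

(** By monotone convergence the sum of all [f k] has finite expectation, so it is finite almost
    everywhere, and it bounds each term. *)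
Lemma ae_bounded_of_summable (f : nat -> T -> R) (b : nat -> R) (K : R) :
  (forall k x, 0 <= f k x) -> (forall k, measurable_fun setT (f k)) ->
  (forall k, (\int[P]_x (f k x)%:E <= (b k)%:E)%E) ->
  (forall n, \sum_(k < n) b k <= K) ->
  {ae P, forall x, exists Z, forall k, f k x <= Z}.
Proof.
move=> f0 mf fb bK.
pose g (x : T) := (\sum_(k <oo) (f k x)%:E)%E.
have g0 x : (0 <= g x)%E by apply: nneseries_ge0 => k _ _; rewrite lee_fin.
have mg : measurable_fun setT g.
  apply: ge0_emeasurable_sum => // k; first by move=> x _ _; rewrite lee_fin.
  by move=> _; exact/measurable_EFinP.
have ig : (\int[P]_x g x <= K%:E)%E.
  rewrite integral_nneseries//; last 2 first.
  - by move=> k; exact/measurable_EFinP.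
  - by move=> k x _; rewrite lee_fin.
  have h k : (0 <= \int[P]_x (f k x)%:E)%E.
    by apply: integral_ge0 => x _; rewrite lee_fin.
  apply: lime_le; first by apply: is_cvg_nneseries => k _ _; exact: h.
  apply: nearW => n; apply: (@le_trans _ _ (\sum_(0 <= k < n) (b k)%:E)%E).
    by apply: lee_sum => k _; exact: fb.
  by rewrite sumEFin lee_fin big_mkord.
have intg : P.-integrable setT g.
  apply/integrableP; split=> //.
  apply: le_lt_trans (ltry K); apply: le_trans ig.
  by under eq_integral do rewrite gee0_abs//.
have := integrable_ae measurableT intg; apply: filterS => x /(_ I) fin.
exists (fine (g x)) => k; rewrite -lee_fin fineK//.
apply: (@le_trans _ _ (\sum_(0 <= j < k.+1) (f j x)%:E)%E).
  rewrite sumEFin lee_fin big_mkord (bigD1 ord_max)//= lerDl.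
  exact: sumr_ge0.
by apply: nneseries_lim_ge => j _ _; rewrite lee_fin.
Qed.

(** Squared increments over all dyadic blocks of [0, 2^k], of lengths [2^j] for [j < k]. *)
Definition dyadic_var (S : nat -> R) (k : nat) : R :=
  \sum_(j < k) \sum_(b < 2 ^ (k - j)) (S (b.+1 * 2 ^ j)%N - S (b * 2 ^ j)%N) ^+ 2.

Lemma dyadic_var_ge0 S k : 0 <= dyadic_var S k.
Proof. by apply: sumr_ge0 => j _; apply: sumr_ge0 => b _; exact: sqr_ge0. Qed.

(** Clearing the binary digits of [n] from the lowest up leads from [n] to 0 in [k] steps, each
    crossing at most one dyadic block; Cauchy-Schwarz over the steps gives the factor [k]. *)
Lemma sqr_le_dyadic_var (S : nat -> R) k n : S 0%N = 0 -> (n < 2 ^ k)%N ->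
  S n ^+ 2 <= k%:R * dyadic_var S k.
Proof.
move=> S0 nk.
pose x (j : nat) := S (n %/ 2 ^ j * 2 ^ j)%N - S (n %/ 2 ^ j.+1 * 2 ^ j.+1)%N.
have tele : S n = \sum_(j < k) x j.
  rewrite -(big_mkord xpredT) -[RHS]opprK -sumrN.
  under eq_bigr do rewrite opprB.
  rewrite telescope_sumr// (divn_small nk) mul0n S0 expn0 divn1 muln1.
  by rewrite sub0r opprK.
have cs := @weighted_cauchy_schwarz R 'I_k (fun=> 1) (fun j => x j) (fun=> ler01).
have e1 : \sum_(i < k) (1 : R) = k%:R by rewrite sumr_const card_ord.
have e2 : \sum_(j < k) 1 * x j = S n.
  by rewrite tele; apply: eq_bigr => j _; rewrite mul1r.
rewrite e1 e2 in cs; apply: (le_trans cs); apply: ler_wpM2l => //.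
apply: ler_sum => j _; rewrite mul1r.
pose h := (n %/ 2 ^ j)%N.
have hj : (n %/ 2 ^ j.+1)%N = h./2 by rewrite expnSr divnMA -divn2.
rewrite /x hj -/h expnS.
(* The parity of [h] is the digit [j] of [n]: if it is 0 nothing moves, otherwise exactly one block
   of length [2^j] is crossed. *)
have [oh|eh] := boolP (odd h); last first.
  have -> : (h./2 * (2 * 2 ^ j) = h * 2 ^ j)%N.
    by rewrite mulnA muln2 -[in RHS](odd_double_half h) (negPf eh).
  by rewrite subrr expr0n /= sumr_ge0// => b _; exact: sqr_ge0.
have hE : h = (h./2.*2).+1 by rewrite -[LHS]odd_double_half oh.
have hb : (h./2.*2 < 2 ^ (k - j))%N.
  rewrite -ltnS -hE ltnS; apply: ltnW.
  by rewrite /h ltn_divLR ?expn_gt0// -expnD subnK// ltnW.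
rewrite (bigD1 (Ordinal hb))//= -hE mulnA muln2 lerDl.
by apply: sumr_ge0 => b _; exact: sqr_ge0.
Qed.

(* Rademacher-Menshov: linear growth of the increments' second moments costs
   only a factor k^2 for the maximum over [0, 2^k). *)
Lemma ae_growth (D : nat -> T -> R) (C : R) : 0 <= C ->
  (forall t, measurable_fun setT (D t)) ->
  (forall m n, (m <= n)%N ->
     (\int[P]_x ((\sum_(m <= t < n) D t x) ^+ 2)%:E <= (C * (n - m)%:R)%:E)%E) ->
  forall eta : R, 0 < eta ->
  {ae P, forall x, exists K, forall N, (0 < N)%N ->
     `|\sum_(t < N) D t x| <= K * N%:R `^ (2^-1 + eta)}.
Proof.
move=> C0 mD hD eta eta0.
pose S x n := \sum_(t < n) D t x.
have SB x m n : (m <= n)%N -> S x n - S x m = \sum_(m <= t < n) D t x.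
  by move=> mn; rewrite /S -!(big_mkord xpredT (D^~ x)) (big_cat_nat (leq0n m) mn)/= addrAC subrr add0r.
have mS n : measurable_fun setT (S^~ n) by exact: measurable_sum.
(* The mean of [dyadic_var] at level [k] is at most [C k 2^k]; the weight [(r / 2)^k k] turns this
   into [C k^2 r^k], which is summable since [r < 1]. *)
pose r : R := 2 `^ (- (2 * eta)).
have r0 : 0 < r by exact: powR_gt0.
have r1 : r < 1.
  rewrite /r powRN invf_lt1 ?powR_gt0//.
  have p1 : 1 `^ (2 * eta) = 1 :> R by rewrite powR1.
  rewrite -[ltLHS]p1.
  by apply: gt0_ltr_powR; rewrite ?nnegrE ?mulr_gt0// ltr1n.
have mV k : measurable_fun setT (fun x => dyadic_var (S x) k).
  apply: measurable_sum => j; apply: measurable_sum => b.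
  by apply: measurable_funX; exact: measurable_funB.
have EV k : (\int[P]_x (dyadic_var (S x) k)%:E <= (C * k%:R * 2 ^+ k)%:E)%E.
  rewrite /dyadic_var.
  under eq_integral do rewrite -sumEFin.
  rewrite ge0_integral_sum//; last 2 first.
  - move=> j; apply/measurable_EFinP; apply: measurable_sum => b.
    by apply: measurable_funX; exact: measurable_funB.
  - by move=> j x _; rewrite lee_fin sumr_ge0// => b _; exact: sqr_ge0.
  apply: (@le_trans _ _ (\sum_(j < k) (C * 2 ^+ k)%:E)%E); last first.
    by rewrite sumEFin lee_fin sumr_const card_ord -[leLHS]mulr_natr mulrAC.
  apply: lee_sum => j _.
  under eq_integral do rewrite -sumEFin.
  rewrite ge0_integral_sum//; last 2 first.
  - move=> b; apply/measurable_EFinP.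
    by apply: measurable_funX; exact: measurable_funB.
  - by move=> b x _; rewrite lee_fin sqr_ge0.
  apply: (@le_trans _ _ (\sum_(b < 2 ^ (k - j)) (C * 2 ^+ j)%:E)%E); last first.
    rewrite sumEFin lee_fin sumr_const card_ord -[leLHS]mulr_natr -mulrA natrX -exprD.
    by rewrite subnKC// ltnW.
  apply: lee_sum => b _.
  have le : (b * 2 ^ j <= b.+1 * 2 ^ j)%N by rewrite leq_mul2r leqnSn orbT.
  under eq_integral do rewrite SB//.
  by apply: (le_trans (hD _ _ le)); rewrite -mulnBl subSnn mul1n natrX.
have dec : expdecay (fun k => C * (k%:R * (k%:R * r ^+ k))).
  apply: expdecayZ; apply: expdecay_natM; apply: expdecay_natM.
  by apply: expdecay_geo; rewrite gtr0_norm.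
have [K0 [K00 sK]] := expdecay_summable dec.
have w0 k : 0 <= (r / 2) ^+ k by rewrite exprn_ge0// divr_ge0// ltW.
have bdd : {ae P, forall x, exists Z, forall k,
    (r / 2) ^+ k * (k%:R * dyadic_var (S x) k) <= Z}.
  apply: (@ae_bounded_of_summable _ (fun k => C * (k%:R * (k%:R * r ^+ k))) K0).
  - by move=> k x; rewrite mulr_ge0// mulr_ge0//; exact: dyadic_var_ge0.
  - by move=> k; apply: measurable_funM => //; exact: measurable_funM.
  - move=> k; under eq_integral do rewrite mulrA EFinM.
    rewrite ge0_integralZl//; last 3 first.
    + exact/measurable_EFinP.
    + by move=> x _; rewrite lee_fin dyadic_var_ge0.
    + by rewrite lee_fin mulr_ge0.
    apply: (@le_trans _ _ (((r / 2) ^+ k * k%:R)%:E * (C * k%:R * 2 ^+ k)%:E)%E).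
      by apply: lee_wpmul2l => //; rewrite lee_fin mulr_ge0.
    rewrite -EFinM lee_fin le_eqVlt; apply/orP; left; apply/eqP.
    rewrite expr_div_n; have : (2 ^+ k : R) != 0 by rewrite expf_neq0.
    by move=> ?; field.
  - move=> n; apply: le_trans (sK n); apply: ler_sum => k _; exact: ler_norm.
apply: filterS bdd => x [Z hZ].
have Z0 : 0 <= Z by apply: le_trans (hZ 0%N); rewrite mul0r mulr0.
exists (Num.sqrt (Z * (2 / r))) => N N0.
(* Since [2^t <= N < 2^(t+1)], level [t + 1] covers [N]; the surplus level costs the factor [2 / r],
   and [(2 / r)^t = (2^t)^(1 + 2 eta)] is at most [N^(1 + 2 eta)]. *)
have /andP[tN Nt] := trunc_log_bounds (ltnSn 1) N0.
set t := trunc_log 2 N in tN Nt.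
have r2 : 0 < 2 / r by rewrite divr_gt0.
have r2E : 2 / r = 2 `^ (1 + 2 * eta).
  by rewrite /r -powRN opprK powRD ?powRr1// pnatr_eq0 implybT.
have main : S x N ^+ 2 <= Z * (2 / r) * (N%:R `^ (2^-1 + eta)) ^+ 2.
  apply: (le_trans (sqr_le_dyadic_var _ Nt)); first by rewrite /S big_ord0.
  have := hZ t.+1; rewrite -(ler_pM2l (x := (2 / r) ^+ t.+1)) ?exprn_gt0//.
  have e1 : (2 / r) ^+ t.+1 * (r / 2) ^+ t.+1 = 1.
    by rewrite -exprMn mulrA divfK ?gt_eqF// mulfV ?pnatr_eq0// expr1n.
  rewrite [leLHS]mulrA e1 mul1r => h; apply: (le_trans h).
  rewrite exprS [leLHS]mulrC mulrA; apply: ler_wpM2l.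
    by rewrite mulr_ge0// ltW.
  rewrite -[leRHS]powR_mulrn ?powR_ge0// -powRrM (mulrDl 2^-1 eta) mulVf ?pnatr_eq0//.
  rewrite (mulrC eta) r2E -[leLHS]powR_mulrn ?powR_ge0// powRAC powR_mulrn//.
  apply: ge0_ler_powR; rewrite ?nnegrE//; first by rewrite addr_ge0// mulr_ge0// ltW.
  by rewrite -natrX ler_nat.
have := ler_wsqrtr main; rewrite (@sqrtrM _ (Z * (2 / r))); last by rewrite mulr_ge0// ltW.
by rewrite !sqrtr_sqr (ger0_norm (powR_ge0 _ _)).
Qed.

End chaining.

(** * Filtered white noise *)

Section integral_sums.
Context d (T : measurableType d) (R : realType) (P : probability T R).

Lemma integrable_bigsum (J : Type) (s : seq J) (f : J -> T -> R) :
  (forall j, P.-integrable setT (EFin \o f j)) ->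
  P.-integrable setT (EFin \o (fun x => \sum_(j <- s) f j x)).
Proof.
move=> h; have := integrable_sum measurableT s (P := xpredT) (fun j _ => h j).
by apply: eq_integrable => //= x _; rewrite sumEFin.
Qed.

Lemma integrable_scale (a : R) (f : T -> R) : P.-integrable setT (EFin \o f) ->
  P.-integrable setT (EFin \o (fun x => a * f x)).
Proof. by move=> h; have := integrableZl measurableT a h; exact: eq_integrable. Qed.

Lemma Rintegral_sum (J : Type) (s : seq J) (f : J -> T -> R) :
  (forall j, P.-integrable setT (EFin \o f j)) ->
  \int[P]_x (\sum_(j <- s) f j x) = \sum_(j <- s) \int[P]_x f j x.
Proof.
move=> h; elim: s => [|j s IH].
  rewrite big_nil; under eq_Rintegral do rewrite big_nil.
  by rewrite Rintegral_cst// mul0r.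
rewrite big_cons -IH; under eq_Rintegral do rewrite big_cons.
by rewrite RintegralD//; exact: integrable_bigsum.
Qed.

Lemma EFin_Rintegral (f : T -> R) : P.-integrable setT (EFin \o f) ->
  (\int[P]_x (f x)%:E = (\int[P]_x f x)%:E)%E.
Proof. by move=> h; rewrite fineK//; exact: integrable_fin_num. Qed.

Lemma integrable_mul2B (f g h k : T -> R) (r s : R) :
  L4 P f -> L4 P g -> L4 P h -> L4 P k ->
  P.-integrable setT (EFin \o (fun x => (f x * g x - r) * (h x * k x - s))).
Proof.
move=> lf lg lh lk.
pose M := integrable_mul4 lf lg lh lk.
pose A := integrable_mul2 lf lg; pose B := integrable_mul2 lh lk.
have := integrableD measurableT (integrableB measurableT (integrableB measurableT M
  (integrable_scale s A)) (integrable_scale r B)) (integrable_L4 (L4_cst P (r * s))).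
by apply: eq_integrable => //= x _; congr EFin; ring.
Qed.

End integral_sums.

Section filtered_noise.
Context d (T : measurableType d) (R : realType) (P : probability T R).
Variables (I : finType) (W : nat -> I -> T -> R).
Hypothesis WN : white_noise P W.

Definition sig (al : nat -> I -> R) (t : nat) (x : T) : R :=
  \sum_(s < t.+1) \sum_c al s c * W (t - s)%N c x.

Lemma sigE al t x :
  sig al t x = \sum_(p : 'I_t.+1 * I) al p.1 p.2 * W (t - p.1)%N p.2 x.
Proof. by rewrite /sig pair_bigA. Qed.

Lemma sig_mulE al be t x : sig al t x * sig be t x =
  \sum_(p : ('I_t.+1 * I) * ('I_t.+1 * I))
    al p.1.1 p.1.2 * be p.2.1 p.2.2 *
    (W (t - p.1.1)%N p.1.2 x * W (t - p.2.1)%N p.2.2 x).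
Proof.
rewrite !sigE big_distrlr/= pair_bigA.
by apply: eq_bigr => p _; rewrite mulrACA.
Qed.

Lemma integrable_sig_mul al be t :
  P.-integrable setT (EFin \o (fun x => sig al t x * sig be t x)).
Proof.
under [X in _.-integrable _ (_ \o X)]eq_fun do rewrite sig_mulE.
apply: integrable_bigsum => p; apply: integrable_scale.
by apply: integrable_mul2; exact: wn_L4.
Qed.

Lemma sub_ord_eq t (i j : 'I_t.+1) : (t - i == t - j)%N = (i == j).
Proof.
apply/eqP/eqP => [h|->//]; apply: val_inj => /=.
by rewrite -(subKn (leq_ord i)) h subKn// leq_ord.
Qed.

Lemma Rintegral_sig_mul al be t :
  \int[P]_x (sig al t x * sig be t x) = \sum_(s < t.+1) \sum_c al s c * be s c.
Proof.
under eq_Rintegral do rewrite sig_mulE.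
rewrite Rintegral_sum; last first.
  by move=> p; apply: integrable_scale; apply: integrable_mul2; exact: wn_L4.
have WW t' c s' c' : P.-integrable setT (EFin \o (fun x => W t' c x * W s' c' x)).
  by apply: integrable_mul2; exact: wn_L4.
rewrite -(pair_bigA _ (fun p q : 'I_t.+1 * I => \int[P]_x (al p.1 p.2 * be q.1 q.2 *
    (W (t - p.1)%N p.2 x * W (t - q.1)%N q.2 x))))/= [RHS]pair_bigA/=.
apply: eq_bigr => p _; rewrite (bigD1 p)//= big1 ?addr0.
  by rewrite RintegralZl// (wn_cov WN) !eqxx mulr1.
move=> q qp; rewrite RintegralZl// (wn_cov WN) sub_ord_eq -xpair_eqE -!surjective_pairing.
by rewrite eq_sym (negPf qp) mulr0.
Qed.

(** The value 0 while a lag exceeds [t] lets one lag range [n] serve all times below [n]. *)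
Definition cprod (i j : nat) (a b : I) (t : nat) (x : T) : R :=
  if (i <= t)%N && (j <= t)%N
  then W (t - i)%N a x * W (t - j)%N b x - ((i == j) && (a == b))%:R else 0.

Lemma integrable_cprod_mul i j a b t s :
  P.-integrable setT (EFin \o (fun x => cprod i j a b t x * cprod i j a b s x)).
Proof.
rewrite /cprod; case: ((i <= t)%N && (j <= t)%N); last first.
  have := integrable_L4 (L4_cst P 0).
  by apply: eq_integrable => //= x _; rewrite mul0r.
case: ((i <= s)%N && (j <= s)%N); last first.
  have := integrable_L4 (L4_cst P 0).
  by apply: eq_integrable => //= x _; rewrite mulr0.
by apply: integrable_mul2B; exact: wn_L4.
Qed.

(** With distinct lags, the smaller lag at the later time [s] reads the noise strictly after the
    three other factors, which isolates a centred variable. With equal lags the two centred products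
    live at different times. *)
Lemma cprod_orth i j a b t s : (t < s)%N ->
  \int[P]_x (cprod i j a b t x * cprod i j a b s x) = 0.
Proof.
move=> ts; rewrite /cprod.
have z : \int[P]_x (0 : R) = 0 by rewrite Rintegral_cst// mul0r.
case: (boolP ((i <= t)%N && (j <= t)%N)) => [/andP[it jt]|_]; last first.
  by under eq_Rintegral do rewrite mul0r.
rewrite (leq_trans it (ltnW ts)) (leq_trans jt (ltnW ts))/=.
case: (ltngtP i j) => [ij|ji|<-]; last first.
- under eq_Rintegral do rewrite mulrC.
  by rewrite (wn_orth2 WN)//; lia.
- under eq_Rintegral => x _.
    rewrite !subr0 (mulrC (W (t - i) a x * _)) (mulrC (W (s - i) a x)) -mulrA.
    rewrite [X in _ * X]mulrA.
    over.
  by rewrite (wn_orth3 WN)//; lia.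
- under eq_Rintegral => x _.
    rewrite !subr0 (mulrC (W (t - i) a x * _)) -mulrA [X in _ * X]mulrA.
    over.
  by rewrite (wn_orth3 WN)//; lia.
Qed.

Lemma cprod_sqr_bound : exists M : R, 0 <= M /\ forall i j a b t,
  \int[P]_x (cprod i j a b t x * cprod i j a b t x) <= M.
Proof.
have [K hK] := wn_bound WN.
(* From [(uv - e)^2 <= 2 u^2 v^2 + 2 e^2 <= u^4 + v^4 + 2] for [e] in [0, 1]. *)
exists (Num.max 0 (2 * K + 2)); split; first by rewrite le_max lexx.
move=> i j a b t; rewrite le_max; apply/orP.
have [h|h] := boolP ((i <= t)%N && (j <= t)%N); last first.
  left; rewrite /cprod (negPf h); under eq_Rintegral do rewrite mulr0.
  by rewrite Rintegral_cst// mul0r.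
right.
pose F x := W (t - i)%N a x ^+ 4 + W (t - j)%N b x ^+ 4 + 2.
have i4 s c : P.-integrable setT (EFin \o (fun x => W s c x ^+ 4)).
  by have [] := wn_L4 WN s c.
have iF2 : P.-integrable setT
    (EFin \o (fun x => W (t - i)%N a x ^+ 4 + W (t - j)%N b x ^+ 4)).
  by have := integrableD measurableT (i4 (t - i)%N a) (i4 (t - j)%N b); apply: eq_integrable => //= x _; rewrite EFinD.
have iF : P.-integrable setT (EFin \o F).
  by have := integrableD measurableT iF2 (integrable_L4 (L4_cst P 2)); apply: eq_integrable => //= x _; rewrite EFinD.
apply: (@le_trans _ _ (\int[P]_x F x)).
  apply: le_Rintegral => //; first exact: integrable_cprod_mul.
  move=> x _; rewrite /cprod h /F.
  set u := W _ a x; set v := W _ b x; set e := ((i == j) && (a == b))%:R.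
  have e1 : 0 <= e <= 1 by rewrite /e ler0n lern1 leq_b1.
  have h1 := sqr_ge0 (u ^+ 2 - v ^+ 2).
  have h2 := sqr_ge0 (u * v + e).
  have e4 (z : R) : z ^+ 4 = z ^+ 2 * z ^+ 2 by rewrite -exprD.
  rewrite !e4; move: h1 h2; rewrite !expr2; case/andP: e1 => e0 e1.
  have : e * e <= 1 by rewrite mulr_ile1.
  nra.
rewrite /F RintegralD//; last exact: integrable_L4 (L4_cst P 2).
rewrite RintegralD// Rintegral_cst// [X in fine X](_ : _ = 1%E); last exact: probability_setT.
have := hK (t - i)%N a; have := hK (t - j)%N b; rewrite /= mulr1.
lra.
Qed.

Lemma cprod_sum_sqr i j a b m n M : (m <= n)%N ->
  (forall t, \int[P]_x (cprod i j a b t x * cprod i j a b t x) <= M) ->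
  P.-integrable setT (EFin \o (fun x => (\sum_(m <= t < n) cprod i j a b t x) ^+ 2)) /\
  \int[P]_x ((\sum_(m <= t < n) cprod i j a b t x) ^+ 2) <= M * (n - m)%:R.
Proof.
move=> mn hM; set c := cprod i j a b.
have e x : (\sum_(m <= t < n) c t x) ^+ 2 =
    \sum_(m <= t < n) \sum_(m <= s < n) (c t x * c s x).
  by rewrite expr2 big_distrlr.
have ii t : P.-integrable setT (EFin \o (fun x => \sum_(m <= s < n) (c t x * c s x))).
  by apply: integrable_bigsum => s; exact: integrable_cprod_mul.
split.
  have := integrable_bigsum (index_iota m n) ii.
  by apply: eq_integrable => //= x _; rewrite e.
under eq_Rintegral do rewrite e.
rewrite Rintegral_sum//.
apply: (@le_trans _ _ (\sum_(m <= t < n) M)); last first.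
  by rewrite sumr_const_nat mulr_natr.
rewrite big_nat_cond [leRHS]big_nat_cond; apply: ler_sum => t /andP[tmn _].
rewrite Rintegral_sum; last by move=> s; exact: integrable_cprod_mul.
rewrite (bigD1_seq t) ?iota_uniq ?mem_index_iota//= big1 ?addr0 ?hM//.
move=> s st; have [ts|ts|ts] := ltngtP t s; last by rewrite ts eqxx in st.
  exact: cprod_orth.
under eq_Rintegral do rewrite mulrC.
exact: cprod_orth.
Qed.

Lemma sig_widen al t n x : (t < n)%N -> sig al t x =
  \sum_(p : 'I_n * I) al p.1 p.2 * (if (p.1 <= t)%N then W (t - p.1)%N p.2 x else 0).
Proof.
move=> tn.
rewrite -(pair_bigA _ (fun (s : 'I_n) c =>
  al s c * (if (s <= t)%N then W (t - s)%N c x else 0)))/=.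
rewrite /sig (big_ord_widen n (fun s => \sum_c al s c * W (t - s)%N c x))//.
rewrite big_mkcond/=; apply: eq_bigr => s _; rewrite ltnS.
by case: ifP => // _; rewrite big1// => c _; rewrite mulr0.
Qed.

Lemma sig_cov_widen (al be : nat -> I -> R) t n : (t < n)%N ->
  \sum_(s < t.+1) \sum_c al s c * be s c =
  \sum_(p : 'I_n * I) \sum_(q : 'I_n * I) al p.1 p.2 * be q.1 q.2 *
     (if (p.1 <= t)%N && (q.1 <= t)%N
      then ((p.1 == q.1 :> nat) && (p.2 == q.2))%:R else 0).
Proof.
move=> tn; rewrite (big_ord_widen n (fun s => \sum_c al s c * be s c))//.
rewrite big_mkcond/= -(pair_bigA _ (fun (s : 'I_n) (c : I) => \sum_(q : 'I_n * I) al s c * be q.1 q.2 *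
     (if (s <= t)%N && (q.1 <= t)%N
      then ((s == q.1 :> nat) && (c == q.2))%:R else 0)))/=.
apply: eq_bigr => s _; rewrite ltnS; case: ifP => st; last first.
  by rewrite big1// => c _; rewrite big1// => q _; rewrite /= mulr0.
apply: eq_bigr => c _; rewrite (bigD1 (s, c))//= st !eqxx mulr1 big1 ?addr0//.
move=> [q1 q2] /=; rewrite xpair_eqE -(inj_eq val_inj)/= => /negPf ne.
by rewrite eq_sym (eq_sym c) ne if_same mulr0.
Qed.

Lemma sig_mul_centered al be t n x : (t < n)%N ->
  sig al t x * sig be t x - \sum_(s < t.+1) \sum_c al s c * be s c =
  \sum_(w : ('I_n * I) * ('I_n * I)) al w.1.1 w.1.2 * be w.2.1 w.2.2 *
    cprod w.1.1 w.2.1 w.1.2 w.2.2 t x.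
Proof.
move=> tn; rewrite !(sig_widen _ _ tn) (sig_cov_widen _ _ tn) big_distrlr/=.
rewrite -sumrB -(pair_bigA _ (fun p q : 'I_n * I => al p.1 p.2 * be q.1 q.2 *
    cprod p.1 q.1 p.2 q.2 t x))/=; apply: eq_bigr => p _.
rewrite -sumrB; apply: eq_bigr => q _; rewrite /cprod.
case: (p.1 <= t)%N => /=; last by rewrite mulr0 mul0r mulr0 subr0.
case: (q.1 <= t)%N => /=; last by rewrite !mulr0 subr0.
by ring.
Qed.

Lemma summable_components (al : nat -> I -> R) : (forall c, expdecay (al^~ c)) ->
  exists A : R, 0 <= A /\ forall n, \sum_(p : 'I_n * I) `|al p.1 p.2| <= A.
Proof.
move=> h.
have dec : expdecay (fun s => \sum_c `|al s c|).
  by apply: expdecay_sum => c; apply: expdecay_le (h c) => k; rewrite normr_id.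
have [A [A0 hA]] := expdecay_summable dec; exists A; split=> // n.
rewrite -(pair_bigA _ (fun (s : 'I_n) c => `|al s c|))/=; apply: le_trans (hA n).
by apply: ler_sum => s _; exact: ler_norm.
Qed.

Lemma sig_growth al be (eta : R) : (forall c, expdecay (al^~ c)) ->
  (forall c, expdecay (be^~ c)) -> 0 < eta ->
  {ae P, forall x, exists K, forall N, (0 < N)%N ->
     `|\sum_(t < N) (sig al t x * sig be t x
         - \sum_(s < t.+1) \sum_c al s c * be s c)| <= K * N%:R `^ (2^-1 + eta)}.
Proof.
move=> dal dbe eta0.
have [A [A0 hA]] := summable_components dal.
have [B [B0 hB]] := summable_components dbe.
have [M [M0 hM]] := cprod_sqr_bound.
apply: (@ae_growth _ _ _ P (fun t x => sig al t x * sig be t x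
   - \sum_(s < t.+1) \sum_c al s c * be s c) (A * B * (A * B) * M)) => //.
- by rewrite !mulr_ge0.
- move=> t; apply: measurable_funB => //; apply/measurable_EFinP.
  by have /integrableP[] := integrable_sig_mul al be t.
move=> m n mn.
(* The weights of all pairs of lags total at most [A B] for every [n]. Weighted Cauchy-Schwarz
   yields one such factor, and averaging the bounds [M (n - m)] over the weights yields the
   other. *)
pose w (p : ('I_n * I) * ('I_n * I)) : R := `|al p.1.1 p.1.2 * be p.2.1 p.2.2|.
have w0 p : 0 <= w p by exact: normr_ge0.
have sw : \sum_p w p <= A * B.
  rewrite /w; under eq_bigr do rewrite normrM.
  rewrite -(pair_bigA _ (fun p q : 'I_n * I => `|al p.1 p.2| * `|be q.1 q.2|))/=.
  by rewrite -big_distrlr/=; apply: ler_pM; rewrite ?sumr_ge0 ?hA ?hB.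
pose Y (p : ('I_n * I) * ('I_n * I)) x := \sum_(m <= t < n) cprod p.1.1 p.2.1 p.1.2 p.2.2 t x.
have iY (p : ('I_n * I) * ('I_n * I)) :
    P.-integrable setT (EFin \o (fun x => Y p x ^+ 2)) /\
    \int[P]_x (Y p x ^+ 2) <= M * (n - m)%:R.
  by apply: cprod_sum_sqr => // t; exact: hM.
pose G x := A * B * \sum_p w p * Y p x ^+ 2.
have bound x : (\sum_(m <= t < n) (sig al t x * sig be t x
     - \sum_(s < t.+1) \sum_c al s c * be s c)) ^+ 2 <= G x.
  have -> : \sum_(m <= t < n) (sig al t x * sig be t x
      - \sum_(s < t.+1) \sum_c al s c * be s c) =
      \sum_(p : ('I_n * I) * ('I_n * I)) al p.1.1 p.1.2 * be p.2.1 p.2.2 * Y p x.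
    rewrite (eq_big_nat _ _ (F2 := fun t =>
       \sum_(w : ('I_n * I) * ('I_n * I)) al w.1.1 w.1.2 * be w.2.1 w.2.2 *
         cprod w.1.1 w.2.1 w.1.2 w.2.2 t x)); last first.
      by move=> t /andP[_ tn]; exact: sig_mul_centered.
    by rewrite exchange_big/=; apply: eq_bigr => p _; rewrite mulr_sumr.
  rewrite -[leLHS]real_normK ?num_real//.
  apply: (@le_trans _ _ ((\sum_p w p * `|Y p x|) ^+ 2)).
    apply: lerXn2r; rewrite ?nnegrE ?sumr_ge0//.
      by move=> p _; rewrite mulr_ge0.
    apply: (le_trans (ler_norm_sum _ _ _)); apply: ler_sum => p _.
    by rewrite normrM.
  apply: (le_trans (weighted_cauchy_schwarz _ w0)).
  under [X in _ * X <= _]eq_bigr do rewrite real_normK ?num_real//.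
  by apply: ler_wpM2r => //; apply: sumr_ge0 => p _; rewrite mulr_ge0 ?sqr_ge0.
have iG1 : P.-integrable setT (EFin \o (fun x => \sum_p w p * Y p x ^+ 2)).
  by apply: integrable_bigsum => p; apply: integrable_scale; case: (iY p).
have iG : P.-integrable setT (EFin \o G) by exact: integrable_scale.
have mD t : measurable_fun setT (fun x => sig al t x * sig be t x
     - \sum_(s < t.+1) \sum_c al s c * be s c).
  apply: measurable_funB => //; apply/measurable_EFinP.
  by have /integrableP[] := integrable_sig_mul al be t.
apply: (@le_trans _ _ (\int[P]_x (G x)%:E)%E).
  apply: ge0_le_integral => //.
  - by move=> x _; rewrite lee_fin sqr_ge0.
  - by apply/measurable_EFinP; apply: measurable_funX; exact: measurable_sum.
  - by case/integrableP: iG.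
  - by move=> x _; rewrite lee_fin.
rewrite EFin_Rintegral// lee_fin /G RintegralZl// Rintegral_sum; last first.
  by move=> p; apply: integrable_scale; case: (iY p).
rewrite -!mulrA; apply: ler_wpM2l => //; apply: ler_wpM2l => //; rewrite mulrA.
apply: (@le_trans _ _ (\sum_p w p * (M * (n - m)%:R))).
  apply: ler_sum => p _; have [iYp bYp] := iY p.
  by rewrite RintegralZl// ler_wpM2l.
by rewrite -mulr_suml; apply: ler_wpM2r; rewrite // mulr_ge0.
Qed.

End filtered_noise.

(** * Tails of exponentially decaying series *)

Section expdecay_series.
Variable R : realType.

Lemma expdecay_mul (f g : nat -> R) : expdecay f -> expdecay g ->
  expdecay (fun k => f k * g k).
Proof.
move=> [C [r [C0 r0 r1 b]]] dg; have := expdecayZ C dg; apply: expdecay_le => k.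
rewrite !normrM; apply: ler_wpM2r => //; rewrite (ger0_norm C0).
apply: (le_trans (b k)); apply: ler_piMr => //.
by apply: exprn_ile1; exact: ltW.
Qed.

Lemma expdecay_series_tail (f : nat -> R) : expdecay f ->
  exists2 g, expdecay g & forall t n, (t <= n)%N ->
    `|\sum_(s < n) f s - \sum_(s < t) f s| <= g t.
Proof.
move=> [C [r [C0 r0 r1 b]]]; exists (fun t => C * (1 - r)^-1 * r ^+ t).
  by apply: expdecayZ; apply: expdecay_geo; rewrite gtr0_norm.
move=> t n tn; rewrite -!(big_mkord xpredT f) (big_cat_nat (leq0n t) tn)/=.
rewrite addrAC subrr add0r; apply: (le_trans (ler_norm_sum _ _ _)).
rewrite -{1}(add0n t) big_addn big_mkord.
apply: (@le_trans _ _ (\sum_(i < n - t) C * r ^+ t * r ^+ i)).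
  by apply: ler_sum => i _; apply: (le_trans (b _)); rewrite addnC exprD mulrA.
rewrite -mulr_sumr [leRHS]mulrAC; apply: ler_wpM2l.
  by rewrite mulr_ge0// exprn_ge0// ltW.
exact: geo_sum_le (ltW r0) r1.
Qed.

Lemma expdecay_is_cvg (f : nat -> R) : expdecay f -> cvgn (series f).
Proof.
move=> df; have [K [K0 hK]] := expdecay_summable df.
apply: normed_cvg; rewrite /normed_series_of; apply: nondecreasing_is_cvgn.
  by apply/nondecreasing_seqP => n; rewrite /series/= big_nat_recr//= lerDl.
exists K => _ [n _ <-]; rewrite /series/= big_mkord; exact: hK.
Qed.

Lemma expdecay_lim_rate (f : nat -> R) : expdecay f ->
  exists2 g, expdecay g & forall t, `|\sum_(s < t) f s - limn (series f)| <= g t.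
Proof.
move=> df; have [g dg hg] := expdecay_series_tail df; exists g => // t.
have cv : (fun n => `|series f n - \sum_(s < t) f s|) @ \oo -->
    `|limn (series f) - \sum_(s < t) f s|.
  by apply: cvg_norm; apply: cvgB; [exact: expdecay_is_cvg|exact: cvg_cst].
rewrite distrC -(cvg_lim _ cv)//; apply: limr_le; first by apply/cvg_ex; eexists; exact: cv.
near=> n; rewrite /series/= big_mkord; apply: hg.
by near: n; exists t.
Unshelve. all: by end_near.
Qed.

End expdecay_series.

(** * Limit covariances and the rate of sample covariances *)

Section gram.
Context d (T : measurableType d) (R : realType) (P : probability T R).
Variables (I : finType) (W : nat -> I -> T -> R).
Hypothesis WN : white_noise P W.

(** Limit covariance of two filtered noises; filters starting at rest have as exact covariance at
    time [t] a partial sum of this series. *)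
Definition gram (al be : nat -> I -> R) : R :=
  limn (series (fun s => \sum_c al s c * be s c)).

Variables (al be : nat -> I -> R).
Hypotheses (dal : forall c, expdecay (al^~ c)) (dbe : forall c, expdecay (be^~ c)).

Let dc : expdecay (fun s => \sum_c al s c * be s c).
Proof. by apply: expdecay_sum => c; exact: expdecay_mul. Qed.

Lemma gram_cvg : (fun t => \int[P]_x (sig W al t x * sig W be t x)) @ \oo --> gram al be.
Proof.
under eq_fun do rewrite Rintegral_sig_mul//.
have := expdecay_is_cvg dc; rewrite /gram => cv.
have h : (fun t => series (fun s => \sum_c al s c * be s c) t.+1) @ \oo --> gram al be.
  by rewrite (cvg_shiftS (series (fun s => \sum_c al s c * be s c))).
have -> : (fun t => \sum_(s < t.+1) \sum_c al s c * be s c) =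
    (fun t => series (fun s => \sum_c al s c * be s c) t.+1).
  by apply/funext => t; rewrite /series/= big_mkord.
exact: h.
Qed.

Lemma sig_mean_rate (eta : R) : 0 < eta ->
  {ae P, forall x, exists K, forall N, (0 < N)%N ->
     `|N%:R^-1 * (\sum_(t < N) sig W al t x * sig W be t x) - gram al be|
       <= K * N%:R `^ (- 2^-1 + eta)}.
Proof.
move=> eta0; have [g dg hg] := expdecay_lim_rate dc.
have [G [G0 hG]] := expdecay_summable dg.
apply: filterS (sig_growth WN dal dbe eta0) => x [K hK].
exists (K + G) => N N0.
have N0' : (0 : R) < N%:R by rewrite ltr0n.
pose r t := \sum_(s < t.+1) \sum_c al s c * be s c.
(* Random fluctuation plus deterministic transient; the transient is summable, so it stays below the
   constant [G]. *)
have e : \sum_(t < N) sig W al t x * sig W be t x - N%:R * gram al be =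
  \sum_(t < N) (sig W al t x * sig W be t x - r t) + \sum_(t < N) (r t - gram al be).
  rewrite -big_split/= mulr_natl -[in _ *+ N](card_ord N) -sumr_const -sumrB.
  by apply: eq_bigr => t _; rewrite addrA subrK.
have -> : N%:R^-1 * (\sum_(t < N) sig W al t x * sig W be t x) - gram al be =
    N%:R^-1 * (\sum_(t < N) sig W al t x * sig W be t x - N%:R * gram al be).
  by rewrite mulrBr mulKf// gt_eqF.
rewrite normrM ger0_norm ?invr_ge0 //.
have step : `|\sum_(t < N) sig W al t x * sig W be t x - N%:R * gram al be| <=
    (K + G) * N%:R `^ (2^-1 + eta).
  rewrite e; apply: (le_trans (ler_normD _ _)); rewrite mulrDl; apply: lerD.
    exact: hK.
  apply: (le_trans (ler_norm_sum _ _ _)).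
  apply: (@le_trans _ _ (\sum_(t < N) `|g t.+1|)).
    by apply: ler_sum => t _; apply: le_trans (ler_norm _); exact: hg.
  apply: (@le_trans _ _ G).
    apply: le_trans (hG N.+1); rewrite big_ord_recl/= lerDr; exact: normr_ge0.
  apply: ler_peMr => //; rewrite -[leLHS](powRr0 N%:R).
  by apply: ler_powR; rewrite ?ler1n// addr_ge0// ltW.
rewrite ler_pdivrMl//; apply: (le_trans step); rewrite [leRHS]mulrCA.
rewrite -[X in _ * (X * _)](powRr1 (ltW N0')) -powRD; last by rewrite (gt_eqF N0') implybT.
rewrite le_eqVlt; apply/orP; left; apply/eqP; congr (_ * _ `^ _).
by field.
Qed.

End gram.

(** * Expansions at infinity of rational functions *)

Lemma fraction_numden (D : idomainType) (f : {fraction D}) :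
  f * FracField.tofrac (frac (repr f)).2 = FracField.tofrac (frac (repr f)).1.
Proof.
rewrite -{1}[f]reprK; unlock FracField.tofrac.
rewrite -[LHS]FracField.pi_mul; apply/eqmodP => /=.
rewrite /FracField.mulf /= FracField.equivfE.
have d0 := denom_ratioP (repr f).
rewrite !numden_Ratio ?oner_neq0 ?mulr1//.
by rewrite mulrC.
Qed.

Section relative_degree.
Variable R : realType.
Local Notation K := (ratfun R).
Local Notation "p %:F" := (@FracField.tofrac {poly R} p).
Implicit Types (f g : K) (k : nat).

Lemma denom_neq0 f : denom f != 0.
Proof. exact: denom_ratioP. Qed.

Lemma numdenE f : f = (numer f)%:F / (denom f)%:F.
Proof.
apply: (canRL (mulfK _)); last exact: fraction_numden.
by rewrite tofrac_eq0 denom_neq0.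
Qed.

(* Membership in the k-th power of the maximal ideal of the valuation ring at
   infinity, for which [1 / 'X] is a uniformizer. *)
Definition vanish_inf k f : Prop := exists n d : {poly R},
  [/\ d != 0, f = n%:F / d%:F & (size n + k <= size d)%N].

Lemma reldeg_ge_vanish_inf k f : reldeg_ge k f -> vanish_inf k f.
Proof.
case=> [->|h].
  exists 0, 'X^k; rewrite tofrac0 mul0r size_poly0 size_polyXn; split=> //.
  by rewrite -size_poly_eq0 size_polyXn.
by exists (numer f), (denom f); split; [exact: denom_neq0|exact: numdenE|].
Qed.

Lemma vanish_inf0 k : vanish_inf k 0.
Proof. by apply: reldeg_ge_vanish_inf; left. Qed.

Lemma vanish_infW k l f : (l <= k)%N -> vanish_inf k f -> vanish_inf l f.
Proof.
move=> lk [n [d [d0 fE s]]]; exists n, d; split=> //.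
by apply: leq_trans s; rewrite leq_add2l.
Qed.

Lemma tofrac_div_eq (n d n' d' : {poly R}) : d != 0 -> d' != 0 ->
  (n%:F / d%:F == n'%:F / d'%:F) = (n * d' == n' * d).
Proof.
move=> d0 d'0; rewrite eqr_div ?tofrac_eq0// -!tofracM tofrac_eq.
by [].
Qed.

(** The degree gap does not depend on the representation: compare degrees in the cross-multiplied
    identity. *)
Lemma vanish_infP k (n d : {poly R}) : d != 0 -> n != 0 ->
  vanish_inf k (n%:F / d%:F) -> (size n + k <= size d)%N.
Proof.
move=> d0 n0 [n' [d' [d'0 /eqP]]]; rewrite tofrac_div_eq// => /eqP e s.
have n'0 : n' != 0.
  by apply: contraNneq n0 => n'0; rewrite n'0 mul0r in e; move/eqP: e; rewrite mulf_eq0 (negPf d'0) orbF.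
have := congr1 (fun p : {poly R} => size p) e; rewrite !size_mul//.
have := n0; have := d0; have := n'0; have := d'0.
rewrite -!size_poly_gt0.
by move: s; move: (size n) (size d) (size n') (size d'); lia.
Qed.

Lemma vanish_infD k f g : vanish_inf k f -> vanish_inf k g -> vanish_inf k (f + g).
Proof.
move=> [n [d [d0 -> s]]] [n' [d' [d'0 -> s']]].
exists (n * d' + n' * d), (d * d'); split; first exact: mulf_neq0.
  by rewrite addf_div ?tofrac_eq0// tofracD !tofracM.
rewrite size_mul//.
have h1 := size_polyD (n * d') (n' * d).
have h2 := size_polyMleq n d'; have h3 := size_polyMleq n' d.
have := d0; have := d'0; rewrite -!size_poly_gt0.
move: s s' h1 h2 h3; move: (size (n * d' + n' * d)) (size (n * d')) (size (n' * d)).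
by move: (size n) (size d) (size n') (size d'); lia.
Qed.

Lemma vanish_infM k l f g : vanish_inf k f -> vanish_inf l g -> vanish_inf (k + l) (f * g).
Proof.
move=> [n [d [d0 -> s]]] [n' [d' [d'0 -> s']]].
have [->|n0] := eqVneq n 0; first by rewrite tofrac0 !mul0r; exact: vanish_inf0.
have [->|n'0] := eqVneq n' 0; first by rewrite tofrac0 mul0r mulr0; exact: vanish_inf0.
exists (n * n'), (d * d'); split; first exact: mulf_neq0.
  by rewrite mulf_div -!tofracM.
rewrite !size_mul//.
have := n0; have := n'0; have := d0; have := d'0; rewrite -!size_poly_gt0.
by move: s s'; move: (size n) (size d) (size n') (size d'); lia.
Qed.

Lemma vanish_infN k f : vanish_inf k f -> vanish_inf k (- f).
Proof.
move=> [n [d [d0 -> s]]]; exists (- n), d; split=> //; last by rewrite size_polyN.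
by rewrite tofracN mulNr.
Qed.

Lemma vanish_infB k f g : vanish_inf k f -> vanish_inf k g -> vanish_inf k (f - g).
Proof. by move=> hf hg; apply: vanish_infD => //; exact: vanish_infN. Qed.

Lemma vanish_inf_sum k (J : Type) (s : seq J) (P : pred J) (F : J -> K) :
  (forall j, P j -> vanish_inf k (F j)) -> vanish_inf k (\sum_(j <- s | P j) F j).
Proof.
move=> h; elim/big_ind : _ => //; [exact: vanish_inf0|exact: vanish_infD].
Qed.

Lemma vanish_inf_polyC (a : R) : vanish_inf 0 (a%:P%:F).
Proof.
exists a%:P, 1; rewrite oner_neq0 tofrac1 divr1 addn0; split=> //.
by rewrite size_poly1 size_polyC; case: (a != 0).
Qed.

Lemma vanish_inf1 : vanish_inf 0 1.
Proof. by have := vanish_inf_polyC 1; rewrite polyC1 tofrac1. Qed.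

Definition zinv : K := ('X%:F)^-1.

Lemma vanish_inf_zinv : vanish_inf 1 zinv.
Proof.
exists 1, 'X; rewrite polyX_eq0 tofrac1 div1r; split=> //.
by rewrite size_poly1 size_polyX.
Qed.

Lemma vanish_infX k l f : vanish_inf k f -> vanish_inf (k * l) (f ^+ l).
Proof.
move=> h; elim: l => [|l IH]; first by rewrite muln0 expr0; exact: vanish_inf1.
by rewrite exprS mulnS; exact: vanish_infM.
Qed.

Lemma vanish_inf_zinvX l : vanish_inf l (zinv ^+ l).
Proof. by have := vanish_infX l vanish_inf_zinv; rewrite mul1n. Qed.

(** Reads [p] as a polynomial in 1/z, so that truncated expansions live in the field of rational
    functions. *)
Definition evz (p : {poly R}) : K :=
  (map_poly (@FracField.tofrac {poly R} \o polyC) p).[zinv].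

Lemma evzD p q : evz (p + q) = evz p + evz q.
Proof. by rewrite /evz rmorphD hornerD. Qed.

Lemma evzM p q : evz (p * q) = evz p * evz q.
Proof. by rewrite /evz rmorphM hornerM. Qed.

Lemma evzX l : evz 'X^l = zinv ^+ l.
Proof. by rewrite /evz map_polyXn hornerXn. Qed.

Lemma evzZ a p : evz (a *: p) = a%:P%:F * evz p.
Proof. by rewrite /evz map_polyZ hornerZ. Qed.

Lemma evzB p q : evz (p - q) = evz p - evz q.
Proof. by rewrite /evz rmorphB hornerD hornerN. Qed.

Lemma vanish_inf_evz p : vanish_inf 0 (evz p).
Proof.
rewrite /evz horner_coef; apply: vanish_inf_sum => i _; rewrite coef_map/=.
apply: (@vanish_infM 0 0); first exact: vanish_inf_polyC.
by have := vanish_infX i (vanish_infW (leq0n 1) vanish_inf_zinv); rewrite mul0n.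
Qed.

Lemma X_neq0F : 'X%:F != 0 :> K.
Proof. by rewrite tofrac_eq0 polyX_eq0. Qed.

Lemma evz_small k (p : {poly R}) : (size p <= k)%N -> vanish_inf k (evz p) -> p = 0.
Proof.
move=> sp v; apply/eqP; apply: contraT => p0.
(* Reversing the coefficients writes [evz p] as a nonzero [r] over ['X^(k-1)], whose relative degree
   is at most [k - 1]. *)
pose r := \poly_(i < k) p`_(k.-1 - i).
have k0 : (0 < k)%N by apply: leq_trans sp; rewrite size_poly_gt0.
have e : evz p = r%:F / ('X^(k.-1))%:F.
  have XK : ('X^(k.-1))%:F != 0 :> K by rewrite tofrac_eq0 -size_poly_eq0 size_polyXn.
  apply: (canRL (mulfK XK)).
  rewrite /evz (horner_coef_wide (n := k)); last exact: leq_trans (size_poly _ _) sp.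
  rewrite mulr_suml /r poly_def rmorph_sum/= (reindex_inj rev_ord_inj)/=.
  apply: eq_bigr => i _; rewrite coef_map/= -mul_polyC !rmorphM/= !tofracXn /zinv.
  have -> : (k - i.+1 = k.-1 - i)%N by lia.
  rewrite -mulrA; congr (_ * _).
  have -> : k.-1 = (k.-1 - i + i)%N by rewrite subnK//; have := ltn_ord i; lia.
  by rewrite addnK exprD mulrA -exprMn mulVf ?X_neq0F// expr1n mul1r.
have r0 : r != 0.
  apply: contraNneq p0 => r0; apply/eqP/polyP => i; rewrite coef0.
  have [ik|ki] := ltnP i k; last by rewrite nth_default//; exact: leq_trans sp ki.
  have := congr1 (fun q : {poly R} => q`_(k.-1 - i)) r0.
  rewrite coef_poly coef0; case: ifP => [_|/negP[]]; last by lia.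
  by rewrite subKn//; lia.
have := @vanish_infP k r 'X^(k.-1); rewrite -e => /(_ _ r0 v).
rewrite -size_poly_eq0 size_polyXn => /(_ isT).
have := r0; rewrite -size_poly_gt0; lia.
Qed.

Definition trunc (h : nat -> R) k : {poly R} := \poly_(i < k.+1) h i.

(** The expansion at infinity, as congruences modulo z^-(k+1). Being independent of numerators and
    denominators, it is what transports sums and products to [markov]. *)
Definition expansion f (h : nat -> R) : Prop :=
  forall k, vanish_inf k.+1 (f - evz (trunc h k)).

Lemma expansion_proper f h : expansion f h -> vanish_inf 0 f.
Proof.
move=> /(_ 0%N) v; rewrite -(subrK (evz (trunc h 0)) f); apply: vanish_infD.
  exact: vanish_infW v.
exact: vanish_inf_evz.
Qed.

Lemma expansion_unique f h l : expansion f h -> expansion f l -> h =1 l.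
Proof.
move=> eh el k; apply/eqP; rewrite -subr_eq0.
have v : vanish_inf k.+1 (evz (trunc h k - trunc l k)).
  rewrite evzB; have := vanish_infB (el k) (eh k); congr vanish_inf.
  by rewrite opprB addrC addrA subrK.
have s : (size (trunc h k - trunc l k)%R <= k.+1)%N.
  apply: leq_trans (size_polyD _ _) _; rewrite size_polyN geq_max.
  by rewrite !size_poly.
have /(congr1 (fun p : {poly R} => p`_k)) := evz_small s v.
by rewrite coefB !coef_poly ltnSn coef0 => ->.
Qed.

Lemma expansionD f g h l : expansion f h -> expansion g l ->
  expansion (f + g) (fun k => h k + l k).
Proof.
move=> ef eg k; have := vanish_infD (ef k) (eg k).
rewrite addrACA -opprD -evzD; congr (vanish_inf _ (_ - evz _)).
by apply/polyP => i; rewrite coefD !coef_poly; case: ifP => // _; rewrite addr0.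
Qed.

Lemma expansionN f h : expansion f h -> expansion (- f) (fun k => - h k).
Proof.
move=> ef k; have := vanish_infN (ef k); rewrite opprB.
have -> : trunc (fun k => - h k) k = - trunc h k.
  by apply/polyP => i; rewrite coefN !coef_poly; case: ifP => // _; rewrite oppr0.
rewrite -[- trunc h k]add0r evzB.
have -> : evz 0 = 0 by rewrite /evz map_poly0 horner0.
by rewrite sub0r opprK addrC.
Qed.

Lemma expansionM f g h l : expansion f h -> expansion g l ->
  expansion (f * g) (fun k => \sum_(i < k.+1) h i * l (k - i)%N).
Proof.
move=> ef eg k.
pose H := trunc h k; pose L := trunc l k.
(* Two truncation errors, and the carry: the coefficients above degree [k] in the product of the
   truncations. *)
have -> : f * g - evz (trunc (fun k => \sum_(i < k.+1) h i * l (k - i)%N) k) =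
   f * (g - evz L) + (f - evz H) * evz L + evz (drop_poly k.+1 (H * L)) * zinv ^+ k.+1.
  have e : evz (H * L) = evz (trunc (fun k => \sum_(i < k.+1) h i * l (k - i)%N) k) +
      evz (drop_poly k.+1 (H * L)) * zinv ^+ k.+1.
    rewrite -evzX -evzM -evzD; congr evz; rewrite -[LHS](poly_take_drop k.+1).
    congr (_ + _); apply/polyP => i; rewrite coef_take_poly !coef_poly.
    case: ifP => // ik; rewrite coefM; apply: eq_bigr => j _.
    by rewrite !coef_poly; do 2 (case: ifP => [_|/negP[]]; last by have := ltn_ord j; lia).
  rewrite mulrBr mulrBl addrA subrK -evzM e; ring.
apply: vanish_infD; first apply: vanish_infD.
- by rewrite -[k.+1]add0n; apply: vanish_infM => //; exact: expansion_proper ef.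
- by rewrite -[k.+1]addn0; apply: vanish_infM => //; exact: vanish_inf_evz.
- by rewrite -[k.+1]add0n; apply: vanish_infM; [exact: vanish_inf_evz|exact: vanish_inf_zinvX].
Qed.

Lemma expansion_sum (J : Type) (s : seq J) (F : J -> K) (h : J -> nat -> R) :
  (forall j, expansion (F j) (h j)) ->
  expansion (\sum_(j <- s) F j) (fun k => \sum_(j <- s) h j k).
Proof.
move=> e; elim: s => [|j s IH].
  rewrite big_nil => k; rewrite (_ : trunc _ k = 0).
    by rewrite /evz map_poly0 horner0 subrr; exact: vanish_inf0.
  by apply/polyP => i; rewrite coef_poly big_nil coef0; case: ifP.
rewrite big_cons; have := expansionD (e j) IH.
by congr expansion; apply/funext => k; rewrite big_cons.
Qed.

Lemma expansion1 : expansion 1 (fun k => (k == 0%N)%:R).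
Proof.
move=> k; rewrite (_ : trunc _ k = 1).
  by rewrite /evz rmorph1 hornerC subrr; exact: vanish_inf0.
apply/polyP => i; rewrite coef_poly coef1; case: ifP => // /negbT ik.
by case: i ik.
Qed.

Lemma expansion0 : expansion 0 (fun=> 0).
Proof.
move=> k; rewrite (_ : trunc _ k = 0).
  by rewrite /evz map_poly0 horner0 subrr; exact: vanish_inf0.
by apply/polyP => i; rewrite coef_poly coef0; case: ifP.
Qed.

Lemma expansion_markov f : vanish_inf 0 f -> expansion f (Defs.markov f).
Proof.
move=> v0.
pose n := numer f; pose d := denom f; have d0 : d != 0 by exact: denom_neq0.
have sz : (size n <= size d)%N.
  have [->|n0] := eqVneq n 0; first by rewrite size_poly0.
  by have := @vanish_infP 0 n d d0 n0; rewrite -numdenE addn0; exact.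
pose Q k := (n * 'X^k) %/ d; pose r k := (n * 'X^k) %% d.
have QE k : n * 'X^k = Q k * d + r k by exact: divp_eq.
have sr k : (size (r k) < size d)%N by rewrite ltn_modp.
have Q0 : (size (Q 0%N) <= 1)%N.
  by rewrite /Q expr0 mulr1 size_divp//; move: sz; move: (size n) (size d); lia.
(* Long division digit by digit: one more factor ['X] appends a single constant to the quotient, so
   [Q k] is z^k times the expansion truncated at order [k]. *)
have QS k : Q k.+1 = Q k * 'X + ((Q k.+1)`_0)%:P.
  have e : Q k.+1 = Q k * 'X + (r k * 'X) %/ d.
    by rewrite {1}/Q exprSr mulrA QE mulrDl mulrAC divpD mulpK.
  rewrite {1}e; congr (_ + _).
  have c1 : (size ((r k * 'X) %/ d)%R <= 1)%N.
    have := sr k; have := size_polyMleq (r k) 'X; rewrite size_divp// size_polyX.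
    by move: (size (r k * 'X)) (size (r k)) (size d); lia.
  rewrite e coefD coefMX/= add0r; exact: size1_polyC.
have QT k : (Q k)%:F = 'X%:F ^+ k * evz (trunc (Defs.markov f) k).
  elim: k => [|k IH].
    rewrite (size1_polyC Q0) mul1r /trunc (_ : \poly_(i < 1) _ = ((Q 0%N)`_0)%:P).
      by rewrite /evz map_polyC hornerC.
    by apply/polyP => i; rewrite coef_poly coefC; case: i.
  rewrite QS tofracD tofracM IH.
  have -> : trunc (Defs.markov f) k.+1 = trunc (Defs.markov f) k + (Q k.+1)`_0 *: 'X^(k.+1).
    apply/polyP => i; rewrite coefD coefZ coefXn !coef_poly ltnS leq_eqVlt.
    by have [->|/=] := eqVneq i k.+1; rewrite ?ltnn ?mulr1 ?add0r// mulr0 addr0.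
  rewrite evzD evzZ evzX mulrDr; congr (_ + _).
    by rewrite exprSr mulrAC.
  by rewrite mulrCA /zinv -exprMn mulfV ?X_neq0F// expr1n mulr1.
move=> k.
have -> : f - evz (trunc (Defs.markov f) k) = zinv ^+ k * ((r k)%:F / d%:F).
  have XK : 'X%:F ^+ k != 0 :> K by rewrite expf_neq0// X_neq0F.
  have XZ : 'X%:F ^+ k * zinv ^+ k = 1 by rewrite /zinv -exprMn mulfV ?X_neq0F// expr1n.
  apply: (mulfI XK); rewrite mulrBr -QT [RHS]mulrA XZ mul1r.
  rewrite {1}[f]numdenE mulrA -tofracXn -tofracM (mulrC 'X^k) QE tofracD tofracM mulrDl.
  by rewrite mulfK ?tofrac_eq0// addrAC subrr add0r.
rewrite -addn1; apply: vanish_infM; first exact: vanish_inf_zinvX.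
by exists (r k), d; split=> //; rewrite addn1.
Qed.

Lemma markov_expansion f h : expansion f h -> Defs.markov f =1 h.
Proof.
move=> ex; have ep := expansion_proper ex.
exact: expansion_unique (expansion_markov ep) ex.
Qed.

(** Euclidean division of z^k [n] by [d] for an arbitrary representation of [f]. A coefficient of
    the remainder beyond its degree bound vanishes, which gives the two identities below. *)
Lemma markov_div_remainder f (n d : {poly R}) k : d != 0 -> f = n%:F / d%:F ->
  (size n <= size d)%N ->
  (size (n * 'X^k - \poly_(i < k.+1) Defs.markov f (k - i)%N * d)%R < size d)%N.
Proof.
move=> d0 fE s.
have v0 : vanish_inf 0 f by exists n, d; rewrite addn0.
set H := \poly_(i < k.+1) _; set r := _ - _.
have d1 : (0 < size d)%N by rewrite size_poly_gt0.
have [->|r0] := eqVneq r 0; first by rewrite size_poly0.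
have XF : 'X%:F ^+ k != 0 :> K by rewrite expf_neq0// X_neq0F.
have Xk0 : ('X^k : {poly R}) != 0 by rewrite -size_poly_eq0 size_polyXn.
have HE : evz (trunc (Defs.markov f) k) = H%:F / 'X%:F ^+ k.
  apply: (canRL (mulfK XF)); rewrite /evz (horner_coef_wide (n := k.+1)); last first.
    exact: leq_trans (size_poly _ _) (size_poly _ _).
  rewrite mulr_suml /H poly_def rmorph_sum/= [RHS](reindex_inj rev_ord_inj)/=.
  apply: eq_bigr => i _; have ik := ltn_ord i.
  rewrite coef_map/= coef_poly ik subSS subKn// -mul_polyC rmorphM/= tofracXn.
  rewrite -mulrA; congr (_ * _); rewrite /zinv.
  have -> : 'X%:F ^+ k = 'X%:F ^+ i * 'X%:F ^+ (k - i) :> K.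
    by rewrite -exprD subnKC// -ltnS.
  by rewrite mulrA -exprMn mulVf ?X_neq0F// expr1n mul1r.
have v := expansion_markov v0 k.
have e : f - evz (trunc (Defs.markov f) k) = r%:F / (d * 'X^k)%:F.
  apply: (canRL (mulfK _)); first by rewrite tofrac_eq0 mulf_neq0.
  rewrite HE fE /r tofracB !tofracM tofracXn mulrBl; congr (_ - _).
    by rewrite mulrA mulfVK ?tofrac_eq0.
  by rewrite (mulrC d%:F) mulrA mulfVK.
have := @vanish_infP k.+1 r (d * 'X^k) (mulf_neq0 d0 Xk0) r0; rewrite -e => /(_ v).
by rewrite size_mulXn// addnC addSn ltn_add2l.
Qed.

Lemma markov_coef_tail f (n d : {poly R}) l : d != 0 -> f = n%:F / d%:F ->
  (size n <= size d)%N -> \sum_(i < size d) d`_i * Defs.markov f (l.+1 + i)%N = 0.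
Proof.
move=> d0 fE s; pose D := (size d).-1.
have dD : size d = D.+1 by rewrite prednK// size_poly_gt0.
(* At coefficient [D] the shifted numerator contributes nothing, so only the recurrence remains. *)
have sD := markov_div_remainder (l.+1 + D) d0 fE s.
rewrite [X in (_ < X)%N]dD ltnS in sD; have := nth_default 0 sD.
rewrite coefB coefMXn addSn ltnS leq_addl sub0r mulrC coefM -dD => /eqP.
rewrite oppr_eq0 => /eqP e; rewrite -[RHS]e; apply: eq_bigr => i _; have := ltn_ord i.
rewrite coef_poly => iD; congr (_ * _).
case: ifP => [_|/negP[]]; last by lia.
by congr (Defs.markov f _); lia.
Qed.

Lemma markov_coef_head f (n d : {poly R}) j : d != 0 -> f = n%:F / d%:F ->
  (size n <= size d)%N ->
  n`_j = \sum_(i < size d | (j <= i)%N) d`_i * Defs.markov f (i - j)%N.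
Proof.
move=> d0 fE s; pose D := (size d).-1.
have dD : size d = D.+1 by rewrite prednK// size_poly_gt0.
(* With exponent [D], coefficient [D + j] of the shifted numerator is coefficient [j] of [n]. *)
have sD := markov_div_remainder D d0 fE s.
rewrite [X in (_ < X)%N]dD ltnS in sD; have := nth_default 0 (leq_trans sD (leq_addr j D)).
rewrite coefB coefMXn ltnNge leq_addr/= addKn => /eqP.
rewrite subr_eq0 => /eqP ->; rewrite mulrC coefM.
rewrite (big_ord_widen_cond (D + j).+1 (fun i => (j <= i)%N)
  (fun i => d`_i * Defs.markov f (i - j)%N)); last by rewrite dD ltnS leq_addr.
rewrite [RHS]big_mkcond/=; apply: eq_bigr => i _; have := ltn_ord i => iD.
have [iS|Si] := ltnP i (size d); last by rewrite andbF nth_default// mul0r.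
rewrite andbT coef_poly; case: (leqP j i) => ji.
  case: ifP => [_|/negP[]]; last by lia.
  by congr (_ * Defs.markov f _); lia.
by case: ifP => [|_]; [lia|rewrite mulr0].
Qed.

End relative_degree.

(** * Polynomials in the shift and decay of Markov parameters *)

Section shift_op.
Variable F : comNzRingType.
Implicit Types (p q : {poly F}) (g : nat -> F).

(* [p] acting on a signal as a polynomial in the forward shift. *)
Definition shift_op p g (k : nat) : F := \sum_(i < size p) p`_i * g (k + i)%N.

Lemma shift_op_wide N p g k : (size p <= N)%N ->
  shift_op p g k = \sum_(i < N) p`_i * g (k + i)%N.
Proof.
move=> pN; rewrite /shift_op (big_ord_widen N (fun i => p`_i * g (k + i)%N))//.
rewrite big_mkcond/=; apply: eq_bigr => i _; case: ifP => // /negbT.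
by rewrite -leqNgt => /(nth_default 0) ->; rewrite mul0r.
Qed.

Lemma shift_opD p q g k : shift_op (p + q) g k = shift_op p g k + shift_op q g k.
Proof.
rewrite !(@shift_op_wide (maxn (size p) (size q))) ?leq_maxl ?leq_maxr ?size_polyD//.
by rewrite -big_split/=; apply: eq_bigr => i _; rewrite coefD mulrDl.
Qed.

Lemma shift_op0 g k : shift_op 0 g k = 0.
Proof. by rewrite /shift_op size_poly0 big_ord0. Qed.

Lemma shift_op_sum (J : Type) (s : seq J) (p : J -> {poly F}) g k :
  shift_op (\sum_(j <- s) p j) g k = \sum_(j <- s) shift_op (p j) g k.
Proof.
by elim: s => [|j s IH]; rewrite ?big_nil ?shift_op0// !big_cons shift_opD IH.
Qed.

Lemma shift_opC (c : F) g k : shift_op c%:P g k = c * g k.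
Proof.
rewrite (@shift_op_wide 1) ?size_polyC ?leq_b1// big_ord_recl big_ord0 addr0.
by rewrite coefC addn0.
Qed.

Lemma shift_opCM (c : F) p g k : shift_op (c%:P * p) g k = c * shift_op p g k.
Proof.
rewrite !(@shift_op_wide (size p)) ?mul_polyC ?size_scale_leq// mulr_sumr.
by apply: eq_bigr => i _; rewrite coefZ mulrA.
Qed.

Lemma shift_opMX p g k : shift_op (p * 'X) g k = shift_op p (fun k => g k.+1) k.
Proof.
rewrite (@shift_op_wide (size p).+1); last first.
  by apply: leq_trans (size_polyMleq _ _) _; rewrite size_polyX addn2.
rewrite big_ord_recl coefMX/= mul0r add0r /shift_op.
by apply: eq_bigr => i _; rewrite coefMX/= /bump/= add1n addnS.
Qed.

Lemma shift_opM p q g k : shift_op (p * q) g k = shift_op p (shift_op q g) k.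
Proof.
elim/poly_ind: p g k => [|p c IH] g k; first by rewrite mul0r !shift_op0.
rewrite mulrDl shift_opD mulrAC shift_opMX IH shift_opCM shift_opD shift_opMX shift_opC.
by congr (_ + _).
Qed.

Lemma shift_op_sumr (J : Type) (s : seq J) p (g : J -> nat -> F) k :
  shift_op p (fun k => \sum_(j <- s) g j k) k = \sum_(j <- s) shift_op p (g j) k.
Proof.
rewrite /shift_op exchange_big/=; apply: eq_bigr => i _.
by rewrite mulr_sumr.
Qed.

Lemma shift_opZr p (a : F) g k : shift_op p (fun k => a * g k) k = a * shift_op p g k.
Proof. by rewrite /shift_op mulr_sumr; apply: eq_bigr => i _; rewrite mulrCA. Qed.

Lemma shift_op_XsubC (l : F) g k : shift_op ('X - l%:P) g k = g k.+1 - l * g k.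
Proof.
by rewrite -[X in X - _]mul1r -polyCN shift_opD shift_opMX !shift_opC mul1r mulNr.
Qed.

End shift_op.

Section markov_decay.
Local Open Scope complex_scope.
Variable R : realType.
Local Notation normc := (@ComplexField.Normc.normc R).

Definition cdecay (g : nat -> R[i]) := expdecay (fun k => normc (g k)).

Lemma normc_ge0 (z : R[i]) : 0 <= normc z.
Proof. by case: z => a b; exact: sqrtr_ge0. Qed.

Lemma normcD (x y : R[i]) : normc (x + y) <= normc x + normc y.
Proof. by rewrite -lecR rmorphD/=; exact: (@ler_normD _ R[i]). Qed.

Lemma normc_real (a : R) : normc a%:C = `|a|.
Proof. by rewrite /= expr0n addr0 sqrtr_sqr. Qed.

Lemma cdecay_lrec (l : R[i]) (g : nat -> R[i]) : normc l < 1 ->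
  cdecay (fun k => g k.+1 - l * g k) -> cdecay g.
Proof.
move=> l1 [C [r [C0 r0 r1 b]]].
have nl0 := normc_ge0 l.
pose s := (1 + Num.max r (normc l)) / 2.
have m1 : Num.max r (normc l) < 1 by rewrite gt_max r1.
have rm : r <= Num.max r (normc l) by rewrite le_max lexx.
have lm : normc l <= Num.max r (normc l) by rewrite le_max lexx orbT.
have s1 : s < 1 by rewrite /s; lra.
have ls : normc l < s by rewrite /s; lra.
have rs : r <= s by rewrite /s; lra.
have s0 : 0 < s by lra.
(* The constant [B] closes the induction: [C <= B (s - |l|)] means [|l| B + C <= B s]. *)
exists (Num.max (normc (g 0%N)) (C / (s - normc l))), s; split=> //.
  by rewrite le_max normc_ge0.
set B := Num.max _ _.
have B0 : 0 <= B by rewrite /B le_max normc_ge0.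
have hB : C <= B * (s - normc l) by rewrite -ler_pdivrMr ?subr_gt0// /B le_max lexx orbT.
move=> k; rewrite ger0_norm ?normc_ge0//; elim: k => [|k IH].
  by rewrite expr0 mulr1 /B le_max lexx.
have -> : g k.+1 = l * g k + (g k.+1 - l * g k) by rewrite addrC subrK.
apply: (le_trans (normcD _ _)); rewrite ComplexField.Normc.normcM.
apply: (@le_trans _ _ (normc l * (B * s ^+ k) + C * s ^+ k)).
  apply: lerD; first exact: ler_wpM2l.
  have := b k; rewrite ger0_norm ?normc_ge0// => h; apply: (le_trans h).
  by apply: ler_wpM2l => //; apply: lerXn2r => //; rewrite nnegrE ltW.
rewrite mulrA -mulrDl exprS mulrA; apply: ler_wpM2r; first by rewrite exprn_ge0// ltW.
by move: hB; rewrite mulrBr; lra.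
Qed.

(** The linear factors are undone one at a time by [cdecay_lrec]; this is why real recurrences are
    passed to the complex numbers, where they split. *)
Lemma cdecay_shift_op (rs : seq R[i]) (g : nat -> R[i]) :
  (forall l, l \in rs -> normc l < 1) ->
  cdecay (shift_op (\prod_(l <- rs) ('X - l%:P)) g) -> cdecay g.
Proof.
elim: rs g => [|l rs IH] g h.
  rewrite big_nil /shift_op size_poly1.
  by apply: expdecay_le => k; rewrite big_ord_recl big_ord0 coef1/= mul1r addn0 addr0.
rewrite big_cons mulrC.
have -> : shift_op ((\prod_(j <- rs) ('X - j%:P)) * ('X - l%:P)) g =
    shift_op (\prod_(j <- rs) ('X - j%:P)) (fun k => g k.+1 - l * g k).
  apply/funext => k; rewrite shift_opM; congr shift_op; apply/funext => i.
  exact: shift_op_XsubC.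
move=> /IH d.
apply: (@cdecay_lrec l); first by apply: h; rewrite inE eqxx.
by apply: d => x xrs; apply: h; rewrite inE xrs orbT.
Qed.

Lemma expdecay_recurrence (d : {poly R}) (h : nat -> R) : d != 0 ->
  (forall z, root (map_poly (real_complex R) d) z -> normc z < 1) ->
  (forall k, \sum_(i < size d) d`_i * h (k + i)%N = 0) -> expdecay h.
Proof.
move=> d0 roots rec; pose dC := map_poly (real_complex R) d.
have [rs dE] := closed_field_poly_normal dC.
have dC0 : dC != 0 by rewrite map_poly_eq0.
have : cdecay (fun k => (h k)%:C).
  apply: (@cdecay_shift_op rs) => [l lrs|].
    apply: roots; rewrite -/dC dE rootZ ?lead_coef_eq0// root_prod_XsubC//.
  set p := \prod_(z <- rs) _ in dE *.
  have sp : size p = size d by rewrite -(size_map_poly (real_complex R) d) -/dC dE size_scale// lead_coef_eq0.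
  apply: expdecay_le (expdecay0 R) => k; rewrite /shift_op.
  have : lead_coef dC * \sum_(i < size p) p`_i * (h (k + i)%N)%:C = 0.
    rewrite mulr_sumr -[RHS](rmorph0 (real_complex R)) -(rec k) rmorph_sum/= sp.
    apply: eq_bigr => i _; rewrite mulrA -coefZ -dE /dC coef_map/= rmorphM//.
  move/eqP; rewrite mulf_eq0 lead_coef_eq0 (negPf dC0)/= => /eqP ->.
  by rewrite normr0 -(normr0 R) /= expr0n addr0 sqrtr0.
by apply: expdecay_le => k; rewrite normc_real normr_id.
Qed.

Local Notation "p %:F" := (@FracField.tofrac {poly R} p).

Lemma expdecay_markov (f : ratfun R) : vanish_inf 0 f ->
  (forall z, is_pole f z -> normc z < 1) -> expdecay (Defs.markov f).
Proof.
move=> v0 stab.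
(* A root of the stored denominator need not be a pole. After reduction, [d] divides the denominator
   of every representation, so all its roots are poles. *)
pose g := gcdp (numer f) (denom f).
pose n := numer f %/ g; pose d := denom f %/ g.
have dn0 : denom f != 0 := denom_neq0 f.
have g0 : g != 0 by rewrite gcdp_eq0 (negPf dn0) andbF.
have nE : numer f = n * g by rewrite divpK// dvdp_gcdl.
have dE : denom f = d * g by rewrite divpK// dvdp_gcdr.
have d0 : d != 0 by apply: contraNneq dn0 => d0; rewrite dE d0 mul0r.
have cop : coprimep n d by apply: coprimep_div_gcd; rewrite dn0 orbT.
have fE : f = n%:F / d%:F.
  by rewrite [LHS]numdenE nE dE !tofracM -mulf_div divff ?mulr1// tofrac_eq0.
have roots z : root (map_poly (real_complex R) d) z -> normc z < 1.
  move=> rz; apply: stab => n1 d1 d10 /eqP; rewrite fE tofrac_div_eq// => /eqP e.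
  have : d %| n * d1 by rewrite e dvdp_mull.
  rewrite Gauss_dvdpr; last by rewrite coprimep_sym.
  by case/dvdpP => q ->; rewrite rmorphM rootM rz orbT.
have nd : (size n <= size d)%N.
  have [->|n0] := eqVneq n 0; first by rewrite size_poly0.
  by rewrite -[size n]addn0; apply: vanish_infP; rewrite -?fE.
(* The recurrence starts at index 1, since index 0 carries the direct term; hence the shift. *)
apply: expdecay_unshift; apply: (@expdecay_recurrence d) => // k.
exact: markov_coef_tail nd.
Qed.

End markov_decay.

(** * Matrix filters and the closed loop *)

Section filters.
Variable R : realType.
Local Notation K := (ratfun R).

Definition proper_entries p m (F : 'M[K]_(p, m)) := forall i j, vanish_inf 0 (F i j).

Lemma proper_mx_entries p m (F : 'M[K]_(p, m)) : proper_mx F -> proper_entries F.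
Proof. by move=> h i j; exact: reldeg_ge_vanish_inf. Qed.

Lemma proper_entriesM p m n (F : 'M[K]_(p, m)) (G : 'M[K]_(m, n)) :
  proper_entries F -> proper_entries G -> proper_entries (F *m G).
Proof.
move=> pF pG i j; rewrite mxE; apply: vanish_inf_sum => k _.
by have := vanish_infM (pF i k) (pG k j).
Qed.

Lemma markov_mxM p m n (F : 'M[K]_(p, m)) (G : 'M[K]_(m, n)) k :
  proper_entries F -> proper_entries G ->
  markov_mx (F *m G) k = \sum_(s < k.+1) markov_mx F s *m markov_mx G (k - s).
Proof.
move=> pF pG; apply/matrixP => i j; rewrite mxE summxE [in LHS]mxE.
rewrite (@markov_expansion _ _ (fun k => \sum_l \sum_(s < k.+1)
    Defs.markov (F i l) s * Defs.markov (G l j) (k - s)%N)).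
  rewrite exchange_big/=; apply: eq_bigr => s _; rewrite mxE.
  by apply: eq_bigr => l _; rewrite !mxE.
by apply: expansion_sum => l; apply: expansionM; exact: expansion_markov.
Qed.

Lemma markov_mxD p m (F G : 'M[K]_(p, m)) k :
  proper_entries F -> proper_entries G ->
  markov_mx (F + G) k = markov_mx F k + markov_mx G k.
Proof.
move=> pF pG; apply/matrixP => i j; rewrite !mxE.
by rewrite (markov_expansion (expansionD (expansion_markov (pF i j)) (expansion_markov (pG i j)))).
Qed.

Lemma markov_mx1 m k : markov_mx (1%:M : 'M[K]_m) k = (k == 0%N)%:R%:M.
Proof.
apply/matrixP => i j; rewrite !mxE; case: eqP => _.
  by rewrite mulr1n (markov_expansion (@expansion1 R)) mulr1n.
by rewrite mulr0n (markov_expansion (@expansion0 R)) mulr0n.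
Qed.

Lemma markov_mxN p m (F : 'M[K]_(p, m)) k : proper_entries F ->
  markov_mx (- F) k = - markov_mx F k.
Proof.
move=> pF; apply/matrixP => i j; rewrite !mxE.
by rewrite (markov_expansion (expansionN (expansion_markov (pF i j)))).
Qed.

Lemma markov0_strictly_proper (f : K) : vanish_inf 1 f -> Defs.markov f 0%N = 0.
Proof.
move=> v; have e := expansion_markov (vanish_infW (leq0n 1) v).
have v1 : vanish_inf 1 (evz (trunc (Defs.markov f) 0)).
  by have := vanish_infB v (e 0%N); rewrite opprB addrC subrK.
have := evz_small (size_poly _ _) v1.
by move/(congr1 (fun p : {poly R} => p`_0)); rewrite coef_poly coef0.
Qed.

Lemma filtD p m (F G : 'M[K]_(p, m)) x t : proper_entries F -> proper_entries G ->
  filt (F + G) x t = filt F x t + filt G x t.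
Proof.
move=> pF pG; rewrite /filt -big_split/=; apply: eq_bigr => s _.
by rewrite markov_mxD// mulmxDl.
Qed.

Lemma filt_add p m (F : 'M[K]_(p, m)) x y t :
  filt F (fun t => x t + y t) t = filt F x t + filt F y t.
Proof. by rewrite /filt -big_split/=; apply: eq_bigr => s _; rewrite mulmxDr. Qed.

Lemma filt_sub p m (F : 'M[K]_(p, m)) x y t :
  filt F (fun t => x t - y t) t = filt F x t - filt F y t.
Proof. by rewrite /filt -sumrB/=; apply: eq_bigr => s _; rewrite mulmxBr. Qed.

Lemma filtN p m (F : 'M[K]_(p, m)) x t : proper_entries F ->
  filt (- F) x t = - filt F x t.
Proof.
by move=> pF; rewrite /filt -sumrN; apply: eq_bigr => s _; rewrite markov_mxN// mulNmx.
Qed.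

Lemma filt1 m (x : nat -> 'cV[R]_m) t : filt 1%:M x t = x t.
Proof.
rewrite /filt big_ord_recl markov_mx1/= mul1mx subn0 big1 ?addr0// => s _.
by rewrite markov_mx1/= raddf0 mul0mx.
Qed.

Lemma sum_lag (V : nmodType) (F : nat -> nat -> V) t :
  \sum_(s < t.+1) \sum_(r < (t - s).+1) F s r =
  \sum_(k < t.+1) \sum_(s < k.+1) F s (k - s)%N.
Proof.
transitivity (\sum_(s < t.+1) \sum_(k < t.+1 | (s <= k)%N) F s (k - s)%N).
  apply: eq_bigr => s _; have st := ltn_ord s.
  rewrite -(big_mkord xpredT (F s)) -(big_mkord (fun k => (s <= k)%N) (fun k => F s (k - s)%N)).
  rewrite [RHS](big_cat_nat (n := s)) //=; last exact: ltnW.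
  rewrite [X in _ = X + _]big_nat_cond [X in _ = X + _]big_pred0 ?add0r//; last first.
    by move=> k; rewrite [(s <= k)%N]leqNgt /= andbN.
  rewrite -[X in _ = \big[_/_]_(X <= _ < _ | _) _]add0n big_addn subSn; last by lia.
  by apply: eq_big => k; rewrite ?leq_addl// addnK.
rewrite (exchange_big_dep xpredT)//=; apply: eq_bigr => k _; have kt := ltn_ord k.
rewrite (big_ord_widen t.+1 (fun s => F s (k - s)%N))//.
Qed.

Lemma filt_comp p m n (F : 'M[K]_(p, m)) (G : 'M[K]_(m, n)) x t :
  proper_entries F -> proper_entries G ->
  filt F (filt G x) t = filt (F *m G) x t.
Proof.
move=> pF pG; rewrite /filt.
under eq_bigr do rewrite mulmx_sumr.
under [RHS]eq_bigr do rewrite markov_mxM// mulmx_suml.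
rewrite (sum_lag (fun s r => markov_mx F s *m (markov_mx G r *m x (t - s - r)%N))).
apply: eq_bigr => k _; apply: eq_bigr => s _.
by rewrite mulmxA; congr (_ *m x _); have := ltn_ord s; lia.
Qed.

(** In the Leibniz formula the identity permutation gives a product of terms equal to 1 at infinity,
    and every other permutation has an off-diagonal factor, which vanishes there. *)
Lemma det_sub_strictly_proper n (A : 'M[K]_n) : (forall i j, vanish_inf 1 (A i j)) ->
  vanish_inf 1 (\det (1%:M - A) - 1).
Proof.
move=> hA; rewrite /determinant (bigD1 (1%g : 'S_n))//= odd_perm1 expr0 mul1r addrAC.
have v0 i j : vanish_inf 0 ((1%:M - A) i j).
  rewrite !mxE; apply: vanish_infB; last exact: vanish_infW (hA i j).
  by case: (i == j); [exact: vanish_inf1|exact: vanish_inf0].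
apply: vanish_infD.
  elim/big_rec : _ => [|i x _ IH]; first by rewrite subrr; exact: vanish_inf0.
  rewrite !mxE perm1 eqxx mulrBl mul1r addrAC; apply: vanish_infB => //.
  rewrite -(subrK 1 x) mulrDr mulr1; apply: vanish_infD => //.
  by apply: (vanish_infW (k := 2)) => //; exact: (vanish_infM (k := 1) (l := 1)).
apply: vanish_inf_sum => s s1.
have [i si] : exists i, s i != i.
  apply/existsP; apply: contraNT s1; rewrite negb_exists => /forallP h.
  by apply/eqP/perm.permP => i; rewrite perm1; apply/eqP; have := h i; rewrite negbK.
rewrite (bigD1 i)//= mulrCA.
have vp : vanish_inf 0 (\prod_(j | j != i) (1%:M - A) j (s j)).
  elim/big_rec : _ => [|j x _ IH]; first exact: vanish_inf1.
  exact: (vanish_infM (k := 0) (l := 0)).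
rewrite -[1%N]addn0; apply: vanish_infM.
  by rewrite !mxE eq_sym (negPf si) sub0r; exact: vanish_infN.
rewrite -[0%N]addn0; apply: vanish_infM => //.
by case: (odd_perm s); rewrite ?expr0 ?expr1; [apply: vanish_infN|]; exact: vanish_inf1.
Qed.

Lemma not_vanish_inf1 : ~ vanish_inf 1 (1 : K).
Proof.
move=> v; have : vanish_inf 1 (evz (1 : {poly R})) by rewrite /evz rmorph1 hornerC.
move/evz_small; rewrite size_poly1 => /(_ isT)/eqP; by rewrite oner_eq0.
Qed.

Section loop.
Variables (p m ne neps : nat) (G : 'M[K]_(p, m)) (H : 'M[K]_(p, ne))
  (Gu : 'M[K]_(m, p)) (Hu : 'M[K]_(m, neps)).
Hypotheses (pH : proper_entries H) (pGu : proper_entries Gu) (pHu : proper_entries Hu).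
Hypothesis spG : forall i j, vanish_inf 1 (G i j).

Let pG : proper_entries G.
Proof. by move=> i j; exact: vanish_infW (spG i j). Qed.

Local Notation M := (1%:M - Gu *m G).

Lemma return_difference_unit : M \in unitmx.
Proof.
rewrite unitmxE unitfE; apply/negP => /eqP d0.
have := det_sub_strictly_proper (A := Gu *m G); rewrite d0 sub0r.
move=> h; apply: (@not_vanish_inf1); rewrite -[1]opprK; apply: vanish_infN; apply: h.
move=> i j; rewrite mxE; apply: vanish_inf_sum => k _.
exact: (vanish_infM (k := 0) (l := 1)).
Qed.

Lemma proper_return_difference : proper_entries M.
Proof.
move=> i j; rewrite mxE [X in vanish_inf _ (_ + X)]mxE mxE; apply: vanish_infB; last exact: proper_entriesM.
by case: (i == j); [exact: vanish_inf1|exact: vanish_inf0].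
Qed.

Lemma filt_return_difference (x : nat -> 'cV[R]_m) t :
  filt M x t = x t - filt Gu (filt G x) t.
Proof.
rewrite filtD; last 2 first.
- move=> i j; rewrite mxE.
  by case: (i == j); [exact: vanish_inf1|exact: vanish_inf0].
- by move=> i j; rewrite mxE; apply: vanish_infN; exact: proper_entriesM.
by rewrite filt1 filtN ?filt_comp//; exact: proper_entriesM.
Qed.

(* The loop is well posed: a causal filter followed by a strictly causal one
   has only the zero fixed point. *)
Lemma loop_fixpoint0 (z : nat -> 'cV[R]_m) :
  (forall t, z t = filt Gu (filt G z) t) -> forall t, z t = 0.
Proof.
move=> hz; elim/ltn_ind => t IH; rewrite hz /filt big1// => s _.
rewrite big1 ?mulmx0// => r _.
have [r0|r0] := posnP (r : nat).
  rewrite r0 (_ : markov_mx G 0 = 0) ?mul0mx//.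
  by apply/matrixP => i j; rewrite !mxE markov0_strictly_proper.
by rewrite IH ?mulmx0//; have := ltn_ord r; have := ltn_ord s; lia.
Qed.

(** The actual input and the candidate solve the same equation for the return difference, so their
    difference is a fixed point of the loop and vanishes. *)
Lemma loop_unique (w1 : nat -> 'cV[R]_ne) (w2 : nat -> 'cV[R]_neps)
    (u : nat -> 'cV[R]_m) (y : nat -> 'cV[R]_p) (A : 'M[K]_(m, ne)) (B : 'M[K]_(m, neps)) :
  proper_entries A -> proper_entries B -> M *m A = Gu *m H -> M *m B = Hu ->
  (forall t, y t = filt G u t + filt H w1 t) ->
  (forall t, u t = filt Gu y t + filt Hu w2 t) ->
  forall t, u t = filt A w1 t + filt B w2 t.
Proof.
move=> pA pB MA MB hy hu.
pose v t := filt A w1 t + filt B w2 t.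
have pM := proper_return_difference.
have hv t : v t - filt Gu (filt G v) t = filt Gu (filt H w1) t + filt Hu w2 t.
  by rewrite -filt_return_difference filt_add !filt_comp// MA MB.
have hu' t : u t - filt Gu (filt G u) t = filt Gu (filt H w1) t + filt Hu w2 t.
  rewrite {1}hu (_ : y = fun t => filt G u t + filt H w1 t); last exact/funext.
  by rewrite filt_add addrAC [X in X + _]addrAC subrr add0r.
move=> t; apply/eqP; rewrite -subr_eq0; apply/eqP.
apply: (loop_fixpoint0 (z := fun t => u t - v t)) => {}t.
have -> : filt G (fun t => u t - v t) = fun t => filt G u t - filt G v t.
  by apply/funext => s; rewrite filt_sub.
rewrite filt_sub -/(v _); apply/eqP; rewrite -subr_eq0 opprB.
have := hu' t; rewrite -hv => e; rewrite addrAC addrA.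
have -> : u t + filt Gu (filt G v) t - filt Gu (filt G u) t =
  (u t - filt Gu (filt G u) t) + filt Gu (filt G v) t by rewrite addrAC.
by rewrite e; apply/eqP; rewrite subrK subrr.
Qed.

End loop.
End filters.

(** * Real least squares *)

Section quadratic.
Variables (R : realFieldType) (J : finType).
Implicit Types (Phi : J -> J -> R) (f th : J -> R).

(** A least-squares cost with regressor Gram matrix [Phi], correlations [f] with the output, and
    output energy [c]. Sample costs, mean costs and their limit all have this form. *)
Definition quad Phi f (c : R) th : R :=
  c - 2 * (\sum_j th j * f j) + \sum_j \sum_k th j * th k * Phi j k.

Lemma quad_min_normal_eq Phi f c th : (forall j k, Phi j k = Phi k j) ->
  (forall th', quad Phi f c th <= quad Phi f c th') ->
  forall j, \sum_k Phi j k * th k = f j.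
Proof.
move=> sym mn j0.
pose g := \sum_k Phi j0 k * th k - f j0; pose a := Phi j0 j0.
have pert h : quad Phi f c (fun j => th j + h * (j == j0)%:R) =
    quad Phi f c th + 2 * h * g + h ^+ 2 * a.
  have delta (F : J -> R) : \sum_j (j == j0)%:R * F j = F j0.
    rewrite (bigD1 j0)//= eqxx mul1r big1 ?addr0// => j /negPf ->.
    by rewrite mul0r.
  have e1 : \sum_j (th j + h * (j == j0)%:R) * f j = \sum_j th j * f j + h * f j0.
    rewrite -(delta f) mulr_sumr -big_split/=; apply: eq_bigr => j _; ring.
  have e2 : \sum_j \sum_k (th j + h * (j == j0)%:R) * (th k + h * (k == j0)%:R) * Phi j k =
      \sum_j \sum_k th j * th k * Phi j k + 2 * h * (\sum_k Phi j0 k * th k) + h ^+ 2 * a.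
    have s1 : \sum_j \sum_k h * ((j == j0)%:R * (Phi j k * th k)) = h * \sum_k Phi j0 k * th k.
      rewrite -(delta (fun j => \sum_k Phi j k * th k)) mulr_sumr; apply: eq_bigr => j _.
      by rewrite !mulr_sumr.
    have s2 : \sum_j \sum_k h * ((k == j0)%:R * (Phi j k * th j)) = h * \sum_k Phi j0 k * th k.
      rewrite exchange_big/= -s1; apply: eq_bigr => j _; apply: eq_bigr => k _.
      by rewrite sym.
    have s3 : \sum_j \sum_k h ^+ 2 * ((j == j0)%:R * ((k == j0)%:R * Phi j k)) = h ^+ 2 * a.
      rewrite /a -(delta (fun k => Phi j0 k)).
      rewrite -(delta (fun j => \sum_k (k == j0)%:R * Phi j k)) mulr_sumr.
      by apply: eq_bigr => j _; rewrite !mulr_sumr.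
    have -> (X B Y : R) : X + 2 * h * B + Y = X + (h * B + h * B) + Y by ring.
    rewrite -{1}s1 -s2 -s3 -!big_split/=; apply: eq_bigr => j _.
    rewrite -!big_split/=; apply: eq_bigr => k _; ring.
  rewrite /quad e1 e2 /g; ring.
have na : 0 < `|a| + 1 by rewrite ltr_wpDl.
(* Moving coordinate [j0] by [-g / (|a| + 1)] decreases the cost whenever [g] is nonzero, whatever
   the sign of [a]. *)
have := mn (fun j => th j + (- g / (`|a| + 1)) * (j == j0)%:R).
rewrite pert -addrA lerDl => h.
have h2 : 0 <= g ^+ 2 * (a - 2 * (`|a| + 1)).
  have -> : g ^+ 2 * (a - 2 * (`|a| + 1)) =
      (2 * (- g / (`|a| + 1)) * g + (- g / (`|a| + 1)) ^+ 2 * a) * (`|a| + 1) ^+ 2.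
    by field; rewrite gt_eqF.
  by rewrite mulr_ge0// sqr_ge0.
have neg : a - 2 * (`|a| + 1) < 0 by have := ler_norm a; have := normr_ge0 a; lra.
rewrite nmulr_lge0// in h2.
have : g == 0 by rewrite -sqrf_eq0 eq_le h2 sqr_ge0.
by rewrite /g subr_eq0 => /eqP.
Qed.

Lemma left_inverse_of_injective Phi :
  (forall th, (forall j, \sum_k Phi j k * th k = 0) -> forall k, th k = 0) ->
  exists Psi : J -> J -> R, forall i k, \sum_j Psi i j * Phi j k = (i == k)%:R.
Proof.
move=> ker.
(* Transposed, since kernels and inverses are taken on row vectors. *)
pose A := \matrix_(i < #|J|, j < #|J|) Phi (enum_val j) (enum_val i).
have uA : A \in unitmx.
  rewrite -row_free_unit -kermx_eq0; apply/eqP/row_matrixP => i0; rewrite row0.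
  set v := row i0 _.
  have vA : v *m A = 0 by rewrite /v -row_mul mulmx_ker row0.
  apply/rowP => i; rewrite [RHS]mxE.
  have := ker (fun k => v 0 (enum_rank k)).
  move=> /(_ _ (enum_val i)); rewrite enum_valK; apply=> j.
  move/rowP: vA => /(_ (enum_rank j)); rewrite !mxE => vAj; rewrite -[RHS]vAj.
  rewrite [RHS](reindex_onto enum_rank enum_val)/=; last by move=> *; rewrite enum_valK.
  apply: eq_big => [k|k _]; first by rewrite enum_rankK eqxx.
  by rewrite !mxE !enum_rankK mulrC.
exists (fun i j => invmx A (enum_rank j) (enum_rank i)) => i k.
have := mulmxV uA => /matrixP/(_ (enum_rank k) (enum_rank i)).
rewrite !mxE (inj_eq enum_rank_inj) eq_sym => <-.
rewrite [RHS](reindex_onto enum_rank enum_val)/=; last by move=> *; rewrite enum_valK.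
apply: eq_big => [j|j _]; first by rewrite enum_rankK eqxx.
by rewrite !mxE !enum_rankK mulrC.
Qed.

Lemma normal_eq_perturbation Phi f th (Psi : J -> J -> R) :
  (forall i k, \sum_j Psi i j * Phi j k = (i == k)%:R) ->
  (forall j, \sum_k Phi j k * th k = f j) ->
  exists2 C : R, 0 < C & forall (Phi' : J -> J -> R) (f' th' : J -> R) (del : R),
    (forall j k, `|Phi' j k - Phi j k| <= del) -> (forall j, `|f' j - f j| <= del) ->
    (forall j, \sum_k Phi' j k * th' k = f' j) -> 0 <= del -> C * del <= 1 / 2 ->
    \sum_k `|th' k - th k| <= 2 * C * del.
Proof.
move=> inv ne.
pose S := \sum_i \sum_j `|Psi i j|; pose T := \sum_k `|th k|.
have S0 : 0 <= S by apply: sumr_ge0 => i _; exact: sumr_ge0.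
have T0 : 0 <= T by exact: sumr_ge0.
(* With [D] the distance between the solutions, [Phi (th' - th)] has entries at most
   [del (1 + T + D)]. Applying [Psi] gives [D <= C del (1 + D)], and [C del <= 1/2] absorbs the [D]
   on the right. *)
exists ((S + 1) * (1 + T)); first by rewrite mulr_gt0//; lra.
move=> Phi' f' th' del hPhi hf ne' del0 small.
pose D := \sum_k `|th' k - th k|.
have D0 : 0 <= D by exact: sumr_ge0.
have sT : \sum_k `|th' k| <= T + D.
  rewrite /T /D -big_split/=; apply: ler_sum => k _.
  by rewrite -{1}(subrK (th k) (th' k)) addrC (le_trans (ler_normD _ _)).
pose e j := \sum_k Phi j k * (th' k - th k).
have he j : `|e j| <= del * (1 + T + D).
  have -> : e j = \sum_k (Phi j k - Phi' j k) * th' k + (f' j - f j).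
    rewrite -ne' -ne /e -sumrB -big_split/=; apply: eq_bigr => k _; ring.
  apply: (le_trans (ler_normD _ _)).
  apply: (@le_trans _ _ (del * (T + D) + del)); last by rewrite le_eqVlt; apply/orP; left; apply/eqP; ring.
  apply: lerD => //; apply: (le_trans (ler_norm_sum _ _ _)).
  apply: (@le_trans _ _ (\sum_k del * `|th' k|)).
    by apply: ler_sum => k _; rewrite normrM ler_wpM2r// distrC.
  by rewrite -mulr_sumr ler_wpM2l.
have De : D <= S * (del * (1 + T + D)).
  rewrite /S mulr_suml /D; apply: ler_sum => i _.
  have -> : th' i - th i = \sum_j Psi i j * e j.
    rewrite /e; under [RHS]eq_bigr do rewrite mulr_sumr.
    rewrite exchange_big/= (bigD1 i)//= [X in _ = _ + X]big1 ?addr0.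
      under [RHS]eq_bigr do rewrite mulrA.
      by rewrite -mulr_suml inv eqxx mul1r.
    move=> k ki; under eq_bigr do rewrite mulrA.
    by rewrite -mulr_suml inv eq_sym (negPf ki) mul0r.
  apply: (le_trans (ler_norm_sum _ _ _)); rewrite mulr_suml; apply: ler_sum => j _.
  by rewrite normrM ler_wpM2l.
set C := (S + 1) * (1 + T) in small *.
have : D <= C * del * (1 + D).
  apply: (le_trans De); rewrite /C.
  have -> : (S + 1) * (1 + T) * del * (1 + D) =
    S * (del * (1 + T + D)) + del * (S * T * D + (1 + T) * (1 + D)) by ring.
  by rewrite lerDl mulr_ge0// addr_ge0// ?mulr_ge0// addr_ge0.
rewrite -/D => hD.
have : C * del * D <= 1 / 2 * D by exact: ler_wpM2r.
move: hD; rewrite mulrDr mulr1; lra.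
Qed.

End quadratic.

Section limits.
Variable R : realType.

Lemma cvg_finsum (J : Type) (s : seq J) (u : J -> nat -> R) (l : J -> R) :
  (forall j, u j @ \oo --> l j) ->
  (fun n => \sum_(j <- s) u j n) @ \oo --> \sum_(j <- s) l j.
Proof.
move=> h; elim: s => [|j s IH].
  by rewrite big_nil; under eq_fun do rewrite big_nil; exact: cvg_cst.
rewrite big_cons; under eq_fun do rewrite big_cons.
exact: cvgD.
Qed.

Lemma cvg_scale (a : R) (u : nat -> R) (l : R) : u @ \oo --> l ->
  (fun n => a * u n) @ \oo --> a * l.
Proof. by move=> h; apply: cvgM => //; exact: cvg_cst. Qed.

Lemma powR_le_near (s e : R) : 0 < s -> 0 < e ->
  \forall N \near \oo, N%:R `^ (- s) <= e.
Proof.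
move=> s0 e0; near=> N.
have N0 : (0 < N)%N by near: N; exact: nbhs_infty_gt.
rewrite powRN invf_ple ?posrE ?powR_gt0 ?ltr0n//.
have eE : e^-1 = (e^-1 `^ s^-1) `^ s.
  by rewrite -powRrM mulVf ?gt_eqF// powRr1// invr_ge0 ltW.
rewrite eE; apply: ge0_ler_powR; rewrite ?nnegrE ?powR_ge0// ?ltW//.
by near: N; exact: nbhs_infty_gtr.
Unshelve. all: by end_near.
Qed.

End limits.

(** * The rate for real least squares driven by white noise *)

Section real_least_squares.
Context d (T : measurableType d) (R : realType) (P : probability T R).
Variables (I : finType) (W : nat -> I -> T -> R).
Hypothesis WN : white_noise P W.

Section gram_quadratic.
Variables (J : finType) (al : J -> nat -> I -> R).
Hypothesis dal : forall j c, expdecay ((al j)^~ c).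

Lemma gram_series_cvg (a b : nat -> I -> R) : (forall c, expdecay (a^~ c)) ->
  (forall c, expdecay (b^~ c)) ->
  series (fun s => \sum_c a s c * b s c) @ \oo --> gram a b.
Proof.
move=> da db; apply: expdecay_is_cvg; apply: expdecay_sum => c.
exact: expdecay_mul.
Qed.

Lemma expdecay_lincomb (th : J -> R) c :
  expdecay (fun s => \sum_j th j * al j s c).
Proof. by apply: expdecay_sum => j; apply: expdecayZ. Qed.

Lemma gram_lincomb (th : J -> R) :
  \sum_j \sum_k th j * th k * gram (al j) (al k) =
  gram (fun s c => \sum_j th j * al j s c) (fun s c => \sum_j th j * al j s c).
Proof.
have h1 := gram_series_cvg (expdecay_lincomb th) (expdecay_lincomb th).
have h2 : (fun n => \sum_j \sum_k th j * th k *
      series (fun s => \sum_c al j s c * al k s c) n) @ \oo -->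
    \sum_j \sum_k th j * th k * gram (al j) (al k).
  apply: cvg_finsum => j; apply: cvg_finsum => k; apply: cvg_scale.
  exact: gram_series_cvg.
rewrite -(cvg_lim (@Rhausdorff R) h2) -(cvg_lim (@Rhausdorff R) h1); congr (lim (_ @ \oo)).
apply/funext => n; rewrite /series/=.
under eq_bigr do under eq_bigr do rewrite mulr_sumr.
under eq_bigr do rewrite exchange_big.
rewrite exchange_big/=; apply: eq_bigr => s _.
under eq_bigr do under eq_bigr do rewrite mulr_sumr.
under eq_bigr do rewrite exchange_big.
rewrite exchange_big/=; apply: eq_bigr => c _.
rewrite big_distrlr/=; apply: eq_bigr => j _; apply: eq_bigr => k _; ring.
Qed.

Lemma gram_ge_term (a : nat -> I -> R) s c : (forall c, expdecay (a^~ c)) ->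
  a s c ^+ 2 <= gram a a.
Proof.
move=> da; have cv := gram_series_cvg da da.
have nd : nondecreasing_seq (series (fun s => \sum_c a s c * a s c)).
  apply/nondecreasing_seqP => n; rewrite /series/= big_nat_recr//= lerDl.
  by apply: sumr_ge0 => c' _; rewrite -expr2 sqr_ge0.
have := nondecreasing_cvgn_le nd (cvgP _ cv) s.+1.
rewrite (cvg_lim _ cv)//; apply: le_trans.
rewrite /series/= big_nat_recr//= (bigD1 c)//= addrCA lerDl.
rewrite addr_ge0//; apply: sumr_ge0 => i _; last by rewrite -expr2 sqr_ge0.
by apply: sumr_ge0 => j _; rewrite -expr2 sqr_ge0.
Qed.

End gram_quadratic.

Section quad_linear.
Variables (J : finType) (th : J -> R).

Lemma quad_res (L : finType) (y : L -> R) (psi : L -> J -> R) :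
  \sum_l (y l - \sum_j th j * psi l j) ^+ 2 =
  quad (fun j k => \sum_l psi l j * psi l k) (fun j => \sum_l y l * psi l j)
    (\sum_l y l * y l) th.
Proof.
rewrite /quad.
have -> : \sum_j th j * \sum_l y l * psi l j = \sum_l y l * \sum_j th j * psi l j.
  under eq_bigr do rewrite mulr_sumr; rewrite exchange_big/=; apply: eq_bigr => l _.
  by rewrite mulr_sumr; apply: eq_bigr => j _; rewrite mulrCA.
have -> : \sum_j \sum_k th j * th k * \sum_l psi l j * psi l k =
    \sum_l (\sum_j th j * psi l j) * (\sum_j th j * psi l j).
  under eq_bigr do under eq_bigr do rewrite mulr_sumr.
  under eq_bigr do rewrite exchange_big.
  rewrite exchange_big/=; apply: eq_bigr => l _; rewrite big_distrlr/=.
  by apply: eq_bigr => j _; apply: eq_bigr => k _; ring.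
rewrite mulr_sumr -sumrB -big_split/=; apply: eq_bigr => l _; ring.
Qed.

Lemma quad_mean N (Phi : nat -> J -> J -> R) f c (a : R) :
  a * (\sum_(t < N) quad (Phi t) (f t) (c t) th) =
  quad (fun j k => a * \sum_(t < N) Phi t j k) (fun j => a * \sum_(t < N) f t j)
    (a * \sum_(t < N) c t) th.
Proof.
rewrite /quad big_split/= sumrB -!mulr_sumr.
have -> : \sum_j th j * (a * \sum_(t < N) f t j) = a * \sum_(t < N) \sum_j th j * f t j.
  rewrite exchange_big/= mulr_sumr; apply: eq_bigr => j _.
  by rewrite mulrCA mulr_sumr.
have -> : \sum_j \sum_k th j * th k * (a * \sum_(t < N) Phi t j k) =
    a * \sum_(t < N) \sum_j \sum_k th j * th k * Phi t j k.
  rewrite [in RHS]exchange_big/= mulr_sumr; apply: eq_bigr => j _.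
  rewrite exchange_big/= mulr_sumr; apply: eq_bigr => k _.
  by rewrite mulrCA mulr_sumr.
ring.
Qed.

Lemma quad_cvg (Phi : nat -> J -> J -> R) f c Phi' f' (c' : R) :
  (forall j k, (fun t => Phi t j k) @ \oo --> Phi' j k) ->
  (forall j, (fun t => f t j) @ \oo --> f' j) -> c @ \oo --> c' ->
  (fun t => quad (Phi t) (f t) (c t) th) @ \oo --> quad Phi' f' c' th.
Proof.
move=> hP hf hc; apply: cvgD; first apply: cvgB => //.
  by apply: cvg_scale; apply: cvg_finsum => j; apply: cvg_scale; exact: hf.
by apply: cvg_finsum => j; apply: cvg_finsum => k; apply: cvg_scale; exact: hP.
Qed.

Lemma quad_Rintegral (Phi : T -> J -> J -> R) f c :
  (forall j k, P.-integrable setT (EFin \o (fun x => Phi x j k))) ->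
  (forall j, P.-integrable setT (EFin \o (fun x => f x j))) ->
  P.-integrable setT (EFin \o c) ->
  P.-integrable setT (EFin \o (fun x => quad (Phi x) (f x) (c x) th)) /\
  \int[P]_x quad (Phi x) (f x) (c x) th =
  quad (fun j k => \int[P]_x Phi x j k) (fun j => \int[P]_x f x j) (\int[P]_x c x) th.
Proof.
move=> iP iF ic.
have i1 : P.-integrable setT (EFin \o (fun x => 2 * \sum_j th j * f x j)).
  by apply: integrable_scale; apply: integrable_bigsum => j; exact: integrable_scale.
have i2' j : P.-integrable setT (EFin \o (fun x => \sum_k th j * th k * Phi x j k)).
  by apply: integrable_bigsum => k; exact: integrable_scale.
have i2 : P.-integrable setT (EFin \o (fun x => \sum_j \sum_k th j * th k * Phi x j k)).
  exact: integrable_bigsum.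
have i3 : P.-integrable setT (EFin \o (fun x => c x - 2 * \sum_j th j * f x j)).
  by have := integrableB measurableT ic i1; apply: eq_integrable => //= x _; rewrite EFinB.
split.
  by have := integrableD measurableT i3 i2; apply: eq_integrable => //= x _; rewrite EFinD.
rewrite /quad RintegralD// RintegralB// RintegralZl//; last first.
  by apply: integrable_bigsum => j; exact: integrable_scale.
rewrite !Rintegral_sum//; last by move=> j; exact: integrable_scale.
congr (_ - _ * _ + _).
  by apply: eq_bigr => j _; rewrite RintegralZl.
apply: eq_bigr => j _; rewrite Rintegral_sum; last by move=> k; exact: integrable_scale.
by apply: eq_bigr => k _; rewrite RintegralZl.
Qed.

End quad_linear.

Variables (L J : finType) (yc : L -> nat -> I -> R) (pc : L -> J -> nat -> I -> R).
Hypotheses (dy : forall l c, expdecay ((yc l)^~ c))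
  (dp : forall l j c, expdecay ((pc l j)^~ c)).

(** [L] indexes the real output components and [J] the real unknowns; each unknown has its own
    regressor in each component. *)
Definition residual_sqr (th : J -> R) (t : nat) (x : T) : R :=
  \sum_l (sig W (yc l) t x - \sum_j th j * sig W (pc l j) t x) ^+ 2.

Definition gramPhi (j k : J) : R := \sum_l gram (pc l j) (pc l k).
Definition gramf (j : J) : R := \sum_l gram (yc l) (pc l j).
Definition gramc : R := \sum_l gram (yc l) (yc l).

Lemma integrable_residual_sqr th t :
  P.-integrable setT (EFin \o residual_sqr th t) /\
  \int[P]_x residual_sqr th t x =
  quad (fun j k => \int[P]_x (\sum_l sig W (pc l j) t x * sig W (pc l k) t x))
    (fun j => \int[P]_x (\sum_l sig W (yc l) t x * sig W (pc l j) t x))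
    (\int[P]_x (\sum_l sig W (yc l) t x * sig W (yc l) t x)) th.
Proof.
have is2 (a b : L -> nat -> I -> R) :
    P.-integrable setT (EFin \o (fun x => \sum_l sig W (a l) t x * sig W (b l) t x)).
  by apply: integrable_bigsum => l; exact: integrable_sig_mul.
have -> : residual_sqr th t = fun x => quad
    (fun j k => \sum_l sig W (pc l j) t x * sig W (pc l k) t x)
    (fun j => \sum_l sig W (yc l) t x * sig W (pc l j) t x)
    (\sum_l sig W (yc l) t x * sig W (yc l) t x) th.
  by apply/funext => x; exact: quad_res.
by apply: quad_Rintegral => [j k|j|]; exact: is2.
Qed.

Lemma mean_residual_sqr_cvg th :
  (fun t => \int[P]_x residual_sqr th t x) @ \oo --> quad gramPhi gramf gramc th.
Proof.
have -> : (fun t => \int[P]_x residual_sqr th t x) = fun t =>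
  quad (fun j k => \int[P]_x (\sum_l sig W (pc l j) t x * sig W (pc l k) t x))
    (fun j => \int[P]_x (\sum_l sig W (yc l) t x * sig W (pc l j) t x))
    (\int[P]_x (\sum_l sig W (yc l) t x * sig W (yc l) t x)) th.
  by apply/funext => t; case: (integrable_residual_sqr th t).
have h (a b : L -> nat -> I -> R) : (forall l c, expdecay ((a l)^~ c)) ->
    (forall l c, expdecay ((b l)^~ c)) ->
    (fun t => \int[P]_x (\sum_l sig W (a l) t x * sig W (b l) t x)) @ \oo -->
    \sum_l gram (a l) (b l).
  move=> da db; rewrite (_ : (fun t => _) = fun t => \sum_l \int[P]_x (sig W (a l) t x * sig W (b l) t x)).
    by apply: cvg_finsum => l; exact: gram_cvg.
  by apply/funext => t; rewrite Rintegral_sum// => l; exact: integrable_sig_mul.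
by apply: quad_cvg => [j k|j|]; exact: h.
Qed.

Hypothesis injective_regressor : forall th : J -> R,
  (forall l s c, \sum_j th j * pc l j s c = 0) -> forall j, th j = 0.

(** A kernel vector makes the quadratic form vanish. That form is a sum over [l] of nonnegative
    energies, each dominating every squared coefficient of the combined filter. *)
Lemma gramPhi_ker (th : J -> R) : (forall j, \sum_k gramPhi j k * th k = 0) ->
  forall j, th j = 0.
Proof.
move=> h; apply: injective_regressor => l s c.
have z : \sum_l gram (fun s c => \sum_j th j * pc l j s c) (fun s c => \sum_j th j * pc l j s c) = 0.
  under eq_bigr do rewrite -(gram_lincomb (dp _)).
  rewrite exchange_big/=; rewrite big1// => j _; rewrite exchange_big/=.
  transitivity (th j * \sum_k gramPhi j k * th k); last by rewrite h mulr0.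
  rewrite mulr_sumr; apply: eq_bigr => k _; rewrite /gramPhi mulr_suml mulr_sumr.
  by apply: eq_bigr => l' _; ring.
have g0 l' : 0 <= gram (fun s c => \sum_j th j * pc l' j s c) (fun s c => \sum_j th j * pc l' j s c).
  apply: le_trans (gram_ge_term s c _); first exact: sqr_ge0.
  exact: (expdecay_lincomb (dp l') th).
have := gram_ge_term s c (expdecay_lincomb (dp l) th).
have gl0 := psumr_eq0P (fun l' _ => g0 l') z (i := l) isT.
rewrite /= gl0.
by move=> le0; apply/eqP; rewrite -sqrf_eq0 eq_le le0 sqr_ge0.
Qed.

Lemma ae_forall_fin (F : finType) (A : F -> T -> Prop) :
  (forall i, {ae P, forall x, A i x}) -> {ae P, forall x, forall i, A i x}.
Proof. by move=> h; apply: filter_forall. Qed.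

Lemma least_squares_rate (thN : nat -> T -> J -> R) (ths : J -> R) (eta : R) :
  0 < eta -> eta < 1 / 2 ->
  (forall th, quad gramPhi gramf gramc ths <= quad gramPhi gramf gramc th) ->
  {ae P, forall x, \forall N \near \oo, forall th : J -> R,
     N%:R^-1 * \sum_(t < N) residual_sqr (thN N x) t x <=
     N%:R^-1 * \sum_(t < N) residual_sqr th t x} ->
  {ae P, forall x, exists K : R, \forall N \near \oo,
     \sum_j `|thN N x j - ths j| <= K * N%:R `^ (- 2^-1 + eta)}.
Proof.
move=> eta0 eta1 mins minN.
have gs (a b : L -> nat -> I -> R) : (forall l c, expdecay ((a l)^~ c)) ->
    (forall l c, expdecay ((b l)^~ c)) ->
    {ae P, forall x, exists K, forall N, (0 < N)%N ->
      `|N%:R^-1 * (\sum_(t < N) \sum_l sig W (a l) t x * sig W (b l) t x)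
        - \sum_l gram (a l) (b l)| <= K * N%:R `^ (- 2^-1 + eta)}.
  move=> da db; have := ae_forall_fin (fun l => sig_mean_rate WN (da l) (db l) eta0).
  apply: filterS => x /choice[K hK]; exists (\sum_l K l) => N N0.
  rewrite exchange_big/= mulr_sumr -sumrB mulr_suml; apply: (le_trans (ler_norm_sum _ _ _)).
  by apply: ler_sum => l _; exact: hK.
have aPhi := ae_forall_fin (fun jk : J * J => gs (pc^~ jk.1) (pc^~ jk.2)
  (fun l c => dp l jk.1 c) (fun l c => dp l jk.2 c)).
have af := ae_forall_fin (fun j : J => gs yc (pc^~ j) dy (fun l c => dp l j c)).
have [Psi hPsi] := left_inverse_of_injective gramPhi_ker.
have sym j k : gramPhi j k = gramPhi k j.
  apply: eq_bigr => l _; rewrite /gram; congr (limn (series _)).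
  by apply/funext => s; apply: eq_bigr => c _; rewrite mulrC.
have nes := quad_min_normal_eq sym mins.
have [C C0 hC] := normal_eq_perturbation hPsi nes.
apply: filterS3 minN aPhi af => x minx /choice[K1 hK1] /choice[K2 hK2].
(* One constant dominating the path-dependent constants of the finitely many entries. *)
pose K := \sum_jk `|K1 jk| + \sum_j `|K2 j|.
have K0 : 0 <= K by rewrite addr_ge0// sumr_ge0.
have KK1 jk : K1 jk <= K.
  apply: (le_trans (ler_norm _)); rewrite /K (bigD1 jk)//= -addrA lerDl.
  by rewrite addr_ge0// sumr_ge0.
have KK2 j : K2 j <= K.
  apply: (le_trans (ler_norm _)); rewrite /K (bigD1 j)//= addrCA lerDl.
  by rewrite addr_ge0// sumr_ge0.
exists (2 * C * K).
(* Here [eta < 1/2] enters: the perturbation tends to 0 and eventually satisfies the absorption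
   condition. *)
have small : \forall N \near \oo, C * (K * N%:R `^ (- 2^-1 + eta)) <= 1 / 2.
  have e0 : 0 < (1 / 2) / (C * (K + 1)) by rewrite divr_gt0// mulr_gt0// ltr_wpDl.
  have s0 : 0 < 2^-1 - eta by lra.
  apply: filterS (powR_le_near s0 e0) => N; rewrite opprB addrC.
  rewrite ler_pdivlMr; last by rewrite mulr_gt0// ltr_wpDl.
  rewrite mulrC -mulrA; apply: le_trans; apply: ler_wpM2l; first exact: ltW.
  by apply: ler_wpM2r; rewrite ?powR_ge0// lerDl.
near=> N.
have N0 : (0 < N)%N by near: N; exact: nbhs_infty_gt.
rewrite -(mulrA (2 * C)); set del := K * _.
apply: (hC (fun j k => N%:R^-1 * \sum_(t < N) \sum_l sig W (pc l j) t x * sig W (pc l k) t x)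
  (fun j => N%:R^-1 * \sum_(t < N) \sum_l sig W (yc l) t x * sig W (pc l j) t x)
  (thN N x) del).
- move=> j k; apply: (le_trans (hK1 (j, k) N N0)); apply: ler_wpM2r => //; exact: powR_ge0.
- move=> j; apply: (le_trans (hK2 j N N0)); apply: ler_wpM2r => //; exact: powR_ge0.
- have mN : forall th : J -> R, N%:R^-1 * \sum_(t < N) residual_sqr (thN N x) t x <=
     N%:R^-1 * \sum_(t < N) residual_sqr th t x by near: N.
  apply: (@quad_min_normal_eq _ _ _ _ (N%:R^-1 * \sum_(t < N) \sum_l sig W (yc l) t x * sig W (yc l) t x)).
    move=> j k; congr (_ * _); apply: eq_bigr => t _; apply: eq_bigr => l _.
    exact: mulrC.
  have rq th : N%:R^-1 * \sum_(t < N) residual_sqr th t x = quad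
      (fun j k => N%:R^-1 * \sum_(t < N) \sum_l sig W (pc l j) t x * sig W (pc l k) t x)
      (fun j => N%:R^-1 * \sum_(t < N) \sum_l sig W (yc l) t x * sig W (pc l j) t x)
      (N%:R^-1 * \sum_(t < N) \sum_l sig W (yc l) t x * sig W (yc l) t x) th.
    rewrite -(quad_mean th (fun t j k => \sum_l sig W (pc l j) t x * sig W (pc l k) t x)
      (fun t j => \sum_l sig W (yc l) t x * sig W (pc l j) t x)
      (fun t => \sum_l sig W (yc l) t x * sig W (yc l) t x)).
    by congr (_ * _); apply: eq_bigr => t _; exact: quad_res.
  by move=> th; rewrite -!rq.
- by rewrite /del mulr_ge0// powR_ge0.
- by rewrite /del; near: N.
Unshelve. all: by end_near.
Qed.

End real_least_squares.

(** * Identifiability of the residues *)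

Section shift_filters.
Local Open Scope complex_scope.
Variable R : realType.
Local Notation K := (ratfun R).
Local Notation "p %:F" := (@FracField.tofrac {poly R} p).

Lemma common_denominator p m (F : 'M[K]_(p, m)) :
  exists (d : {poly R}) (N : 'M[{poly R}]_(p, m)),
    d != 0 /\ forall i j, F i j = (N i j)%:F / d%:F.
Proof.
pose d := \prod_(ij : 'I_p * 'I_m) denom (F ij.1 ij.2).
have d0 : d != 0 by apply/prodf_neq0 => ij _; exact: denom_neq0.
exists d, (\matrix_(i, j) (numer (F i j) *
  \prod_(ij : 'I_p * 'I_m | ij != (i, j)) denom (F ij.1 ij.2))); split=> // i j.
rewrite mxE {1}[F i j]numdenE; apply/eqP; rewrite tofrac_div_eq ?denom_neq0//.
by rewrite /d (bigD1 (i, j))//= mulrA mulrAC.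
Qed.

(** Exact at every [t], without transient: input samples before [t] are multiplied by a vanishing
    recurrence, and the sample at [t + j] by coefficient [j] of [n], through [markov_coef_tail] and
    [markov_coef_head]. *)
Lemma shift_op_markov (f : K) (n d : {poly R}) (x : nat -> R) t :
  d != 0 -> f = n%:F / d%:F -> (size n <= size d)%N ->
  shift_op d (fun t => \sum_(s < t.+1) Defs.markov f s * x (t - s)%N) t = shift_op n x t.
Proof.
move=> d0 fE nd; rewrite (shift_op_wide x t nd) /shift_op.
set S := size d; pose h := Defs.markov f.
transitivity (\sum_(tau < t + S) \sum_(i < S | (tau <= t + i)%N)
    d`_i * h (t + i - tau)%N * x tau).
  rewrite (exchange_big_dep xpredT)//=; apply: eq_bigr => i _; have := ltn_ord i => iS.
  rewrite (big_ord_widen_cond (t + S) xpredT (fun s => h s * x (t + i - s)%N)); last by lia.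
  rewrite mulr_sumr.
  rewrite -(big_mkord (fun s => (s < (t + i).+1)%N) (fun s => d`_i * (h s * x (t + i - s)%N))).
  rewrite -(big_mkord (fun tau => (tau <= t + i)%N) (fun tau => d`_i * h (t + i - tau)%N * x tau)).
  rewrite (big_cat_nat (n := (t + i).+1))//=; last by lia.
  rewrite [X in _ + X]big_nat_cond [X in _ + X]big_pred0 ?addr0; last first.
    by move=> k; apply/negbTE; lia.
  rewrite [RHS](big_cat_nat (n := (t + i).+1))//=; last by lia.
  rewrite [X in _ = _ + X]big_nat_cond [X in _ = _ + X]big_pred0 ?addr0; last first.
    by move=> k; apply/negbTE; lia.
  rewrite big_mkcond [RHS]big_mkcond/= [RHS]big_nat_rev/= add0n.
  rewrite big_nat_cond [RHS]big_nat_cond; apply: eq_bigr => k; rewrite andbT => /andP[_ kt].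
  rewrite subSS kt (_ : (t + i - k <= t + i)%N); last by lia.
  by rewrite subKn// mulrA.
rewrite big_split_ord/= [X in X + _]big1 ?add0r => [|tau _]; last first.
  rewrite -mulr_suml [X in X * _](_ : _ = 0) ?mul0r//.
  have tt := ltn_ord tau.
  rewrite -[RHS](markov_coef_tail (t - tau).-1 d0 fE nd); apply: eq_big => [i|i _]; first by lia.
  by congr (_ * h _); rewrite prednK ?subn_gt0// addnBAC// ltnW.
apply: eq_bigr => j _; rewrite -mulr_suml; congr (_ * _).
rewrite (markov_coef_head j d0 fE nd); apply: eq_big => [i|i _]; first exact: leq_add2l.
by rewrite subnDl.
Qed.

Lemma shift_op_filt p m (F : 'M[K]_(p, m)) (d : {poly R}) (N : 'M[{poly R}]_(p, m))
    (x : nat -> 'cV[R]_m) i t :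
  proper_entries F -> d != 0 -> (forall i j, F i j = (N i j)%:F / d%:F) ->
  shift_op d (fun t => filt F x t i 0) t = \sum_j shift_op (N i j) (fun t => x t j 0) t.
Proof.
move=> pF d0 FE.
have -> : (fun t => filt F x t i 0) = fun t =>
    \sum_j \sum_(s < t.+1) Defs.markov (F i j) s * x (t - s)%N j 0.
  apply/funext => {}t; rewrite summxE exchange_big/=; apply: eq_bigr => s _.
  by rewrite mxE; apply: eq_bigr => j _; rewrite mxE.
rewrite shift_op_sumr; apply: eq_bigr => j _; apply: (shift_op_markov (fun t => x t j 0) t d0 (FE i j)).
have [->|n0] := eqVneq (N i j) 0; first by rewrite size_poly0.
by rewrite -[size (N i j)]addn0; apply: vanish_infP; rewrite -?FE.
Qed.

Lemma shift_op_complex (p : {poly R}) (g : nat -> R) t :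
  shift_op (map_poly (real_complex R) p) (fun t => (g t)%:C) t = (shift_op p g t)%:C.
Proof.
rewrite (@shift_op_wide _ (size p)) ?size_map_poly// /shift_op rmorph_sum/=.
by apply: eq_bigr => i _; rewrite coef_map/= rmorphM.
Qed.

End shift_filters.

Section identifiability.
Local Open Scope complex_scope.
Variables (R : realType) (q m : nat) (mu : 'I_q -> R[i]).
Hypothesis mu_inj : injective mu.
Local Notation K := (ratfun R).
Local Notation "p %:F" := (@FracField.tofrac {poly R} p).
Local Notation toC := (map_poly (real_complex R)).
Variables (M : 'M[K]_m) (d : {poly R}) (N : 'M[{poly R}]_m).
Hypotheses (pM : proper_entries M) (d0 : d != 0) (ME : forall i j, M i j = (N i j)%:F / d%:F).
Hypothesis uM : M \in unitmx.

Definition other_poles (k : 'I_q) : {poly R[i]} := \prod_(l | l != k) ('X - (mu l)%:P).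

Lemma other_poles_neq0 k : (other_poles k).[mu k] != 0.
Proof.
rewrite /other_poles horner_prod; apply/prodf_neq0 => l lk.
by rewrite hornerXsubC subr_eq0 (inj_eq mu_inj) eq_sym.
Qed.

Lemma other_poles_root k l : l != k -> (other_poles k).[mu l] = 0.
Proof. by move=> lk; rewrite /other_poles horner_prod (bigD1 l)//= hornerXsubC subrr mul0r. Qed.

Lemma det_numerators_neq0 : \det N != 0.
Proof.
have ME' : M = (d%:F)^-1 *: map_mx (@FracField.tofrac {poly R}) N.
  by apply/matrixP => i j; rewrite !mxE ME mulrC.
move: uM; rewrite unitmxE unitfE ME' detZ det_map_mx mulf_eq0 negb_or tofrac_eq0.
by case/andP.
Qed.

(* The component [i] of the numerator, over the common denominator of the filters
   from the probing signal, of the filter mapping it to \sum_k c_k x^(k). *)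
Definition probe_basis k (j i : 'I_m) : {poly R[i]} :=
  other_poles k * toC (\adj N j i * d).
Definition probe_poly (c : 'I_q -> 'I_m -> R[i]) (i : 'I_m) : {poly R[i]} :=
  \sum_k \sum_j (c k j)%:P * probe_basis k j i.
(** Bounds the sizes of [probe_poly c] for all [c] at once, from the loop and the poles alone; it
    becomes the required order of excitation. *)
Definition probe_order : nat := \max_k \max_j \max_i size (probe_basis k j i).

Lemma size_probe_poly c i : (size (probe_poly c i) <= probe_order)%N.
Proof.
have sb k j : (size (probe_basis k j i) <= probe_order)%N.
  rewrite /probe_order; apply: leq_trans (leq_bigmax k).
  by apply: leq_trans (leq_bigmax j); exact: (leq_bigmax i).
apply: (leq_trans (size_sum _ _ _)); apply/bigmax_leqP => k _.
apply: (leq_trans (size_sum _ _ _)); apply/bigmax_leqP => j _.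
by rewrite mul_polyC; apply: leq_trans (sb k j); exact: size_scale_leq.
Qed.

(** Multiplying by [N] turns the adjugate into the nonzero factor [\det N] and isolates the
    Lagrange-type combination [Q j], whose value at [mu k] is a nonzero multiple of [c k j]. *)
Lemma probe_poly_eq0 c : (forall i, probe_poly c i = 0) -> forall k j, c k j = 0.
Proof.
move=> h k j.
pose Q j := \sum_k (c k j)%:P * other_poles k.
have pE i : probe_poly c i = \sum_j Q j * toC (\adj N j i * d).
  rewrite /probe_poly exchange_big/=; apply: eq_bigr => j' _.
  by rewrite mulr_suml; apply: eq_bigr => k' _; rewrite mulrA.
have Q0 : Q j * toC (\det N * d) = 0.
  transitivity (\sum_i probe_poly c i * toC (N i j)); last first.
    by rewrite big1// => i _; rewrite h mul0r.
  under eq_bigr do rewrite pE mulr_suml.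
  rewrite exchange_big/=.
  have adjN j' : \sum_i \adj N j' i * N i j = (j' == j)%:R * \det N.
    have := mul_adj_mx N => /matrixP/(_ j' j); rewrite !mxE => ->.
    by rewrite mulr_natl mulrb; case: (j' == j).
  transitivity (\sum_j' Q j' * toC ((j' == j)%:R * \det N * d)).
    rewrite (bigD1 j)//= eqxx mul1r big1 ?addr0// => j' /negPf ->.
    by rewrite !mul0r rmorph0 mulr0.
  apply: eq_bigr => j' _; rewrite -adjN mulr_suml rmorph_sum mulr_sumr/=.
  by apply: eq_bigr => i _; rewrite -[RHS]mulrA -rmorphM; congr (_ * toC _); ring.
move/eqP: Q0; rewrite mulf_eq0 map_poly_eq0 mulf_eq0 (negPf d0) (negPf det_numerators_neq0).
rewrite !orbF => /eqP/(congr1 (fun p : {poly R[i]} => p.[mu k])).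
rewrite horner0 /Q horner_sum (bigD1 k)//= big1 ?addr0 => [|l lk]; last first.
  by rewrite hornerM other_poles_root ?mulr0// eq_sym.
rewrite hornerM hornerC => /eqP; rewrite mulf_eq0 (negPf (other_poles_neq0 k)) orbF.
by move/eqP.
Qed.

Lemma shift_op_probe_poly (c : 'I_q -> 'I_m -> R[i]) (r u : nat -> 'cV[R]_m) :
  (forall t, filt M u t = r t) ->
  (forall t, \sum_k \sum_j c k j * filter_state (mu k) u t j 0 = 0) ->
  forall t, \sum_i shift_op (probe_poly c i) (fun t => (r t i 0)%:C) t = 0.
Proof.
move=> Mu v0.
pose uC j t := (u t j 0)%:C.
have st k j t : shift_op ('X - (mu k)%:P) (fun t => filter_state (mu k) u t j 0) t = uC j t.
  by rewrite shift_op_XsubC /= !mxE addrAC subrr add0r.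
(* The product of all ['X - mu l] cancels the filter of index [k] and leaves the other poles acting
   on the input itself. *)
have hu t : \sum_k \sum_j c k j * shift_op (other_poles k) (uC j) t = 0.
  pose pi := \prod_l ('X - (mu l)%:P).
  transitivity (shift_op pi (fun t => \sum_k \sum_j c k j * filter_state (mu k) u t j 0) t).
    rewrite shift_op_sumr; apply: eq_bigr => k _; rewrite shift_op_sumr.
    apply: eq_bigr => j _; rewrite shift_opZr; congr (_ * _).
    rewrite /pi (bigD1 k)//= mulrC shift_opM; congr shift_op.
    by apply/funext => s; rewrite st.
  by rewrite /shift_op big1// => i _; rewrite v0 mulr0.
(* Clearing the denominator in [M u = r] gives [d r = N u], and the adjugate of [N] solves this for
   [\det N] applied to [u]. *)
have hr j t : \sum_i shift_op (\adj N j i * d) (fun t => r t i 0) t =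
    shift_op (\det N) (fun t => u t j 0) t.
  transitivity (\sum_i \sum_l shift_op (\adj N j i * N i l) (fun t => u t l 0) t).
    apply: eq_bigr => i' _; rewrite shift_opM.
    have -> : shift_op d (fun t => r t i' 0) = fun t => \sum_l shift_op (N i' l) (fun t => u t l 0) t.
      apply/funext => s; rewrite -(shift_op_filt u i' s pM d0 ME).
      by congr shift_op; apply/funext => s'; rewrite Mu.
    by rewrite shift_op_sumr; apply: eq_bigr => l _; rewrite shift_opM.
  rewrite exchange_big/= (bigD1 j)//= [X in _ + X]big1 ?addr0.
    rewrite -shift_op_sum; congr shift_op.
    by have := mul_adj_mx N => /matrixP/(_ j j); rewrite !mxE eqxx mulr1n.
  move=> l lj; rewrite -shift_op_sum.
  have := mul_adj_mx N => /matrixP/(_ j l); rewrite !mxE eq_sym (negPf lj) mulr0n => ->.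
  exact: shift_op0.
move=> t; rewrite /probe_poly.
transitivity (\sum_k \sum_j c k j * shift_op (other_poles k)
    (shift_op (toC (\det N)) (uC j)) t).
  under eq_bigr do rewrite shift_op_sum; rewrite exchange_big/=; apply: eq_bigr => k _.
  under eq_bigr do rewrite shift_op_sum; rewrite exchange_big/=; apply: eq_bigr => j _.
  under eq_bigr do rewrite shift_opCM; rewrite -mulr_sumr; congr (_ * _).
  under eq_bigr do rewrite /probe_basis shift_opM.
  rewrite -shift_op_sumr; congr shift_op; apply/funext => s.
  under eq_bigr do rewrite shift_op_complex.
  rewrite -rmorph_sum hr; apply: esym; exact: shift_op_complex.
transitivity (shift_op (toC (\det N)) (fun t => \sum_k \sum_j c k j *
    shift_op (other_poles k) (uC j) t) t).
  rewrite shift_op_sumr; apply: eq_bigr => k _; rewrite shift_op_sumr; apply: eq_bigr => j _.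
  rewrite shift_opZr; congr (_ * _).
  transitivity (shift_op (other_poles k * toC (\det N)) (uC j) t); first by rewrite shift_opM.
  by rewrite mulrC shift_opM.
by rewrite /shift_op big1// => i _; rewrite hu mulr0.
Qed.

End identifiability.

(** * The H2 norm *)

Section excitation.
Local Open Scope complex_scope.
Context d (T : measurableType d) (R : realType) (P : probability T R).
Variables (I : finType) (W : nat -> I -> T -> R).
Hypothesis WN : white_noise P W.

Lemma integrable_sig_mul_lag al be t s :
  P.-integrable setT (EFin \o (fun x => sig W al t x * sig W be s x)).
Proof.
have -> : (fun x => sig W al t x * sig W be s x) = fun x =>
    \sum_(p : ('I_t.+1 * I) * ('I_s.+1 * I)) al p.1.1 p.1.2 * be p.2.1 p.2.2 *
    (W (t - p.1.1)%N p.1.2 x * W (s - p.2.1)%N p.2.2 x).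
  apply/funext => x; rewrite !sigE big_distrlr/= pair_bigA.
  by apply: eq_bigr => p _; rewrite mulrACA.
apply: integrable_bigsum => p; apply: integrable_scale.
by apply: integrable_mul2; exact: (wn_L4 WN).
Qed.

(** The block covariance form, evaluated at the coefficients of [g], is the limit of the mean square
    of the annihilated signal, hence 0; positive definiteness then forces the coefficients to
    vanish. *)
Lemma persistently_exciting_annihilator m n (r : nat -> T -> 'cV[R]_m)
    (rc : 'I_m -> nat -> I -> R) (g : 'I_m -> {poly R}) :
  (forall t x i, r t x i 0 = sig W (rc i) t x) ->
  persistently_exciting P n r -> (forall i, (size (g i) <= n)%N) ->
  (forall x t, \sum_i shift_op (g i) (fun t => r t x i 0) t = 0) ->
  forall i, g i = 0.
Proof.
move=> rE [Rw [cv pos]] sg g0.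
pose c (l : 'I_n) : 'cV[R]_m := \col_i (g i)`_l.
have [[l cl]|c0] := pselect (exists l, c l != 0); last first.
  move=> i; apply/polyP => k; rewrite coef0.
  have [kn|nk] := ltnP k n; last by rewrite nth_default//; exact: leq_trans (sg i) nk.
  have [/eqP cE|cE] := boolP (c (Ordinal kn) == 0).
    by move/colP/(_ i): cE; rewrite !mxE.
  by case: c0; exists (Ordinal kn).
have := pos c (ex_intro _ l cl).
have ir a b t s : P.-integrable setT (EFin \o (fun x => r t x a 0 * r s x b 0)).
  under [X in _.-integrable _ (_ \o X)]eq_fun do rewrite !rE.
  exact: integrable_sig_mul_lag.
pose Er (i j : 'I_n) a b t := \int[P]_x (r (t + i)%N x a 0 * r (t + j)%N x b 0).
have cvR i j a b : Er i j a b @ \oo --> Rw i j a b.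
  have := cv i j a b; rewrite (_ : (fun t => _) = EFin \o Er i j a b).
    by move/fine_cvg.
  by apply/funext => t; rewrite unlock /= EFin_Rintegral.
pose V t := \sum_i \sum_j \sum_a \sum_b c i a 0 * c j b 0 * Er i j a b t.
have V0 t : V t = 0.
  have s0 x : \sum_i \sum_a c i a 0 * r (t + i)%N x a 0 = 0.
    rewrite exchange_big/= -[RHS](g0 x t); apply: eq_bigr => a _.
    rewrite (shift_op_wide _ _ (sg a)); apply: eq_bigr => i _; by rewrite mxE.
  have -> : V t = \int[P]_x (\sum_i \sum_j \sum_a \sum_b
      c i a 0 * c j b 0 * (r (t + i)%N x a 0 * r (t + j)%N x b 0)).
    have i1 i j a b : P.-integrable setT (EFin \o (fun x =>
      c i a 0 * c j b 0 * (r (t + i)%N x a 0 * r (t + j)%N x b 0))).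
      exact: integrable_scale.
    rewrite Rintegral_sum; last by move=> i; do 3! apply: integrable_bigsum => ?.
    apply: eq_bigr => i _; rewrite Rintegral_sum; last by move=> j; do 2! apply: integrable_bigsum => ?.
    apply: eq_bigr => j _; rewrite Rintegral_sum; last by move=> a; apply: integrable_bigsum => ?.
    apply: eq_bigr => a _; rewrite Rintegral_sum//.
    by apply: eq_bigr => b _; rewrite RintegralZl.
  rewrite -[RHS](_ : \int[P]_x (0 : R) = 0); last by rewrite Rintegral_cst// mul0r.
  apply: eq_Rintegral => x _.
  transitivity ((\sum_i \sum_a c i a 0 * r (t + i)%N x a 0) ^+ 2); last by rewrite s0 expr0n.
  rewrite expr2 big_distrlr/=; apply: eq_bigr => i _; apply: eq_bigr => j _.
  by rewrite big_distrlr/=; apply: eq_bigr => a _; apply: eq_bigr => b _; ring.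
have cvV : V @ \oo --> \sum_i \sum_j \sum_a \sum_b c i a 0 * c j b 0 * Rw i j a b.
  by do 4! apply: cvg_finsum => ?; apply: cvg_scale.
have cv0 : V @ \oo --> (0 : R) by rewrite (_ : V = fun=> 0); [exact: cvg_cst|exact/funext].
have := cvg_unique (@Rhausdorff R) cvV cv0 => e.
rewrite summxE (_ : \sum_i _ = 0) ?ltxx// -[RHS]e; apply: eq_bigr => i _.
rewrite summxE; apply: eq_bigr => j _; rewrite mxE exchange_big/=.
apply: eq_bigr => b _; rewrite mxE mulr_suml; apply: eq_bigr => a _.
by rewrite !mxE mulrAC.
Qed.

End excitation.

(** * The H2 norm bounded by the supremum on the unit circle *)

Section H2_bound.
Local Open Scope complex_scope.
Variable R : realType.
Local Notation normc := (@ComplexField.Normc.normc R).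

(** Read off the integral of a nonnegative function as a supremum over simple functions below it, so
    that it covers arbitrary nonnegative integrands. *)
Lemma ge0_le_integral_majorant d (T : measurableType d) (mu : {measure set T -> \bar R})
    (D : set T) (f g : T -> \bar R) :
  (forall x, D x -> 0 <= f x)%E -> (forall x, D x -> f x <= g x)%E ->
  (\int[mu]_(x in D) f x <= \int[mu]_(x in D) g x)%E.
Proof.
move=> f0 fg; rewrite !ge0_integralE//; last first.
  by move=> x Dx; exact: le_trans (f0 x Dx) (fg x Dx).
apply: ereal_sup_le => _ [h hf <-]; exists h => // x.
by apply: (le_trans (hf x)); exact: lee_restrict.
Qed.

Lemma H2norm_ge0 p m (F : R[i] -> 'M[R[i]]_(p, m)) : 0 <= H2norm F.
Proof. exact: sqrtr_ge0. Qed.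

Lemma normc_expi (w : R) : normc (expi w) = 1.
Proof. by rewrite /expi /= cos2Dsin2 sqrtr1. Qed.

Lemma normc_sqr (z : R[i]) : normc z ^+ 2 = complex.Re z ^+ 2 + complex.Im z ^+ 2.
Proof. by case: z => a b /=; rewrite sqr_sqrtr// addr_ge0 ?sqr_ge0. Qed.

Lemma Re_mul_conjc (z : R[i]) : complex.Re (z * conjc z) = normc z ^+ 2.
Proof. by rewrite normc_sqr; case: z => a b /=; rewrite !expr2 mulrN opprK. Qed.

Lemma Re_sum (J : Type) (s : seq J) (F : J -> R[i]) :
  complex.Re (\sum_(j <- s) F j) = \sum_(j <- s) complex.Re (F j).
Proof. by elim: s => [|j s IH]; rewrite ?big_nil// !big_cons -IH; case: (F j); case: (\sum_(i <- s) F i). Qed.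

Lemma Im_sum (J : Type) (s : seq J) (F : J -> R[i]) :
  complex.Im (\sum_(j <- s) F j) = \sum_(j <- s) complex.Im (F j).
Proof. by elim: s => [|j s IH]; rewrite ?big_nil// !big_cons -IH; case: (F j); case: (\sum_(i <- s) F i). Qed.

Lemma normc_sum (J : Type) (s : seq J) (F : J -> R[i]) :
  normc (\sum_(j <- s) F j) <= \sum_(j <- s) normc (F j).
Proof.
elim: s => [|j s IH]; first by rewrite !big_nil ComplexField.Normc.normc0.
by rewrite !big_cons; apply: (le_trans (normcD _ _)); rewrite lerD2l.
Qed.

Lemma normc_le_ReIm (z : R[i]) : normc z <= `|complex.Re z| + `|complex.Im z|.
Proof.
rewrite -(@ler_pXn2r _ 2) ?nnegrE ?normc_ge0 ?addr_ge0// normc_sqr sqrrD.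
by rewrite !real_normK ?num_real// addrAC lerDl mulrn_wge0// mulr_ge0.
Qed.

(** The integrand is the squared Frobenius norm, at most [p m B^2], and the normalized measure of
    the circle is 1. *)
Lemma H2norm_le p m (F : R[i] -> 'M[R[i]]_(p, m)) (B : R) : 0 <= B ->
  (forall w i j, normc (F (expi w) i j) <= B) ->
  H2norm F <= Num.sqrt (p%:R * m%:R) * B.
Proof.
move=> B0 hB; rewrite /H2norm -(ger0_norm B0) -sqrtr_sqr -sqrtrM; last first.
  by rewrite mulr_ge0.
apply: ler_wsqrtr.
have pi0 : 0 < 2 * pi :> R by rewrite mulr_gt0// pi_gt0.
rewrite ler_pdivrMl//.
pose f (w : R) := complex.Re (\tr (F (expi w) *m (map_mx (@conjc R) (F (expi w)))^T)).
have fE w : f w = \sum_i \sum_j normc (F (expi w) i j) ^+ 2.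
  rewrite /f /mxtrace Re_sum; apply: eq_bigr => i _; rewrite mxE Re_sum.
  by apply: eq_bigr => j _; rewrite !mxE Re_mul_conjc.
have f0 w : 0 <= f w.
  by rewrite fE; apply: sumr_ge0 => i _; apply: sumr_ge0 => j _; rewrite sqr_ge0.
have fB w : f w <= p%:R * m%:R * B ^+ 2.
  rewrite fE; apply: (@le_trans _ _ (\sum_(i < p) \sum_(j < m) B ^+ 2)).
    apply: ler_sum => i _; apply: ler_sum => j _.
    by apply: lerXn2r; rewrite ?nnegrE ?normc_ge0.
  by rewrite !sumr_const !card_ord -mulrnA -[leLHS]mulr_natl natrM (mulrC p%:R).
set C := p%:R * m%:R * B ^+ 2 in fB *.
have C0 : 0 <= C by apply: le_trans (fB 0).
pose D : set R := `[- pi, pi]%classic.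
have le : (\int[lebesgue_measure]_(w in D) (f w)%:E <= (2 * pi * C)%:E)%E.
  apply: (@le_trans _ _ (\int[lebesgue_measure]_(w in D) C%:E)%E).
    by apply: ge0_le_integral_majorant => w _; rewrite lee_fin.
  have mD : lebesgue_measure D = (2 * pi)%:E.
    rewrite /D lebesgue_measure_itv/= lte_fin gtrN ?pi_gt0// -EFinB opprK.
    by congr EFin; ring.
  rewrite integral_cst; last exact: measurable_itv.
  by rewrite [X in (_ * X)%E](_ : _ = (2 * pi)%:E)// -EFinM mulrC.
rewrite /Rintegral -[leRHS]/(fine (2 * pi * C)%:E); apply: fine_le => //.
rewrite ge0_fin_numE; first exact: le_lt_trans le (ltry _).
by apply: integral_ge0 => w _; rewrite lee_fin; exact: f0.
Qed.

End H2_bound.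

(** * Complex residues in real coordinates *)

Section regressors.
Local Open Scope complex_scope.
Context d (T : measurableType d) (R : realType).
Local Notation K := (ratfun R).
Local Notation normc := (@ComplexField.Normc.normc R).

Section sig_algebra.
Variables (I : finType) (W : nat -> I -> T -> R).

Lemma sigZ (a : R) al t x : sig W (fun s c => a * al s c) t x = a * sig W al t x.
Proof.
rewrite /sig mulr_sumr; apply: eq_bigr => s _; rewrite mulr_sumr.
by apply: eq_bigr => c _; rewrite mulrA.
Qed.

Lemma sig_sum (J : finType) (al : J -> nat -> I -> R) t x :
  sig W (fun s c => \sum_j al j s c) t x = \sum_j sig W (al j) t x.
Proof.
rewrite /sig [RHS]exchange_big/=; apply: eq_bigr => s _; rewrite [RHS]exchange_big/=.
by apply: eq_bigr => c _; rewrite mulr_suml.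
Qed.

Lemma sig_conv (h : nat -> R) al t x :
  \sum_(s < t.+1) h s * sig W al (t - s)%N x =
  sig W (fun k c => \sum_(s < k.+1) h s * al (k - s)%N c) t x.
Proof.
under eq_bigr do rewrite /sig mulr_sumr.
rewrite (sum_lag (fun s r => h s * \sum_c al r c * W (t - s - r)%N c x)).
rewrite /sig; apply: eq_bigr => k _.
under [RHS]eq_bigr do rewrite mulr_suml; rewrite [RHS]exchange_big/=.
apply: eq_bigr => s _; rewrite mulr_sumr; apply: eq_bigr => c _.
by rewrite mulrA; congr (_ * W _ _ _); rewrite -subnDA subnKC// -ltnS.
Qed.

End sig_algebra.

(* Impulse response of 1 / (z - mu). *)
Definition pole_response (mu : R[i]) (s : nat) : R[i] :=
  if s is r.+1 then mu ^+ r else 0.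

Lemma filter_stateE m (mu : R[i]) (u : nat -> 'cV[R]_m) t j :
  filter_state mu u t j 0 =
  \sum_(s < t.+1) pole_response mu s * (u (t - s)%N j 0)%:C.
Proof.
elim: t => [|t IH]; first by rewrite big_ord_recl big_ord0 mul0r addr0 /= mxE.
rewrite [LHS]/= !mxE IH big_ord_recl mul0r add0r [in RHS]big_ord_recl mul0r add0r.
rewrite [in RHS]big_ord_recl/= expr0 mul1r addrC /bump/= subSS subn0; congr (_ + _).
rewrite mulr_sumr; apply: eq_bigr => s _; rewrite !add1n subSS.
by rewrite mulrA -exprS.
Qed.

Lemma expdecay_pole_response (mu : R[i]) (part : R[i] -> R) : normc mu < 1 ->
  (forall z, `|part z| <= normc z) -> expdecay (fun s => part (pole_response mu s)).
Proof.
move=> mu1 hp; apply: expdecay_unshift => /=.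
have n0 := normc_ge0 mu.
have dg : expdecay (fun k => normc mu ^+ k) by apply: expdecay_geo; rewrite ger0_norm.
apply: expdecay_le dg => k; apply: (le_trans (hp _)); rewrite ger0_norm ?exprn_ge0//.
elim: k => [|k IH]; first by rewrite !expr0 ComplexField.Normc.normc1.
by rewrite !exprS ComplexField.Normc.normcM; apply: ler_wpM2l.
Qed.

Lemma normr_Re_le (z : R[i]) : `|complex.Re z| <= normc z.
Proof. by rewrite -sqrtr_sqr; case: z => a b; apply: ler_wsqrtr; rewrite lerDl sqr_ge0. Qed.

Lemma normr_Im_le (z : R[i]) : `|complex.Im z| <= normc z.
Proof. by rewrite -sqrtr_sqr; case: z => a b; apply: ler_wsqrtr; rewrite lerDr sqr_ge0. Qed.

Variables (p m q : nat) (mu : 'I_q -> R[i]) (I : finType).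

(* Real coordinates of the residues: real parts at [false], imaginary parts at [true]. *)
Definition residue_index : finType := ('I_q * 'I_p * 'I_m * bool)%type.

Definition residue_coord (Rk : 'I_q -> 'M[R[i]]_(p, m)) (w : residue_index) : R :=
  let z := Rk w.1.1.1 w.1.1.2 w.1.2 in if w.2 then complex.Im z else complex.Re z.

Definition residue_of_coord (th : residue_index -> R) (k : 'I_q) : 'M[R[i]]_(p, m) :=
  \matrix_(i, j) Complex (th (k, i, j, false)) (th (k, i, j, true)).

Lemma residue_of_coordK th : residue_coord (residue_of_coord th) = th.
Proof.
by apply/funext => -[[[k i] j] b]; rewrite /residue_coord /= mxE; case: b.
Qed.

Lemma sum_pair (A B : finType) (F : A * B -> R) : \sum_x F x = \sum_a \sum_b F (a, b).
Proof. by rewrite pair_bigA; apply: eq_bigr => -[]. Qed.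

Lemma sum_coord (F : residue_index -> R) :
  \sum_w F w = \sum_k \sum_i \sum_j (F (k, i, j, false) + F (k, i, j, true)).
Proof.
rewrite sum_pair sum_pair sum_pair; do 3! (apply: eq_bigr => ? _).
by rewrite big_bool addrC.
Qed.

Variable uc : 'I_m -> nat -> I -> R.

Definition state_coef (part : R[i] -> R) k j s c : R :=
  \sum_(r < s.+1) part (pole_response (mu k) r) * uc j (s - r)%N c.

(** Real form of complex multiplication, with [l.2] and [w.2] marking imaginary parts of the output
    and of the residue: equal marks read the real part of the state, different marks its imaginary
    part, and the minus sign is that of [- Im * Im] or [- Im z Im x] in the real part of a
    product. *)
Definition regressor_coef (l : 'I_p * bool) (w : residue_index) s c : R :=
  ((l.1 == w.1.1.2)%:R * (if ~~ l.2 && w.2 then -1 else 1)) *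
  state_coef (if l.2 == w.2 then @complex.Re R else @complex.Im R) w.1.1.1 w.1.2 s c.

Lemma expdecay_regressor_coef l w c : (forall k, normc (mu k) < 1) ->
  (forall j c, expdecay ((uc j)^~ c)) -> expdecay ((regressor_coef l w)^~ c).
Proof.
move=> mu1 du; apply: expdecayZ; rewrite /state_coef; set part := if _ then _ else _.
apply: (expdecay_conv (h := fun r => part (pole_response (mu w.1.1.1) r)) _ (du w.1.2 c)).
apply: expdecay_pole_response => // z; rewrite /part.
by case: ifP => _; [exact: normr_Re_le|exact: normr_Im_le].
Qed.

Section signal.
Variables (W : nat -> I -> T -> R) (u : nat -> 'cV[R]_m) (x : T).
Hypothesis uE : forall t j, u t j 0 = sig W (uc j) t x.

Lemma Re_filter_state k t j :
  complex.Re (filter_state (mu k) u t j 0) = sig W (state_coef (@complex.Re R) k j) t x.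
Proof.
rewrite filter_stateE Re_sum.
rewrite -(sig_conv W (fun r => complex.Re (pole_response (mu k) r)) (uc j)); apply: eq_bigr => s _; rewrite uE.
by case: (pole_response _ _) => a b /=; rewrite mulr0 subr0.
Qed.

Lemma Im_filter_state k t j :
  complex.Im (filter_state (mu k) u t j 0) = sig W (state_coef (@complex.Im R) k j) t x.
Proof.
rewrite filter_stateE Im_sum.
rewrite -(sig_conv W (fun r => complex.Im (pole_response (mu k) r)) (uc j)); apply: eq_bigr => s _; rewrite uE.
by case: (pole_response _ _) => a b /=; rewrite mulr0 add0r mulrC.
Qed.

Let prediction (Rk : 'I_q -> 'M[R[i]]_(p, m)) t i := (\sum_k Rk k *m filter_state (mu k) u t) i 0.

Let predictionE Rk t i : prediction Rk t i =
  \sum_k \sum_j Rk k i j * filter_state (mu k) u t j 0.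
Proof. by rewrite /prediction summxE; apply: eq_bigr => k _; rewrite mxE. Qed.

Let coord_delta i (F : 'I_q -> 'I_p -> 'I_m -> R) :
  \sum_k \sum_i' \sum_j (i == i')%:R * F k i' j = \sum_k \sum_j F k i j.
Proof.
apply: eq_bigr => k _; rewrite (bigD1 i)//= [X in _ + X]big1 ?addr0 => [|i' /negPf ii].
  by apply: eq_bigr => j _; rewrite eqxx mul1r.
by rewrite big1// => j _; rewrite eq_sym ii mul0r.
Qed.

Let coord_term (Rk : 'I_q -> 'M[R[i]]_(p, m)) (l : 'I_p * bool) t k i' j :
  \sum_b residue_coord Rk (k, i', j, b) * sig W (regressor_coef l (k, i', j, b)) t x =
  (l.1 == i')%:R * (if l.2 then complex.Im (Rk k i' j * filter_state (mu k) u t j 0)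
                    else complex.Re (Rk k i' j * filter_state (mu k) u t j 0)).
Proof.
rewrite big_bool /regressor_coef /residue_coord/= !sigZ.
case: l => i0 [] /=; rewrite -Re_filter_state -Im_filter_state;
case: (Rk k i' j) => a b; case: (filter_state _ _ _ _ _) => a' b' /=; ring.
Qed.

Lemma prediction_coord (Rk : 'I_q -> 'M[R[i]]_(p, m)) (l : 'I_p * bool) t :
  (if l.2 then complex.Im ((\sum_k Rk k *m filter_state (mu k) u t) l.1 0)
   else complex.Re ((\sum_k Rk k *m filter_state (mu k) u t) l.1 0)) =
  \sum_w residue_coord Rk w * sig W (regressor_coef l w) t x.
Proof.
rewrite -/(prediction Rk t l.1) predictionE.
transitivity (\sum_k \sum_j (if l.2 then complex.Im (Rk k l.1 j * filter_state (mu k) u t j 0)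
                    else complex.Re (Rk k l.1 j * filter_state (mu k) u t j 0))).
  by case: l.2; rewrite ?Re_sum ?Im_sum; apply: eq_bigr => k _; rewrite ?Re_sum ?Im_sum.
rewrite -(coord_delta l.1 (fun k i' j =>
  if l.2 then complex.Im (Rk k i' j * filter_state (mu k) u t j 0)
  else complex.Re (Rk k i' j * filter_state (mu k) u t j 0))) sum_coord; do 3! (apply: eq_bigr => ? _).
by rewrite -coord_term big_bool addrC.
Qed.

End signal.
End regressors.

Section complex_least_squares.
Local Open Scope complex_scope.
Context d (T : measurableType d) (R : realType).
Variables (p m q : nat) (mu : 'I_q -> R[i]) (I : finType).
Variables (yc : 'I_p -> nat -> I -> R) (uc : 'I_m -> nat -> I -> R).

(** The measured output is real, but a complex model also has an imaginary prediction error,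
    compared here with a zero output. *)
Definition output_coef (l : 'I_p * bool) s c : R := (~~ l.2)%:R * yc l.1 s c.

Lemma sqerror_residual_sqr (W : nat -> I -> T -> R) (y : nat -> 'cV[R]_p)
    (u : nat -> 'cV[R]_m) x Rk t :
  (forall t i, y t i 0 = sig W (yc i) t x) -> (forall t j, u t j 0 = sig W (uc j) t x) ->
  sqerror mu y u Rk t =
  residual_sqr W output_coef (regressor_coef mu uc) (residue_coord Rk) t x.
Proof.
move=> yE uE; rewrite /sqerror /sqnormc /residual_sqr sum_pair; apply: eq_bigr => i _.
set S := \sum_k _; have -> : (cplx (y t) - S) i 0 = (y t i 0)%:C - S i 0 by rewrite !mxE.
rewrite normc_sqr big_bool addrC -!(prediction_coord mu uE) /output_coef !sigZ -yE/= -/S.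
by case: (S i 0) => a b /=; rewrite mul1r mul0r add0r.
Qed.

(** Holds for an arbitrary driving sequence [W], so it may be used with the probing noise alone. *)
Lemma regressor_combination0 (W : nat -> I -> T -> R) (u : nat -> 'cV[R]_m) x
    (th : residue_index p m q -> R) i t :
  (forall t j, u t j 0 = sig W (uc j) t x) ->
  (forall l s c, \sum_w th w * regressor_coef mu uc l w s c = 0) ->
  \sum_k \sum_j Complex (th (k, i, j, false)) (th (k, i, j, true)) *
     filter_state (mu k) u t j 0 = 0.
Proof.
move=> uE th0.
pose z := (\sum_k residue_of_coord th k *m filter_state (mu k) u t) i 0.
have zl l : \sum_w th w * sig W (regressor_coef mu uc l w) t x = 0.
  under eq_bigr do rewrite -sigZ; rewrite -sig_sum.
  rewrite /sig big1// => s _; rewrite big1// => c _.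
  by rewrite th0 mul0r.
have Rez : complex.Re z = 0.
  have := prediction_coord mu uE (residue_of_coord th) (i, false) t.
  by rewrite residue_of_coordK zl.
have Imz : complex.Im z = 0.
  have := prediction_coord mu uE (residue_of_coord th) (i, true) t.
  by rewrite residue_of_coordK zl.
transitivity z; last by case: z Rez Imz => a b /= -> ->.
rewrite /z summxE; apply: eq_bigr => k _; rewrite mxE; apply: eq_bigr => j _.
by rewrite mxE.
Qed.

Lemma asymptotic_cost_quad (P : probability T R) (W : nat -> I -> T -> R)
    (y : nat -> T -> 'cV[R]_p) (u : nat -> T -> 'cV[R]_m) Rk :
  white_noise P W -> (forall k, ComplexField.Normc.normc (mu k) < 1) ->
  (forall i c, expdecay ((yc i)^~ c)) -> (forall j c, expdecay ((uc j)^~ c)) ->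
  (forall t x i, y t x i 0 = sig W (yc i) t x) ->
  (forall t x j, u t x j 0 = sig W (uc j) t x) ->
  asymptotic_cost P mu y u Rk = (quad (gramPhi (regressor_coef mu uc))
    (gramf output_coef (regressor_coef mu uc)) (gramc output_coef) (residue_coord Rk))%:E.
Proof.
move=> WN mu1 dy du yE uE; rewrite /asymptotic_cost /asymptotic_mean.
apply: cvg_lim => //.
have dY l c : expdecay ((output_coef l)^~ c) by exact: expdecayZ.
have dR (l : 'I_p * bool) w c : expdecay ((regressor_coef mu uc l w)^~ c) by exact: expdecay_regressor_coef.
have := mean_residual_sqr_cvg WN dY dR (th := residue_coord Rk).
rewrite (_ : (fun t => _) = EFin \o (fun t =>
  \int[P]_x residual_sqr W output_coef (regressor_coef mu uc) (residue_coord Rk) t x)).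
  by move=> h; apply: cvg_comp h _; exact: cvg_id.
apply/funext => t; rewrite unlock /=.
rewrite -EFin_Rintegral; last by case: (integrable_residual_sqr WN output_coef (regressor_coef mu uc) (residue_coord Rk) t).
by apply: eq_integral => x _; rewrite (sqerror_residual_sqr (W := W) (x := x)).
Qed.

Lemma H2norm_pole_model_le (mu1 : forall k, ComplexField.Normc.normc (mu k) < 1) :
  exists2 C : R, 0 <= C & forall Rk Sk : 'I_q -> 'M[R[i]]_(p, m),
    H2norm (fun z => pole_model mu Rk z - pole_model mu Sk z) <=
    C * \sum_w `|residue_coord Rk w - residue_coord Sk w|.
Proof.
(* On the unit circle [|z - mu k|] is at least [1 - |mu k|]. *)
pose ka := \sum_k (1 - ComplexField.Normc.normc (mu k))^-1.
have ka0 : 0 <= ka by apply: sumr_ge0 => k _; rewrite invr_ge0 subr_ge0 ltW.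
exists (Num.sqrt (p%:R * m%:R) * ka); first by rewrite mulr_ge0 ?sqrtr_ge0.
move=> Rk Sk; set D := \sum_w _.
have D0 : 0 <= D by exact: sumr_ge0.
rewrite -mulrA; apply: H2norm_le; first exact: mulr_ge0.
move=> w i j.
have -> : (pole_model mu Rk (expi w) - pole_model mu Sk (expi w)) i j =
    \sum_k (expi w - mu k)^-1 * (Rk k i j - Sk k i j).
  rewrite /pole_model -sumrB summxE; apply: eq_bigr => k _.
  by rewrite !mxE mulrBr.
apply: (le_trans (normc_sum _ _)); rewrite /ka mulr_suml; apply: ler_sum => k _.
rewrite ComplexField.Normc.normcM ComplexField.Normc.normcV.
have pk : 0 < 1 - ComplexField.Normc.normc (mu k) by rewrite subr_gt0.
apply: ler_pM; rewrite ?invr_ge0 ?normc_ge0//.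
  rewrite lef_pV2 ?posrE//.
    rewrite lerBlDr -(normc_expi w) -{1}(subrK (mu k) (expi w)); exact: normcD.
  apply: (lt_le_trans pk).
  by rewrite lerBlDr -(normc_expi w) -{1}(subrK (mu k) (expi w)); exact: normcD.
apply: (le_trans (normc_le_ReIm _)).
have nn k' i' j' : 0 <= `|residue_coord Rk (k', i', j', false) - residue_coord Sk (k', i', j', false)|
    + `|residue_coord Rk (k', i', j', true) - residue_coord Sk (k', i', j', true)|.
  exact: addr_ge0.
rewrite /D sum_coord (bigD1 k)//= (bigD1 i)//= (bigD1 j)//=.
rewrite -!addrA [leRHS]addrA.
have -> : `|complex.Re (Rk k i j - Sk k i j)| + `|complex.Im (Rk k i j - Sk k i j)| =
    `|residue_coord Rk (k, i, j, false) - residue_coord Sk (k, i, j, false)|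
    + `|residue_coord Rk (k, i, j, true) - residue_coord Sk (k, i, j, true)|.
  by rewrite /residue_coord /=; case: (Rk k i j) => a b; case: (Sk k i j).
rewrite lerDl !addr_ge0// sumr_ge0// => k' _; rewrite ?nn// sumr_ge0// => i' _; rewrite ?nn//.
by rewrite sumr_ge0.
Qed.

End complex_least_squares.

(** * Closed-loop signals as filters of the joint noise *)

Section loop_signals.
Context d (T : measurableType d) (R : realType) (P : probability T R).
Local Notation K := (ratfun R).
Variables (ne neps : nat) (e : nat -> {RV P >-> ne.-tuple R})
  (eps : nat -> {RV P >-> neps.-tuple R}).

Definition loop_coef m (A : 'M[K]_(m, ne)) (B : 'M[K]_(m, neps)) (i : 'I_m) (s : nat)
    (c : 'I_ne + 'I_neps) : R :=
  match c with inl a => Defs.markov (A i a) s | inr b => Defs.markov (B i b) s end.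

Lemma filt_noise m (A : 'M[K]_(m, ne)) (B : 'M[K]_(m, neps)) t x i :
  (filt A (vec e ^~ x) t + filt B (vec eps ^~ x) t) i 0 =
  sig (noise e eps) (loop_coef A B i) t x.
Proof.
rewrite /filt mxE !summxE /sig -big_split/=; apply: eq_bigr => s _.
by rewrite big_sumType/= !mxE; congr (_ + _); apply: eq_bigr => a _; rewrite !mxE.
Qed.

(** The coefficients are those of the full response, including [A]; only the driving noise has its
    [e] part set to 0. *)
Lemma filt_probe m (A : 'M[K]_(m, ne)) (B : 'M[K]_(m, neps)) t x i :
  filt B (vec eps ^~ x) t i 0 =
  sig (fun t c x => if c is inr b then vec eps t x b 0 else 0) (loop_coef A B i) t x.
Proof.
rewrite /filt !summxE /sig; apply: eq_bigr => s _.
rewrite big_sumType/= [X in _ = X + _]big1 ?add0r => [|a _]; last by rewrite mulr0.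
by rewrite !mxE; apply: eq_bigr => a _; rewrite !mxE.
Qed.

Lemma filt0 m n (x : nat -> 'cV[R]_n) t : filt (0 : 'M[K]_(m, n)) x t = 0.
Proof.
rewrite /filt big1// => s _; rewrite (_ : markov_mx _ _ = 0) ?mul0mx//.
by apply/matrixP => i j; rewrite !mxE (markov_expansion (@expansion0 R)).
Qed.

Lemma expdecay_loop_coef m (A : 'M[K]_(m, ne)) (B : 'M[K]_(m, neps)) i c :
  strictly_stable A -> strictly_stable B -> expdecay ((loop_coef A B i)^~ c).
Proof.
move=> [pA sA] [pB sB]; case: c => a /=.
- apply: expdecay_markov; first exact: proper_mx_entries pA i a.
  by move=> z; exact: sA.
- apply: expdecay_markov; first exact: proper_mx_entries pB i a.
  by move=> z; exact: sB.
Qed.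

End loop_signals.

Section real_parts.
Variable R : realType.

(** Persistent excitation concerns real coefficients, whereas the annihilating polynomial is
    complex; applied to a real signal, its real and imaginary parts annihilate separately. *)
Lemma shift_op_part (part : R[i] -> R) (p : {poly R[i]}) (g : nat -> R) t :
  {morph part : x y / x + y} -> (forall z r, part (z * r%:C%C) = part z * r) ->
  part (shift_op p (fun t => (g t)%:C%C) t) = shift_op (map_poly part p) g t.
Proof.
move=> pD pZ; have p0 : part 0 = 0 by rewrite -[0 in LHS](mul0r (0%:C)%C) pZ mulr0.
rewrite [RHS](@shift_op_wide _ (size p)) ?size_poly// /shift_op (big_morph part pD p0).
by apply: eq_bigr => i _; rewrite pZ coef_map_id0.
Qed.

Lemma poly_ReIm_eq0 (p : {poly R[i]}) :
  map_poly (@complex.Re R) p = 0 -> map_poly (@complex.Im R) p = 0 -> p = 0.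
Proof.
move=> /polyP re /polyP im; apply/polyP => i; have := re i; have := im i.
by rewrite !coef_map_id0// !coef0; case: (p`_i) => a b /= -> ->.
Qed.

End real_parts.

Theorem theorem5 (R : realType) (p m ne q : nat)
    (G : 'M[ratfun R]_(p, m)) (H : 'M[ratfun R]_(p, ne))
    (Gu : 'M[ratfun R]_(m, p)) (mu : 'I_q -> R[i])
    (G_stable : strictly_stable G) (H_stable : strictly_stable H)
    (G_reldeg : forall i j, reldeg_ge 1 (G i j))
    (Gu_proper : proper_mx Gu)
    (mu_inj : injective mu)
    (mu_disc : forall k, ComplexField.Normc.normc (mu k) < 1) :
  (* [n0] is the "sufficiently high order" of excitation: it may depend on the
     plant, the feedback and the poles, but not on the probing signal. *)
  exists n0 : nat,
  forall (neps : nat) (Hu : 'M[ratfun R]_(m, neps))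
    (d : measure_display) (T : measurableType d) (P : probability T R)
    (e : nat -> {RV P >-> ne.-tuple R})
    (eps : nat -> {RV P >-> neps.-tuple R})
    (u : nat -> T -> 'cV[R]_m) (y : nat -> T -> 'cV[R]_p)
    (RN : nat -> T -> 'I_q -> 'M[R[i]]_(p, m))
    (Rstar : 'I_q -> 'M[R[i]]_(p, m)),
  proper_mx Hu ->
  closed_loop_stable G H Gu Hu ->
  iid e -> zero_mean_unit_cov e -> finite_fourth_moments e ->
  iid eps -> zero_mean_unit_cov eps -> finite_fourth_moments eps ->
  independent_processes e eps ->
  (forall t x, y t x = filt G (u ^~ x) t + filt H (vec e ^~ x) t) ->
  (forall t x, u t x = filt Gu (y ^~ x) t + filt Hu (vec eps ^~ x) t) ->
  quasistationary P u ->
  persistently_exciting P n0 (fun t x => filt Hu (vec eps ^~ x) t) ->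
  {ae P, forall x, \forall N \near \oo,
     is_argmin (sample_cost mu N (y ^~ x) (u ^~ x)) (RN N x)} ->
  is_argmin (asymptotic_cost P mu y u) Rstar ->
  forall eta : R, 0 < eta ->
  {ae P, forall x,
     (fun N : nat =>
        H2norm (fun z => pole_model mu (RN N x) z - pole_model mu Rstar z)
          / N%:R `^ (- 2^-1 + eta)) @ \oo --> (0 : R)}.
Proof.
have pGu := proper_mx_entries Gu_proper.
have pH := proper_mx_entries H_stable.1.
have pG := proper_mx_entries G_stable.1.
have spG i j : vanish_inf 1 (G i j) by exact: reldeg_ge_vanish_inf.
pose M := 1%:M - Gu *m G.
have uM : M \in unitmx by exact: return_difference_unit.
have pM : proper_entries M by exact: proper_return_difference.
have [dM [NM [dM0 ME]]] := common_denominator M.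
exists (probe_order mu dM NM).
move=> neps Hu d T P e eps u y RN Rstar Hu_proper [sA sB sYA sYB].
move=> ie ce me ieps ceps meps indep yE uE _ PE minN mins eta eta0.
have pHu := proper_mx_entries Hu_proper.
have WN := white_noise_noise ie ieps indep ce ceps me meps.
pose S := invmx M.
pose A := S *m Gu *m H; pose B := S *m Hu.
have pA : proper_entries A := proper_mx_entries sA.1.
have pB : proper_entries B := proper_mx_entries sB.1.
have MA : M *m A = Gu *m H by rewrite /A !mulmxA mulmxV// mul1mx.
have MB : M *m B = Hu by rewrite /B mulmxA mulmxV// mul1mx.
have uAB t x : u t x = filt A (vec e ^~ x) t + filt B (vec eps ^~ x) t.
  exact: (loop_unique pH pGu spG pA pB MA MB (fun t => yE t x) (fun t => uE t x)).
have yAB t x : y t x = filt (G *m S *m Gu *m H + H) (vec e ^~ x) t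
    + filt (G *m S *m Hu) (vec eps ^~ x) t.
  rewrite yE (_ : u ^~ x = fun t => filt A (vec e ^~ x) t + filt B (vec eps ^~ x) t); last first.
    by apply/funext => s; exact: uAB.
  rewrite filt_add !filt_comp// addrAC /A /B !mulmxA filtD//.
  by have := proper_entriesM pG pA; rewrite /A !mulmxA.
pose uc := loop_coef A B; pose yc := loop_coef (G *m S *m Gu *m H + H) (G *m S *m Hu).
pose W := noise e eps.
have uS t x j : u t x j 0 = sig W (uc j) t x by rewrite uAB; exact: filt_noise.
have yS t x i : y t x i 0 = sig W (yc i) t x by rewrite yAB; exact: filt_noise.
have du j c : expdecay ((uc j)^~ c) by exact: expdecay_loop_coef.
have dy i c : expdecay ((yc i)^~ c) by exact: expdecay_loop_coef.
have dR (l : 'I_p * bool) w c : expdecay ((regressor_coef mu uc l w)^~ c).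
  exact: expdecay_regressor_coef.
have dY l c : expdecay ((output_coef yc l)^~ c) by exact: expdecayZ.
(* A residue direction invisible in the regressors filters the probing signal
   to zero, hence is excluded by persistent excitation. *)
have inj (th : residue_index p m q -> R) :
    (forall l s c, \sum_w th w * regressor_coef mu uc l w s c = 0) -> forall w, th w = 0.
  move=> th0.
  have cz i k j : Complex (th (k, i, j, false)) (th (k, i, j, true)) = 0.
    pose c k j := Complex (th (k, i, j, false)) (th (k, i, j, true)).
    pose g := probe_poly mu dM NM c.
    have gann x t : \sum_i shift_op (g i)
        (fun t => (filt Hu (vec eps ^~ x) t i 0)%:C%C) t = 0.
      (* The response of the input to [eps] alone. It is driven through the same coefficients [uc],
         so the vanishing regressor applies to it, and the return difference maps it to the probing
         signal. *)
      pose v t := filt B (vec eps ^~ x) t.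
      apply: (shift_op_probe_poly pM dM0 ME (u := v)) => [s|s].
        by rewrite /v filt_comp// MB.
      have vS t' j' : v t' j' 0 = sig (fun t c x => if c is inr b then vec eps t x b 0 else 0)
          (uc j') t' x by exact: filt_probe.
      exact: (regressor_combination0 i s vS th0).
    have sg i' := size_probe_poly mu dM NM c i'.
    have rE t x i' : filt Hu (vec eps ^~ x) t i' 0 = sig W (loop_coef 0 Hu i') t x.
      by rewrite -filt_noise filt0 add0r.
    have part0 (part : R[i] -> R) : {morph part : x y / x + y} ->
        (forall z r, part (z * r%:C%C) = part z * r) ->
        forall i', map_poly part (g i') = 0.
      move=> pD pZ; apply: (persistently_exciting_annihilator WN rE PE) => [i'|x t].
        exact: leq_trans (size_poly _ _) (sg i').
      have p0 : part 0 = 0 by rewrite -[0 in LHS](mul0r (0%:C)%C) pZ mulr0.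
      under eq_bigr do rewrite -shift_op_part//.
      by rewrite -(big_morph part pD p0) gann p0.
    have g0 i' : g i' = 0.
      apply: poly_ReIm_eq0; apply: part0.
      - by move=> [a b] [a' b'].
      - by move=> [a b] r /=; rewrite mulr0 subr0.
      - by move=> [a b] [a' b'].
      - by move=> [a b] r /=; rewrite mulr0 add0r.
    exact: (probe_poly_eq0 mu_inj dM0 ME uM g0 k j).
  by case=> [[[k i] j] b]; have [] := cz i k j; case: b.
have [C C0 hC] := @H2norm_pole_model_le _ p m q mu mu_disc.
(* Smaller than [eta], to leave a negative power of [N] in the quotient, and at most 1/4, to stay
   below the 1/2 required by the least-squares rate. *)
pose eta' := Num.min (eta / 2) (4^-1).
have eta'0 : 0 < eta' by rewrite lt_min; apply/andP; split; lra.
have eta'1 : eta' < 1 / 2 by rewrite gt_min; apply/orP; right; lra.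
have eta'2 : eta' < eta by rewrite gt_min; apply/orP; left; lra.
have cost Rk := asymptotic_cost_quad Rk WN mu_disc dy du yS uS.
have rate : {ae P, forall x, exists K : R, \forall N \near \oo,
    \sum_w `|residue_coord (RN N x) w - residue_coord Rstar w| <=
      K * N%:R `^ (- 2^-1 + eta')}.
  apply: (least_squares_rate WN dY dR inj (thN := fun N x => residue_coord (RN N x))
    eta'0 eta'1).
    by move=> th; have := mins (residue_of_coord th); rewrite !cost residue_of_coordK lee_fin.
  apply: filterS minN => x; apply: filterS => N mN th.
  have := mN (residue_of_coord th); rewrite /sample_cost.
  have sq Rk : \sum_(t < N) sqerror mu (y ^~ x) (u ^~ x) Rk t = \sum_(t < N)
      residual_sqr W (output_coef yc) (regressor_coef mu uc) (residue_coord Rk) t x.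
    apply: eq_bigr => t _.
    by apply: sqerror_residual_sqr => s k; [exact: yS|exact: uS].
  by rewrite !sq residue_of_coordK.
apply: filterS rate => x [K hK].
(* The quotient is at most [C |K| N^-(eta - eta')]; the absolute value is taken since the
   path-dependent [K] comes without a sign. *)
have hz : (fun N : nat => C * `|K| * N%:R `^ (- (eta - eta'))) @ \oo --> (0 : R).
  rewrite -(mulr0 (C * `|K|)); apply: cvg_scale; apply/cvgr0Pnorm_le => e' e'0.
  apply: filterS (powR_le_near (s := eta - eta') _ e'0); last by rewrite subr_gt0.
  by move=> N; rewrite ger0_norm// powR_ge0.
apply: (squeeze_cvgr _ (cvg_cst 0) hz).
near=> N.
have N0 : 0 < N%:R :> R by rewrite ltr0n; near: N; exact: nbhs_infty_gt.
have pN a : 0 < N%:R `^ a :> R by exact: powR_gt0.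
apply/andP; split; first by rewrite divr_ge0 ?H2norm_ge0// ltW.
rewrite ler_pdivrMr//; apply: (le_trans (hC _ _)); rewrite -!mulrA; apply: ler_wpM2l => //.
have hN : \sum_w `|residue_coord (RN N x) w - residue_coord Rstar w| <=
      K * N%:R `^ (- 2^-1 + eta') by near: N.
apply: (le_trans hN); rewrite -powRD; last by rewrite (gt_eqF N0) implybT.
have -> : - (eta - eta') + (- 2^-1 + eta) = - 2^-1 + eta' by ring.
by apply: ler_wpM2r; [exact: ltW|exact: ler_norm].
Unshelve. all: by end_near.
Qed.
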